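(* Let $d\ge2$ and $1\le r\le d$ be integers. Let $F(x)=\mathbb{E}_{\xi\sim\mathcal{D}}[f(x,\xi)]$, $F:\mathbb{R}^d\to\mathbb{R}$, be differentiable, bounded below with $F_*:=\inf_xF(x)>-\infty$, and $L$-smooth for some $L>0$, i.e. $\|\nabla F(x)-\nabla F(y)\|\le L\|x-y\|$ for all $x,y\in\mathbb{R}^d$. Let $\mathbb{L}\in\mathbb{R}^{d\times d}$ be a nonzero symmetric positive semidefinite matrix such that for all $x,y\in\mathbb{R}^d$, $$F(y)-F(x)-\langle\nabla F(x),y-x\rangle\le\tfrac12(y-x)^\top\mathbb{L}(y-x).$$ Assume $\mathbb{E}[\nabla f(x,\xi)]=\nabla F(x)$ for all $x\in\mathbb{R}^d$ and that for some $p\in(1,2]$ and $\sigma\ge0$, $\mathbb{E}[\|\nabla f(x,\xi)-\nabla F(x)\|^p]\le\sigma^p$ for all $x\in\mathbb{R}^d$. Let $T\ge1$ be an integer, $B>0$, $q>0$, $\eta>0$, $u\in(0,1)$, and set $\bar B=\lceil\max\{1,BT^q\}\rceil$, $\bar\eta=\eta T^{-u}$. Let $\{x_k\}_{k\ge0}$ be generated from $x_0\in\mathbb{R}^d$ by RS-NSGD with stepsize $\bar\eta$ and minibatch size $\bar B$, and put $\Delta_0:=F(x_0)-F_*$. Then $$\frac1T\sum_{k=0}^{T-1}\mathbb{E}[\|\nabla F(x_k)\|]\le\frac{\Delta_0}{\tau\eta T^{1-u}}+\frac{\eta\,\ell(\mathbb{L})\|\mathbb{L}\|}{2\tau T^u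}+\frac{4\sigma}{\max\{1,BT^q\}^{(p-1)/p}}.$$
   Context: $\|\cdot\|$ is the Euclidean norm on vectors and the induced operator norm on matrices. $\nabla f(x,\xi)$ denotes the gradient in $x$ (assumed to exist and be jointly measurable). Haar matrix: a random $d\times r$ matrix $P$ equal to $\sqrt{d/r}$ times the first $r$ columns of a Haar-distributed random orthogonal matrix in $O(d)$. Thus $UP$ has the same law as $P$ for every $U\in O(d)$, $\mathbb{E}[PP^\top]=I_d$, $P^\top P=\frac dr I_r$, and $\|P^\top x\|>0$ almost surely for each fixed $x\neq0$. RS-NSGD (randomized subspace normalized SGD): $x_0$ is deterministic; at iteration $k=0,1,\dots$ one draws a Haar matrix $P_k\in\mathbb{R}^{d\times r}$ and i.i.d. samples $\xi_k^1,\dots,\xi_k^{\bar B}\sim\mathcal{D}$, all independent of each other and of the past iterations, sets $g_k=\frac1{\bar B}\sum_{j=1}^{\bar B}\nabla f(x_k,\xi_k^j)$, and updates $x_{k+1}=x_k-\bar\eta\,\frac{P_kP_k^\top g_k}{\|P_k^\top g_k\|}$ if $P_k^\top g_k\ne0$, and $x_{k+1}=x_k$ if $P_k^\top g_k=0$. The constant $\tau$ is $$\tau=\sqrt{\frac dr}\,\frac{\Gamma\left(\frac{r+1}{2}\right)\Gamma\left(\frac d2\right)}{\Gamma\left(\frac r2\right)\Gamma\left(\frac{d+1}{2}\right)}.$$ For a nonzero positive semidefinite $S\in\mathbb{R}^{d\times d}$, the effective rank is $r_{\mathrm{eff}}(S)=\operatorname{tr}(S)/\|S\|$, and $$\ell(S)=\frac{d(r-1)+r_{\mathrm{eff}}(S)(d-r)}{r(d-1)}.$$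 *)

(* Defs.v *)
From HB Require Import structures.
From mathcomp Require Import all_boot all_order all_algebra.
From mathcomp Require Import all_classical all_reals all_analysis.

Set Implicit Arguments.
Unset Strict Implicit.
Unset Printing Implicit Defensive.

Import Order.TTheory GRing.Theory Num.Theory.
Import numFieldNormedType.Exports.

Local Open Scope classical_set_scope.
Local Open Scope ring_scope.

(* The library norm `|x| on matrices is the maximum norm: it is used here only
   through the topology and differentiability notions it induces. *)
Definition norm2 (R : realType) (n : nat) (x : 'cV[R]_n) : R :=
  Num.sqrt (\sum_i x i ord0 ^+ 2).

Definition dotv (R : realType) (n : nat) (x y : 'cV[R]_n) : R :=
  \sum_i x i ord0 * y i ord0.

Definition quadform (R : realType) (n : nat) (S : 'M[R]_n) (x : 'cV[R]_n) : R :=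
  dotv x (S *m x).

Definition opnorm (R : realType) (m n : nat) (A : 'M[R]_(m, n)) : R :=
  sup [set norm2 (A *m x) | x in [set x : 'cV[R]_n | norm2 x <= 1]].

Definition symmetric_psd (R : realType) (n : nat) (S : 'M[R]_n) : Prop :=
  S^T = S /\ forall x : 'cV[R]_n, 0 <= quadform S x.

Definition grad (R : realType) (n : nat) (F : 'cV[R]_n -> R) (x : 'cV[R]_n) :
  'cV[R]_n := \col_i 'D_(delta_mx i ord0) F x.

(* Borel sigma-algebra on matrices (hence on column vectors). *)
HB.instance Definition _ (R : realType) (m n : nat) :=
  @isMeasurable.Build (sigma_display (@open 'M[R]_(m, n))) 'M[R]_(m, n)
    <<s @open 'M[R]_(m, n) >>
    (@sigma_algebra0 _ setT (@open 'M[R]_(m, n)))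
    (@sigma_algebraC _ (@open 'M[R]_(m, n)))
    (@sigma_algebra_bigcup _ setT (@open 'M[R]_(m, n))).

Definition has_law (R : realType) (d1 d2 : measure_display)
    (Omega : measurableType d1) (T : measurableType d2)
    (Pr : probability Omega R) (X : Omega -> T) (mu : set T -> \bar R) : Prop :=
  measurable_fun setT X /\
  forall A : set T, measurable A -> Pr (X @^-1` A) = mu A.

Definition generated_sigma (d1 d2 : measure_display)
    (Omega : measurableType d1) (T : measurableType d2) (X : Omega -> T) :
  set (set Omega) := preimage_set_system setT X measurable.

Definition mutually_independent (R : realType) (d1 : measure_display)
    (Omega : measurableType d1) (Pr : probability Omega R) (I : eqType)
    (G : I -> set (set Omega)) : Prop :=
  forall (s : seq I) (A : I -> set Omega), uniq s ->
    (forall i, i \in s -> G i (A i)) ->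
    Pr (\bigcap_(i in [set` s]) A i) = (\prod_(i <- s) Pr (A i))%E.

Definition orthogonal_group (R : realType) (d : nat) : set 'M[R]_d :=
  [set U | U^T *m U = 1%:M].

(* Haar probability on O(d), seen as a measure on all matrices concentrated on
   O(d). As O(d) is compact, left invariance characterizes it. *)
Definition is_haar_orthogonal (R : realType) (d : nat)
    (nu : probability 'M[R]_d R) : Prop :=
  nu (@orthogonal_group R d) = 1%E /\
  forall U : 'M[R]_d, orthogonal_group U ->
    forall A : set 'M[R]_d, measurable A -> nu (mulmx U @^-1` A) = nu A.

Definition haar_block (R : realType) (d r : nat) (hr : (r <= d)%N)
    (Q : 'M[R]_d) : 'M[R]_(d, r) :=
  Num.sqrt (d%:R / r%:R) *: colsub (widen_ord hr) Q.

Definition is_haar_matrix (R : realType) (d1 : measure_display)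
    (Omega : measurableType d1) (Pr : probability Omega R) (d r : nat)
    (hr : (r <= d)%N) (P : Omega -> 'M[R]_(d, r)) : Prop :=
  exists2 nu : probability 'M[R]_d R, is_haar_orthogonal nu &
    has_law Pr P (fun A => nu (haar_block hr @^-1` A)).

(* Sigma-algebras of all the draws: inl k stands for the matrix P_k and
   inr (k, j) for the sample xi_k^j. *)
Definition draws_sigma (R : realType) (d1 d2 : measure_display)
    (Omega : measurableType d1) (Xi : measurableType d2) (d r b : nat)
    (P : nat -> Omega -> 'M[R]_(d, r)) (xi : nat -> 'I_b -> Omega -> Xi)
    (i : nat + nat * 'I_b) : set (set Omega) :=
  match i with
  | inl k => generated_sigma (P k)
  | inr kj => generated_sigma (xi kj.1 kj.2)
  end.

(* Iterates for fixed realizations of the draws; gradf x s is the stochastic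
   gradient at the point x for the sample s. *)
Fixpoint rs_nsgd (R : realType) (Xi : Type) (d r b : nat)
    (gradf : 'cV[R]_d -> Xi -> 'cV[R]_d) (step : R) (x0 : 'cV[R]_d)
    (P : nat -> 'M[R]_(d, r)) (xi : nat -> 'I_b -> Xi) (k : nat) : 'cV[R]_d :=
  match k with
  | 0%N => x0
  | k'.+1 =>
    let x := rs_nsgd gradf step x0 P xi k' in
    let g := b%:R^-1 *: \sum_j gradf x (xi k' j) in
    let v := (P k')^T *m g in
    if v == 0 then x else x - (step / norm2 v) *: (P k' *m v)
  end.

Definition Gamma (R : realType) (a : R) : R :=
  \int[@lebesgue_measure R]_(t in `]0, +oo[) (t `^ (a - 1) * expR (- t)).

Definition tau (R : realType) (d r : nat) : R :=
  Num.sqrt (d%:R / r%:R) *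
  (Gamma ((r%:R + 1) / 2) * Gamma (d%:R / 2) /
   (Gamma (r%:R / 2) * Gamma ((d%:R + 1) / 2))).

Definition effective_rank (R : realType) (d : nat) (S : 'M[R]_d) : R :=
  \tr S / opnorm S.

Definition ell (R : realType) (d r : nat) (S : 'M[R]_d) : R :=
  (d%:R * (r%:R - 1) + effective_rank S * (d%:R - r%:R)) /
  (r%:R * (d%:R - 1)).

(* Main.v *)
Require Import Defs.
From HB Require Import structures.
From mathcomp Require Import all_boot all_order all_algebra.
From mathcomp Require Import all_classical all_reals all_analysis.
From mathcomp Require Import measurable_realfun ring lra.

Set Implicit Arguments.
Unset Strict Implicit.
Unset Printing Implicit Defensive.

Import Order.TTheory GRing.Theory Num.Theory.
Import numFieldNormedType.Exports.

Local Open Scope classical_set_scope.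
Local Open Scope ring_scope.

(* At a step with estimate [g = grad F x + e] and [v = P^T g] the displacement is
   a multiple of [P v / |v|], and
   [<P^T grad F x, v / |v|> >= |P^T grad F x| - 2 |P^T e|]; the upper quadratic
   model of [F] thus bounds the decrease of [F] below for every [P].
   Averaging over [P] needs [E |P^T y| = tau |y|] and
   [E quadform S (P v / |v|) <= ell S * opnorm S], which only use the invariance
   of the law of [P] under Householder reflections: rotating [e0] infinitesimally
   gives the recursion [(d + n) c (n + 2) = d / r * (r + n) * c n] for
   [c n = E |P^T e0| ^+ n], and the log-convexity of both [c] and [Gamma] forces
   [c 1 = tau].  The minibatch error is controlled sample by sample by
   [|s + e|^p <= |s|^p + p |s|^(p-2) <s, e> + 2 |e|^p]. *)

(** * Euclidean norm and reflections *)

(** Haar measure is known only through left invariance, so no density of [|P^T e0|] is at hand; its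
    first moment is reached in the spirit of the Bohr-Mollerup theorem, by a functional equation
    plus log-convexity. The recursion is derived for functions bounded on the scaled Stiefel
    manifold, where a second-order remainder estimate uniform in [P] stands in for differentiation
    under the integral. The quadratic bound rests on the second-moment matrix of the normalized
    direction: in a basis starting with [x / |x|] it is diagonal, with entry 1 along [x] and at most
    [(d/r - 1)/(d - 1)] across. Within an iteration the samples are integrated one by one and [P k]
    last, each time given the draws already revealed. Expectations of [F - inf F] are kept as
    nonnegative extended integrals, so their finiteness is a consequence of the descent and not an
    assumption. The final [4] is [2 * 2]: one factor from the alignment bound, one from the moment
    bound on the minibatch error. *)

Section euclidean.
Context {R : realType}.

Section vectors.
Context {n : nat}.
Implicit Types x y z : 'cV[R]_n.

Lemma dotvE x y : dotv x y = (x^T *m y) ord0 ord0.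
Proof. by rewrite !mxE; apply: eq_bigr => i _; rewrite !mxE. Qed.

Lemma dotvC x y : dotv x y = dotv y x.
Proof. by apply: eq_bigr => i _; rewrite mulrC. Qed.

Lemma dotvDl x y z : dotv (x + y) z = dotv x z + dotv y z.
Proof. by rewrite -big_split; apply: eq_bigr => i _; rewrite !mxE mulrDl. Qed.

Lemma dotvDr x y z : dotv x (y + z) = dotv x y + dotv x z.
Proof. by rewrite dotvC dotvDl !(dotvC x). Qed.

Lemma dotvZl a x y : dotv (a *: x) y = a * dotv x y.
Proof. by rewrite mulr_sumr; apply: eq_bigr => i _; rewrite !mxE mulrA. Qed.

Lemma dotvZr a x y : dotv x (a *: y) = a * dotv x y.
Proof. by rewrite dotvC dotvZl dotvC. Qed.

Lemma dotvNl x y : dotv (- x) y = - dotv x y.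
Proof. by rewrite -scaleN1r dotvZl mulN1r. Qed.

Lemma dotvNr x y : dotv x (- y) = - dotv x y.
Proof. by rewrite dotvC dotvNl dotvC. Qed.

Lemma dotvBl x y z : dotv (x - y) z = dotv x z - dotv y z.
Proof. by rewrite dotvDl dotvNl. Qed.

Lemma dotvBr x y z : dotv x (y - z) = dotv x y - dotv x z.
Proof. by rewrite dotvDr dotvNr. Qed.

Lemma dotv0l x : dotv 0 x = 0.
Proof. by rewrite -(scale0r 0) dotvZl mul0r. Qed.

Lemma dotv0r x : dotv x 0 = 0.
Proof. by rewrite dotvC dotv0l. Qed.

Lemma dotv_delta i x : dotv (delta_mx i ord0) x = x i ord0.
Proof.
rewrite /dotv (bigD1 i) //= big1 ?addr0 => [|j ji]; first by rewrite !mxE !eqxx mul1r.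
by rewrite !mxE (negbTE ji) mul0r.
Qed.

Lemma norm2_ge0 x : 0 <= norm2 x. Proof. exact: sqrtr_ge0. Qed.

Lemma sqr_norm2 x : norm2 x ^+ 2 = dotv x x.
Proof.
rewrite sqr_sqrtr; last by apply: sumr_ge0 => i _; rewrite sqr_ge0.
by apply: eq_bigr => i _; rewrite expr2.
Qed.

Lemma dotv_ge0 x : 0 <= dotv x x.
Proof. by rewrite -sqr_norm2 sqr_ge0. Qed.

Lemma norm2_eq0 x : (norm2 x == 0) = (x == 0).
Proof.
apply/idP/eqP => [/eqP nx0|->]; last first.
  by rewrite -sqrf_eq0 sqr_norm2 dotv0l.
have : dotv x x = 0 by rewrite -sqr_norm2 nx0 expr0n.
move/eqP; rewrite /dotv psumr_eq0 => [/allP x0|i _]; last by rewrite -expr2 sqr_ge0.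
apply/matrixP => i j; rewrite ord1 !mxE.
by have := x0 i (mem_index_enum i); rewrite -expr2 sqrf_eq0 => /eqP.
Qed.

Lemma norm2_gt0 x : (0 < norm2 x) = (x != 0).
Proof. by rewrite lt_def norm2_ge0 andbT norm2_eq0. Qed.

Lemma norm20 : norm2 (0 : 'cV[R]_n) = 0.
Proof. by apply/eqP; rewrite norm2_eq0. Qed.

Lemma norm2Z a x : norm2 (a *: x) = `|a| * norm2 x.
Proof.
apply/eqP; rewrite -(@eqrXn2 _ 2) ?norm2_ge0 ?mulr_ge0 ?norm2_ge0//.
by rewrite exprMn !sqr_norm2 dotvZl dotvZr mulrA real_normK ?num_real// expr2.
Qed.

Lemma norm2N x : norm2 (- x) = norm2 x.
Proof. by rewrite -scaleN1r norm2Z normrN1 mul1r. Qed.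

Lemma dotv_le x y : dotv x y <= norm2 x * norm2 y.
Proof.
have [->|x0] := eqVneq x 0; first by rewrite dotv0l norm20 mul0r.
have [->|y0] := eqVneq y 0; first by rewrite dotv0r norm20 mulr0.
have := dotv_ge0 (norm2 y *: x - norm2 x *: y).
rewrite !(dotvBl, dotvBr, dotvZl, dotvZr) (dotvC y x) -!sqr_norm2.
have xy : 0 < norm2 x * norm2 y by rewrite mulr_gt0// norm2_gt0.
set a := norm2 x in xy *; set b := norm2 y in xy *; set c := dotv x y => h.
have {}h : 0 <= (a * b) * (2 * (a * b - c)) by lra.
by move: h; rewrite pmulr_rge0//; lra.
Qed.

Lemma norm_dotv_le x y : `|dotv x y| <= norm2 x * norm2 y.
Proof.
by rewrite ler_norml dotv_le andbT lerNl -dotvNl -[norm2 x]norm2N dotv_le.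
Qed.

Lemma ler_norm2D x y : norm2 (x + y) <= norm2 x + norm2 y.
Proof.
rewrite -(@ler_pXn2r _ 2) ?nnegrE ?norm2_ge0 ?addr_ge0 ?norm2_ge0//.
rewrite sqr_norm2 dotvDl !dotvDr -!sqr_norm2 (dotvC y x).
by have := dotv_le x y; lra.
Qed.

Lemma entry_le_norm2 x i : `|x i ord0| <= norm2 x.
Proof.
rewrite -(@ler_pXn2r _ 2) ?nnegrE ?norm2_ge0// sqr_norm2 real_normK ?num_real//.
rewrite /dotv (bigD1 i)//= -expr2 lerDl; apply: sumr_ge0 => j _.
by rewrite -expr2 sqr_ge0.
Qed.

End vectors.

Lemma dotv_mulmxl (m n : nat) (A : 'M[R]_(m, n)) (x : 'cV[R]_n) (y : 'cV[R]_m) :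
  dotv (A *m x) y = dotv x (A^T *m y).
Proof. by rewrite !dotvE trmx_mul mulmxA. Qed.

Lemma dotv_mulmxr (m n : nat) (A : 'M[R]_(m, n)) (x : 'cV[R]_n) (y : 'cV[R]_m) :
  dotv y (A *m x) = dotv (A^T *m y) x.
Proof. by rewrite dotvC dotv_mulmxl dotvC. Qed.

(** A crude Frobenius bound by Cauchy-Schwarz on each row. It shows that the set whose [sup] defines
    [opnorm] is bounded above, without which [sup] carries no information. *)
Lemma norm2_row_bound (m n : nat) (A : 'M[R]_(m, n)) (x : 'cV[R]_n) :
  norm2 (A *m x) <= Num.sqrt (\sum_i norm2 (row i A)^T ^+ 2) * norm2 x.
Proof.
set c := \sum_i _; have c0 : 0 <= c by apply: sumr_ge0 => i _; exact: sqr_ge0.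
rewrite -(@ler_pXn2r _ 2) ?nnegrE ?norm2_ge0 ?mulr_ge0 ?norm2_ge0 ?sqrtr_ge0//.
rewrite sqr_norm2 exprMn (sqr_sqrtr c0) mulr_suml; apply: ler_sum => i _.
have -> : (A *m x) i ord0 = dotv (row i A)^T x.
  by rewrite !mxE; apply: eq_bigr => j _; rewrite !mxE.
rewrite -expr2 -exprMn -(real_normK (num_real (dotv _ _))).
by rewrite ler_pXn2r ?nnegrE ?mulr_ge0 ?norm2_ge0// norm_dotv_le.
Qed.

Lemma norm2_mulmx_le (m n : nat) (A : 'M[R]_(m, n)) (x : 'cV[R]_n) :
  norm2 (A *m x) <= opnorm A * norm2 x.
Proof.
set S := [set norm2 (A *m z) | z in [set z : 'cV[R]_n | norm2 z <= 1]].
have Sub : has_ubound S.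
  exists (Num.sqrt (\sum_i norm2 (row i A)^T ^+ 2)) => _ [z /= z1 <-].
  by rewrite (le_trans (norm2_row_bound A z))// ler_piMr// sqrtr_ge0.
have [->|x0] := eqVneq x 0; first by rewrite mulmx0 norm20 norm20 mulr0.
have nx : 0 < norm2 x by rewrite norm2_gt0.
have Sx : S (norm2 (A *m ((norm2 x)^-1 *: x))).
  exists ((norm2 x)^-1 *: x) => //=.
  by rewrite norm2Z ger0_norm ?invr_ge0 ?norm2_ge0// mulVf ?gt_eqF.
have := ub_le_sup Sub Sx.
rewrite -scalemxAr norm2Z ger0_norm ?invr_ge0 ?norm2_ge0//.
by rewrite mulrC ler_pdivrMr.
Qed.

Lemma opnorm_ge0 (m n : nat) (A : 'M[R]_(m, n)) : 0 <= opnorm A.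
Proof.
have [[x [xn0]]|none] := pselect (exists x : 'cV[R]_n, x != 0 /\ norm2 x <= 1).
  move=> _; have := norm2_mulmx_le A x; move/(le_trans (norm2_ge0 _)).
  by rewrite pmulr_lge0// norm2_gt0.
(* Rescaling would put any nonzero vector in the unit ball, so the space is trivial and the supremum
   runs over [[set 0]]. *)
have x0 (x : 'cV[R]_n) : x = 0.
  have [//|xn0] := eqVneq x 0; exfalso; apply: none.
  have nx : 0 < norm2 x by rewrite norm2_gt0.
  exists ((norm2 x)^-1 *: x); split; first by rewrite scaler_eq0 negb_or invr_eq0 gt_eqF.
  by rewrite norm2Z ger0_norm ?invr_ge0 ?norm2_ge0// mulVf ?gt_eqF.
rewrite /opnorm (_ : [set _ | _ in _] = [set 0]) ?sup1//.
apply/seteqP; split => [_ [z _ <-]|_ ->] /=; first by rewrite (x0 z) mulmx0 norm20.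
by exists 0 => /=; rewrite ?norm20 ?ler01// mulmx0 norm20.
Qed.

Lemma quadform_le (n : nat) (S : 'M[R]_n) (x : 'cV[R]_n) :
  quadform S x <= opnorm S * norm2 x ^+ 2.
Proof.
rewrite (le_trans (dotv_le _ _))// expr2 mulrA [leRHS]mulrC ler_wpM2l ?norm2_ge0//.
exact: norm2_mulmx_le.
Qed.

Lemma opnorm_gt0 (n : nat) (S : 'M[R]_n) : S != 0 -> 0 < opnorm S.
Proof.
move=> S0; rewrite lt_def opnorm_ge0 andbT; apply: contra S0 => /eqP nS.
apply/eqP/matrixP => i j; rewrite [RHS]mxE.
have := norm2_mulmx_le S (delta_mx j ord0); rewrite nS mul0r => h.
have : norm2 (S *m delta_mx j ord0) == 0 by rewrite eq_le h norm2_ge0.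
rewrite norm2_eq0 => /eqP/matrixP/(_ i ord0).
by rewrite -colE !mxE.
Qed.

Section reflection.
Context {d : nat}.
Implicit Types a x : 'cV[R]_d.

(** Householder reflection across the hyperplane orthogonal to [a]. At [a = 0] it is the identity,
    so it is orthogonal for every [a]. *)
Definition reflection a : 'M[R]_d := 1%:M - (2 / dotv a a) *: (a *m a^T).

Lemma reflectionE a x : reflection a *m x = x - (2 * dotv a x / dotv a a) *: a.
Proof.
rewrite mulmxBl mul1mx -scalemxAl -mulmxA.
have -> : a^T *m x = (dotv a x)%:M.
  by apply/matrixP => i j; rewrite !ord1 dotvE !mxE eqxx mulr1n.
by rewrite mul_mx_scalar scalerA mulrAC.
Qed.

Lemma reflection_tr a : (reflection a)^T = reflection a.
Proof. by rewrite /reflection linearB /= trmx1 linearZ /= trmx_mul trmxK. Qed.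

Lemma reflectionK a x : reflection a *m (reflection a *m x) = x.
Proof.
have [->|a0] := eqVneq a 0.
  by rewrite !reflectionE !scaler0 !subr0.
have a2 : dotv a a != 0 by rewrite -sqr_norm2 sqrf_eq0 norm2_eq0.
rewrite !reflectionE dotvBr dotvZr -addrA -opprD -scalerDl.
rewrite [X in X *: a](_ : _ = 0) ?scale0r ?subr0//; field.
exact: a2.
Qed.

Lemma reflection_orthogonal a : orthogonal_group (reflection a).
Proof.
rewrite /orthogonal_group /= reflection_tr; apply/matrixP => i j.
have := congr1 (fun v : 'cV_d => v i ord0) (reflectionK a (delta_mx j ord0)).
by rewrite /= mulmxA -colE mxE => ->; rewrite !mxE eqxx andbT.
Qed.

Lemma reflection_self a : reflection a *m a = - a.
Proof.
have [->|a0] := eqVneq a 0; first by rewrite mulmx0 oppr0.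
have a2 : dotv a a != 0 by rewrite -sqr_norm2 sqrf_eq0 norm2_eq0.
by rewrite reflectionE mulfK// scalerDl scale1r opprD addrA subrr add0r.
Qed.

Lemma reflection_orth a x : dotv a x = 0 -> reflection a *m x = x.
Proof. by move=> ax; rewrite reflectionE ax mulr0 mul0r scale0r subr0. Qed.

(** Equal norms give [2 <x - y, x> = |x - y|^2]. Hence reflections are transitive on spheres, which
    lets any unit vector be exchanged with [e0]. *)
Lemma reflection_swap x y :
  dotv x x = dotv y y -> reflection (x - y) *m x = y.
Proof.
move=> xy; have [->|ne] := eqVneq x y.
  by rewrite subrr reflection_orth ?dotv0l.
have a2 : dotv (x - y) (x - y) != 0 by rewrite -sqr_norm2 sqrf_eq0 norm2_eq0 subr_eq0.
have eq2 : 2 * dotv (x - y) x = dotv (x - y) (x - y).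
  by rewrite !dotvBl !dotvBr -xy (dotvC y x); ring.
by rewrite reflectionE eq2 divff// scale1r opprB addrCA subrr addr0.
Qed.

End reflection.
End euclidean.

(** * Borel measurability of matrix operations *)

Section matrix_measurability.
Context {R : realType}.

Lemma continuous_measurable_mx (m n : nat) (f : 'M[R]_(m, n) -> R) :
  continuous f -> measurable_fun setT f.
Proof.
move=> /continuousP cf.
apply: (measurability _ (RGenOpens.measurableE R)).
move=> _ [_ [a [b ->]] <-]; rewrite setTI.
by apply: sub_sigma_algebra; apply: cf; exact: interval_open.
Qed.

Lemma measurable_mx_entry (m n : nat) (i : 'I_m) (j : 'I_n) :
  measurable_fun setT (fun A : 'M[R]_(m, n) => A i j).
Proof. by apply: continuous_measurable_mx; exact: coord_continuous. Qed.

(** Cubes with rational centres and radii [1/(k+1)] form a countable base. The sigma-algebra on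
    matrices is generated by open sets, so going from measurable entries to a measurable matrix
    requires writing each open set as a countable union of such cubes. *)
Let box (m n : nat) (q : 'M[rat]_(m, n)) (k : nat) : set 'M[R]_(m, n) :=
  [set A | forall i j, `|A i j - ratr (q i j)| < k.+1%:R^-1].

Let open_box (m n : nat) (U : set 'M[R]_(m, n)) A : open U -> U A ->
  exists q k, box q k `<=` U /\ box q k A.
Proof.
rewrite openE => /[apply] /nbhs_ballP [e /= e0 AeU].
(* The centre lies within one radius of [A], so a radius below [e / 2] keeps the cube inside the
   [e]-ball around [A]. *)
have [k ke] : exists k : nat, k.+1%:R^-1 < e / 2.
  have [k _ /(_ k (leqnn _))] := near_infty_natSinv_lt (PosNum (divr_gt0 e0 (ltr0n _ 2))).
  by exists k.
have /choice [q qP] : forall ij : 'I_m * 'I_n, exists q : rat,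
    `|A ij.1 ij.2 - ratr q| < k.+1%:R^-1 :> R.
  move=> [i j] /=; have k0 : 0 < k.+1%:R^-1 :> R by rewrite invr_gt0.
  move: (k.+1%:R^-1 : R) k0 => c c0.
  have [|q] := @rat_in_itvoo R (A i j - c) (A i j + c); first by lra.
  by rewrite in_itv /= => /andP[q1 q2]; exists q; rewrite ltr_norml; apply/andP; split; lra.
exists (\matrix_(i, j) q (i, j)), k; split; last first.
  by move=> i j; rewrite mxE; exact: (qP (i, j)).
move=> M Mb; apply: AeU; split=> // i j.
rewrite -ball_normE /=; have := Mb i j; rewrite mxE; have := qP (i, j) => /=.
move: (k.+1%:R^-1 : R) ke => c ce.
by rewrite !ltr_norml => /andP[? ?] /andP[? ?]; apply/andP; split; lra.
Qed.

Lemma measurable_to_mx (d : measure_display) (T : measurableType d) (m n : nat)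
    (f : T -> 'M[R]_(m, n)) :
  (forall i j, measurable_fun setT (fun t => f t i j)) -> measurable_fun setT f.
Proof.
move=> mf.
have mbox q k : measurable (f @^-1` box q k).
  rewrite (_ : _ @^-1` _ = \bigcap_i \bigcap_j
      ((fun t => f t i j) @^-1` [set x | `|x - ratr (q i j)| < k.+1%:R^-1])).
    apply: fin_bigcap_measurable => // i _; apply: fin_bigcap_measurable => // j _.
    rewrite -[X in measurable X]setTI; apply: mf => //.
    rewrite -[X in measurable X]setTI.
    have -> : [set x : R | `|x - ratr (q i j)| < k.+1%:R^-1] =
              `]ratr (q i j) - k.+1%:R^-1, ratr (q i j) + k.+1%:R^-1[%classic.
      by apply/seteqP; split=> x /=; rewrite in_itv /= ltr_distl.
    by rewrite setTI; exact: measurable_itv.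
  by apply/seteqP; split => t /= h; [move=> i _ j _; exact: h|move=> i j; exact: h].
apply: (measurability (@open 'M[R]_(m, n))) => //.
move=> _ [U oU <-]; rewrite setTI.
rewrite (_ : f @^-1` U = \bigcup_(qk : 'M[rat]_(m, n) * nat)
  (if pselect (box qk.1 qk.2 `<=` U) then f @^-1` box qk.1 qk.2 else set0)).
  apply: countable_bigcupT_measurable => [|[q k]] /=; last first.
    by case: pselect => _ /=; [exact: mbox|exact: measurable0].
  exact: countableP.
apply/seteqP; split => [t /= Ut|t [[q k] _] /=]; last by case: pselect => // h /h.
have [q [k [qU qt]]] := open_box oU Ut.
by exists (q, k) => //=; case: pselect.
Qed.

Section operations.
Context {d : measure_display} {T : measurableType d}.

Lemma measurable_mxP (m n : nat) (f : T -> 'M[R]_(m, n)) :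
  measurable_fun setT f <-> forall i j, measurable_fun setT (fun t => f t i j).
Proof.
split => [mf i j|]; last exact: measurable_to_mx.
exact: (measurableT_comp (measurable_mx_entry i j) mf).
Qed.

Lemma measurable_sumR (I : Type) (s : seq I) (f : I -> T -> R) :
  (forall i, measurable_fun setT (f i)) ->
  measurable_fun setT (fun t => \sum_(i <- s) f i t).
Proof. by move=> mf; apply: measurable_sum. Qed.

Lemma measurable_mulmx (m n p : nat) (f : T -> 'M[R]_(m, n)) (g : T -> 'M[R]_(n, p)) :
  measurable_fun setT f -> measurable_fun setT g ->
  measurable_fun setT (fun t => f t *m g t).
Proof.
move=> /measurable_mxP mf /measurable_mxP mg; apply/measurable_mxP => i j.
under eq_fun do rewrite mxE.
by apply: measurable_sumR => k; exact: measurable_funM.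
Qed.

Lemma measurable_trmx (m n : nat) (f : T -> 'M[R]_(m, n)) :
  measurable_fun setT f -> measurable_fun setT (fun t => (f t)^T).
Proof.
move=> /measurable_mxP mf; apply/measurable_mxP => i j.
by under eq_fun do rewrite mxE; exact: mf.
Qed.

Lemma measurable_addmx (m n : nat) (f g : T -> 'M[R]_(m, n)) :
  measurable_fun setT f -> measurable_fun setT g ->
  measurable_fun setT (fun t => f t + g t).
Proof.
move=> /measurable_mxP mf /measurable_mxP mg; apply/measurable_mxP => i j.
by under eq_fun do rewrite mxE; exact: measurable_funD.
Qed.

Lemma measurable_scalemx (m n : nat) (a : T -> R) (f : T -> 'M[R]_(m, n)) :
  measurable_fun setT a -> measurable_fun setT f ->
  measurable_fun setT (fun t => a t *: f t).
Proof.
move=> ma /measurable_mxP mf; apply/measurable_mxP => i j.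
by under eq_fun do rewrite mxE; exact: measurable_funM.
Qed.

Lemma measurable_subm (m n : nat) (f g : T -> 'M[R]_(m, n)) :
  measurable_fun setT f -> measurable_fun setT g ->
  measurable_fun setT (fun t => f t - g t).
Proof.
move=> mf mg; apply: measurable_addmx => //.
under eq_fun do rewrite -scaleN1r.
exact: measurable_scalemx.
Qed.

Lemma measurable_dotv (n : nat) (f g : T -> 'cV[R]_n) :
  measurable_fun setT f -> measurable_fun setT g ->
  measurable_fun setT (fun t => dotv (f t) (g t)).
Proof.
move=> /measurable_mxP mf /measurable_mxP mg.
by apply: measurable_sumR => k; exact: measurable_funM.
Qed.

Lemma measurable_norm2 (n : nat) (f : T -> 'cV[R]_n) :
  measurable_fun setT f -> measurable_fun setT (fun t => norm2 (f t)).
Proof.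
move=> mf; under eq_fun do rewrite /norm2.
apply: (measurableT_comp (continuous_measurable_fun (@sqrt_continuous R))).
by move/measurable_mxP: mf => mf; apply: measurable_sumR => k; exact: measurable_funX.
Qed.

Lemma measurable_quadform (n : nat) (S : 'M[R]_n) (f : T -> 'cV[R]_n) :
  measurable_fun setT f -> measurable_fun setT (fun t => quadform S (f t)).
Proof.
by move=> mf; apply: measurable_dotv => //; exact: measurable_mulmx.
Qed.

(** The inverse is discontinuous at 0, but on nonnegative reals it is the power with exponent -1,
    which is measurable, value 0 at 0 included. *)
Lemma measurable_norm2_inv (n : nat) (f : T -> 'cV[R]_n) :
  measurable_fun setT f -> measurable_fun setT (fun t => (norm2 (f t))^-1).
Proof.
move=> mf; under eq_fun do rewrite -powR_inv1 ?norm2_ge0//.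
exact: (measurableT_comp (measurable_powR _) (measurable_norm2 mf)).
Qed.

End operations.
End matrix_measurability.

(** * The Gamma function at half-integers *)

Section improper_ftc.
Context {R : realType}.
Local Notation mu := (@lebesgue_measure R).
Implicit Types f F : R -> R.

Let derive1_of f F x : is_derive x (1 : R) F (f x) -> derive1 F x = f x.
Proof. by move=> h; rewrite derive1E derive_val. Qed.

Let continuous_of f F x : is_derive x (1 : R) F (f x) -> {for x, continuous F}.
Proof.
by move=> h; apply: differentiable_continuous; apply/derivable1_diffP; exact: ex_derive.
Qed.

Lemma continuous_gt0_measurable (A : set R) f : measurable A ->
  (forall x, A x -> 0 < x) -> (forall x : R, 0 < x -> {for x, continuous f}) ->
  measurable_fun A f.
Proof.
move=> mA A0 cf; apply: (@measurable_funS _ _ _ _ (`]0%R, +oo[%classic : set R)) => //.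
  by move=> x /A0 /=; rewrite in_itv /= andbT.
apply: open_continuous_measurable_fun; first exact: interval_open.
by move=> x; rewrite inE /= in_itv /= andbT => /cf.
Qed.

(** The integrand may blow up at 0, so the interval is exhausted by [[c/(k+2), c]] and monotone
    convergence applied; the primitive has only a right limit [l] at 0. The shift by 2 keeps the
    left endpoint strictly below [c]. *)
Lemma ge0_FTC_itvoc0 f F (c l : R) : 0 < c ->
  (forall x : R, 0 < x <= c -> 0 <= f x) ->
  (forall x : R, 0 < x -> {for x, continuous f}) ->
  (forall x : R, 0 < x -> is_derive x (1 : R) F (f x)) ->
  F x @[x --> 0^'+] --> l ->
  (\int[mu]_(x in `]0%R, c]) (f x)%:E = (F c - l)%:E)%E.
Proof.
move=> c0 f0 cf dF Fl.
pose a (k : nat) := c / k.+2%:R.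
have a0 k : 0 < a k by rewrite divr_gt0.
have ac k : a k < c by rewrite ltr_pdivrMr// ltr_pMr// ltr1n.
pose A k := `[a k, c]%classic.
have UA : \bigcup_k A k = `]0, c]%classic.
  apply/seteqP; split => [x [k _]|x]; rewrite /A /= !in_itv /=.
    by move=> /andP[ax xc]; rewrite xc (lt_le_trans (a0 k) ax).
  move=> /andP[x0 xc]; have cx0 : 0 < x / c by rewrite divr_gt0.
  have [k _ /(_ k (leqnn _))] := near_infty_natSinv_lt (PosNum cx0).
  rewrite /= => kx; exists k => //=; rewrite in_itv /= xc andbT /a.
  rewrite mulrC -ler_pdivlMr// ltW// (le_lt_trans _ kx)//.
  by rewrite lef_pV2 ?posrE// ler_nat.
have intA k : (\int[mu]_(x in A k) (f x)%:E = (F c - F (a k))%:E)%E.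
  rewrite EFinB (@continuous_FTC2 _ f F)//.
  - apply: continuous_in_subspaceT => x; rewrite inE /= in_itv /= => /andP[ax _].
    by apply: cf; exact: lt_le_trans ax.
  - split=> [x|  |].
    + by rewrite in_itv /= => /andP[ax _]; have h := dF x (lt_trans (a0 k) ax); exact: ex_derive.
    + by apply: cvg_at_right_filter; exact: (continuous_of (dF _ (a0 k))).
    + by apply: cvg_at_left_filter; exact: (continuous_of (dF _ c0)).
  - move=> x; rewrite in_itv /= => /andP[ax _].
    by apply: derive1_of; apply: dF; exact: lt_trans ax.
have Acvg : (\int[mu]_(x in A k) (f x)%:E @[k --> \oo] -->
             \int[mu]_(x in `]0%R, c]) (f x)%:E)%E.
  rewrite -UA; apply: ge0_nondecreasing_set_cvg_integral => //.
  - move=> n m nm; apply/subsetPset => x; rewrite /A /= !in_itv /= => /andP[ax ->].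
    by rewrite andbT (le_trans _ ax)// /a ler_pM2l// lef_pV2 ?posrE// ler_nat !ltnS.
  - by move=> k; exact: measurable_itv.
  - move=> k; apply/measurable_EFinP.
    apply: continuous_gt0_measurable => //; first exact: measurable_itv.
    by move=> x; rewrite /A /= in_itv /= => /andP[ax _]; exact: lt_le_trans ax.
  - move=> k x; rewrite /A /= in_itv /= => /andP[ax xc]; rewrite lee_fin f0// xc andbT.
    exact: lt_le_trans ax.
have Fcvg : ((F c - F (a k))%:E @[k --> \oo] --> (F c - l)%:E)%E.
  apply/fine_cvgP; split; first exact: nearW.
  apply: cvgB; first exact: cvg_cst.
  move/cvg_at_rightP : Fl; apply; split=> //.
  rewrite -[X in _ --> X](mulr0 c); apply: cvgM; first exact: cvg_cst.
  apply/cvgrPdist_lt => e e0.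
  have [k _ kP] := near_infty_natSinv_lt (PosNum e0).
  exists k => // n /= kn; rewrite sub0r normrN ger0_norm ?invr_ge0//.
  by apply: (kP n.+1); rewrite /= (leq_trans kn).
apply: (@cvg_unique _ _ (fmap (fun k => \int[mu]_(x in A k) (f x)%:E)%E \oo)).
- exact: ereal_hausdorff.
- exact: Acvg.
- by apply: cvg_trans Fcvg; apply: near_eq_cvg; apply: nearW => k; rewrite intA.
Qed.

Lemma ge0_FTC_itvcy f F (c l : R) : 0 < c ->
  (forall x, c <= x -> 0 <= f x) ->
  (forall x : R, 0 < x -> {for x, continuous f}) ->
  (forall x : R, 0 < x -> is_derive x (1 : R) F (f x)) ->
  F x @[x --> +oo] --> l ->
  (\int[mu]_(x in `]c, +oo[) (f x)%:E = (l - F c)%:E)%E.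
Proof.
move=> c0 f0 cf dF Fl.
have gt0 x : `]c, +oo[%classic x -> 0 < x.
  by rewrite /= in_itv /= andbT; exact: lt_trans.
rewrite EFinB integral_itv_obnd_cbnd; last first.
  by apply/measurable_EFinP; apply: continuous_gt0_measurable.
apply: ge0_continuous_FTC2y => //.
- apply: continuous_in_subspaceT => x; rewrite inE /= in_itv /= andbT => cx.
  by apply: cf; exact: lt_le_trans cx.
- by move=> x cx; have h := dF x (lt_trans c0 cx); exact: ex_derive.
- by apply: cvg_at_right_filter; exact: (continuous_of (dF _ c0)).
- by move=> x xc; apply: derive1_of; apply: dF; exact: gt0.
Qed.

End improper_ftc.

(** Cauchy-Schwarz in linear form: the hypothesis is what integration of [2 x y <= l x^2 + y^2 / l]
    provides, so log-convexity of moments and of [Gamma] follows from monotonicity of the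
    integral. *)
Lemma sqr_le_mul_of_weighted_mean (R : realType) (a b c : R) : 0 <= a -> 0 <= c ->
  (forall l, 0 < l -> 2 * b <= l * a + c / l) -> 0 <= b -> b ^+ 2 <= a * c.
Proof.
move=> a0 c0 h; rewrite le_eqVlt => /predU1P[<-|b0]; first by rewrite expr0n mulr_ge0.
move: a0; rewrite le_eqVlt => /predU1P[a0|a0].
  exfalso; move: h; rewrite -a0 => h.
  move: c0; rewrite le_eqVlt => /predU1P[c0|c0].
    by have := h 1 ltr01; rewrite -c0 mulr0 mul0r addr0; lra.
  have := h (c / b) (divr_gt0 c0 b0).
  by rewrite mulr0 add0r invf_div mulrCA divff ?gt_eqF// mulr1; lra.
(* At [l = b / a] the hypothesis reads [2 b <= b + c a / b]. *)
have := h (b / a) (divr_gt0 b0 a0).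
rewrite -mulrA mulVf ?gt_eqF// mulr1 invf_div mulrA => {}h.
have : b <= c * a / b by lra.
by rewrite ler_pdivlMr// -expr2 mulrC.
Qed.

Section gamma.
Context {R : realType}.
Local Notation mu := (@lebesgue_measure R).
Implicit Types a t : R.

Definition gamma_density a t : R := t `^ (a - 1) * expR (- t).

(** Extended version of [Gamma]. Since [fine] sends [+oo] to 0, the functional equation is proved
    here first, and finiteness is used only in returning to [Gamma]. *)
Definition egamma a : \bar R :=
  (\int[mu]_(t in `]0%R, +oo[) (gamma_density a t)%:E)%E.

Lemma GammaE a : Gamma a = fine (egamma a). Proof. by []. Qed.

Lemma gamma_density_ge0 a t : 0 <= gamma_density a t.
Proof. by rewrite mulr_ge0 ?powR_ge0 ?expR_ge0. Qed.

Let is_derive_primitive a t : 0 < t -> is_derive t (1 : R)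
  (fun t => t `^ a * expR (- t)) (a * gamma_density a t - gamma_density (a + 1) t).
Proof.
move=> t0; have h := is_derive1_powR a t0.
apply: is_derive_eq; rewrite /gamma_density addrK /GRing.scale /=; ring.
Qed.

Let continuous_gamma_density a t : 0 < t -> {for t, continuous (gamma_density a)}.
Proof.
move=> t0; have h := is_derive_primitive (a - 1) t0.
by apply: differentiable_continuous; apply/derivable1_diffP; exact: ex_derive.
Qed.

Lemma measurable_gamma_density a : measurable_fun setT (gamma_density a).
Proof.
apply: measurable_funM; first exact: (measurableT_comp (measurable_powR _)).
by apply: (measurableT_comp (@measurable_expR R)); exact: measurable_funN.
Qed.

Lemma gamma_density_half a t : 0 < t ->
  gamma_density (a + 2^-1) t = Num.sqrt t * gamma_density a t.
Proof.
move=> t0; rewrite /gamma_density (_ : a + _ - 1 = 2^-1 + (a - 1)); last by ring.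
rewrite (@powRD _ t 2^-1 (a - 1)); last by rewrite (gt_eqF t0) implybT.
by rewrite powR12_sqrt ?ltW// mulrA.
Qed.

Lemma gamma_densityD1 a t : 0 < t ->
  gamma_density (a + 1) t = t * gamma_density a t.
Proof.
move=> t0; rewrite /gamma_density (_ : a + 1 - 1 = 1 + (a - 1)); last by ring.
rewrite (@powRD _ t 1 (a - 1)); last by rewrite (gt_eqF t0) implybT.
by rewrite powRr1 ?ltW// mulrA.
Qed.

Lemma integral_itv0y_split (f : R -> \bar R) (c : R) : 0 < c ->
  measurable_fun setT f -> (forall x, 0 <= f x)%E ->
  (\int[mu]_(x in `]0%R, +oo[) f x =
   \int[mu]_(x in `]0%R, c]) f x + \int[mu]_(x in `]c, +oo[) f x)%E.
Proof.
move=> c0 mf f0; rewrite -ge0_integral_setU//.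
- by rewrite -itv_bndbnd_setU// bnd_simp ltW.
- exact: measurable_funTS.
- apply/disj_setPS => y [/=]; rewrite 2!in_itv /= => /andP[_ yc] /andP[cy _].
  by move: cy; rewrite ltNge yc.
Qed.

Lemma primitive_cvg0 a : 0 < a -> t `^ a * expR (- t) @[t --> 0^'+] --> (0 : R).
Proof.
move=> a0; rewrite -[X in _ --> X](mul0r (expR (- 0))).
apply: cvgM; first exact: powR_cvg0.
apply: cvg_at_right_filter; apply: continuous_comp; first exact: continuousN.
exact: continuous_expR.
Qed.

(** For an integer [n >= a] and [t >= 1], the bound [e^t >= t^(n+1) / (n+1)!] leaves at most
    [(n+1)! / t]. *)
Lemma primitive_cvgy a : t `^ a * expR (- t) @[t --> +oo] --> (0 : R).
Proof.
have [n an] : exists n : nat, a <= n%:R.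
  by exists (Num.bound `|a|); rewrite ltW// (le_lt_trans (ler_norm _))// archi_boundP.
apply: (squeeze_cvgr (f := fun=> 0) (h := fun t => n.+1`!%:R / t)).
- near=> t; have t1 : 1 <= t by near: t; exact: nbhs_pinfty_ge.
  have t0 : 0 < t by exact: lt_le_trans t1.
  rewrite mulr_ge0 ?powR_ge0 ?expR_ge0//= expRN ler_pdivrMr ?expR_gt0//.
  rewrite mulrAC ler_pdivlMr//.
  rewrite (@le_trans _ _ (t ^+ n.+1))//.
    rewrite exprSr ler_wpM2r ?(ltW t0)// -(powR_mulrn n (ltW t0)); exact: ler_powR.
  rewrite mulrC -ler_pdivrMr ?ltr0n ?fact_gt0//.
  by apply: le_trans (expR_ge1Dxn n (ltW t0)); rewrite lerDr.
- exact: cvg_cst.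
- rewrite -[X in _ --> X](mulr0 (n.+1`!%:R : R)); apply: cvgM; first exact: cvg_cst.
  apply/gtr0_cvgV0; first by near=> t; near: t; exact: nbhs_pinfty_gt.
  exact: cvg_id.
Unshelve. all: by end_near. Qed.

Let cgd a (x : R) : 0 < x -> {for x, continuous (gamma_density a)}.
Proof. exact: continuous_gamma_density. Qed.

Let egamma_piece_ge0 a (A : set R) : (0 <= \int[mu]_(x in A) (gamma_density a x)%:E)%E.
Proof. by apply: integral_ge0 => x _; rewrite lee_fin gamma_density_ge0. Qed.

Let mgd a (A : set R) : measurable_fun A (EFin \o gamma_density a).
Proof. by apply/measurable_EFinP; apply: measurable_funTS; exact: measurable_gamma_density. Qed.

(* Integration by parts without integrability: the derivative of the
   primitive [t^a e^-t] has constant sign on either side of [t = a]. *)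
Lemma egammaD1 a : 0 < a -> egamma (a + 1) = (a%:E * egamma a)%E.
Proof.
move=> a0.
pose K : R := a `^ a * expR (- a).
have lowK : (\int[mu]_(x in `]0%R, a])
    (a * gamma_density a x - gamma_density (a + 1) x)%:E = K%:E)%E.
  have := @ge0_FTC_itvoc0 R (fun t => a * gamma_density a t - gamma_density (a + 1) t)
    (fun t => t `^ a * expR (- t)) a 0 a0.
  rewrite subr0; apply.
  - move=> x /andP[x0 xa].
    by rewrite gamma_densityD1// -mulrBl mulr_ge0 ?gamma_density_ge0// subr_ge0.
  - move=> x x0; apply: cvgB; last exact: cgd.
    by apply: cvgM; [exact: cvg_cst|exact: cgd].
  - by move=> x x0; exact: is_derive_primitive.
  - exact: primitive_cvg0.
have low : (\int[mu]_(x in `]0%R, a]) (a * gamma_density a x)%:E =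
    \int[mu]_(x in `]0%R, a]) (gamma_density (a + 1) x)%:E + K%:E)%E.
  rewrite -lowK -ge0_integralD//=.
  - by apply: eq_integral => x _; rewrite -EFinD addrC subrK.
  - by move=> x _; rewrite lee_fin gamma_density_ge0.
  - exact: mgd.
  - move=> x; rewrite in_itv /= lee_fin => /andP[x0 xa].
    by rewrite gamma_densityD1// -mulrBl mulr_ge0 ?gamma_density_ge0// subr_ge0.
  - apply/measurable_EFinP; apply: measurable_funTS; apply: measurable_funB.
      by apply: measurable_funM => //; exact: measurable_gamma_density.
    exact: measurable_gamma_density.
have highK : (\int[mu]_(x in `]a, +oo[)
    (gamma_density (a + 1) x - a * gamma_density a x)%:E = K%:E)%E.
  have := @ge0_FTC_itvcy R (fun t => gamma_density (a + 1) t - a * gamma_density a t)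
    (fun t => - (t `^ a * expR (- t))) a 0 a0.
  rewrite sub0r opprK; apply.
  - move=> x xa; rewrite gamma_densityD1 ?(lt_le_trans a0)//.
    by rewrite -mulrBl mulr_ge0 ?gamma_density_ge0// subr_ge0.
  - move=> x x0; apply: cvgB; first exact: cgd.
    by apply: cvgM; [exact: cvg_cst|exact: cgd].
  - move=> x x0; have h := is_derive_primitive a x0.
    by apply: is_derive_eq; rewrite opprB.
  - by rewrite -oppr0; apply: cvgN; exact: primitive_cvgy.
have high : (\int[mu]_(x in `]a, +oo[) (gamma_density (a + 1) x)%:E =
    \int[mu]_(x in `]a, +oo[) (a * gamma_density a x)%:E + K%:E)%E.
  rewrite -highK -ge0_integralD//=.
  - by apply: eq_integral => x _; rewrite -EFinD [in RHS]addrC subrK.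
  - by move=> x _; rewrite lee_fin mulr_ge0 ?gamma_density_ge0// ltW.
  - apply/measurable_EFinP; apply: measurable_funTS.
    by apply: measurable_funM => //; exact: measurable_gamma_density.
  - move=> x; rewrite in_itv /= lee_fin andbT => xa.
    rewrite gamma_densityD1 ?(lt_trans a0)// -mulrBl mulr_ge0 ?gamma_density_ge0//.
    by rewrite subr_ge0 ltW.
  - apply/measurable_EFinP; apply: measurable_funTS; apply: measurable_funB.
      exact: measurable_gamma_density.
    by apply: measurable_funM => //; exact: measurable_gamma_density.
rewrite /egamma (@integral_itv0y_split (fun x => (gamma_density (a + 1) x)%:E) a)//; last 2 first.
- exact: mgd.
- by move=> x; rewrite lee_fin gamma_density_ge0.
(* Both halves carry the same boundary term [K], which is passed from the upper to the lower one;
   possibly infinite integrals are never subtracted. *)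
rewrite high (addeC _ K%:E) addeA -low.
rewrite (@integral_itv0y_split (fun x => (gamma_density a x)%:E) a)//; last 2 first.
- exact: mgd.
- by move=> x; rewrite lee_fin gamma_density_ge0.
rewrite ge0_muleDr ?egamma_piece_ge0//.
have scale (A : set R) : measurable A -> (\int[mu]_(x in A) (a * gamma_density a x)%:E =
    a%:E * \int[mu]_(x in A) (gamma_density a x)%:E)%E.
  move=> mA; under eq_integral do rewrite EFinM.
  rewrite ge0_integralZl//; first exact: mgd.
  - by move=> x _; rewrite lee_fin gamma_density_ge0.
  - by rewrite lee_fin ltW.
by rewrite !scale.
Qed.

(** On []0, 1]] the density is below [t^(a-1)], with primitive [t^a / a]; on []1, +oo[] the
    assumption [a <= 1] puts it below [e^-t]. Larger arguments are reached through [egammaD1]. *)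
Lemma egamma_lty a : 0 < a <= 1 -> (egamma a < +oo)%E.
Proof.
move=> /andP[a0 a1].
rewrite /egamma (@integral_itv0y_split (fun x => (gamma_density a x)%:E) 1)//; last 2 first.
- exact: mgd.
- by move=> x; rewrite lee_fin gamma_density_ge0.
apply: lte_add_pinfty.
- apply: (@le_lt_trans _ _ (\int[mu]_(x in `]0%R, 1%R]) (x `^ (a - 1))%:E)%E).
    apply: ge0_le_integral => //.
    + by move=> x _; rewrite lee_fin gamma_density_ge0.
    + exact: mgd.
    + by apply/measurable_EFinP; apply: measurable_funTS; exact: measurable_powR.
    + move=> x /=; rewrite in_itv /= => /andP[x0 _]; rewrite lee_fin ler_piMr ?powR_ge0//.
      by rewrite -expR0 ler_expR oppr_le0 ltW.
  have -> : (\int[mu]_(x in `]0%R, 1%R]) (x `^ (a - 1))%:E = (a^-1 * 1 `^ a - 0)%:E)%E.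
    apply: (@ge0_FTC_itvoc0 R (fun t => t `^ (a - 1)) (fun t => a^-1 * t `^ a)) => //.
    + by move=> x _; exact: powR_ge0.
    + move=> x x0; have h := is_derive1_powR (a - 1) x0.
      by apply: differentiable_continuous; apply/derivable1_diffP; exact: ex_derive.
    + move=> x x0; have h := is_derive1_powR a x0.
      by apply: is_derive_eq; rewrite /GRing.scale /= ?mulr0 ?addr0 mulrA mulVf ?gt_eqF// mul1r.
    + rewrite -[X in _ --> X](mulr0 a^-1); apply: cvgM; first exact: cvg_cst.
      exact: powR_cvg0.
  exact: ltry.
- apply: (@le_lt_trans _ _ (\int[mu]_(x in `]1%R, +oo[) (gamma_density 1 x)%:E)%E).
    apply: ge0_le_integral => //.
    + by move=> x _; rewrite lee_fin gamma_density_ge0.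
    + exact: mgd.
    + exact: mgd.
    + move=> x /=; rewrite in_itv /= andbT => x1; rewrite lee_fin ler_wpM2r ?expR_ge0//.
      by apply: ler_powR; [exact: ltW|rewrite lerB].
  have -> : (\int[mu]_(x in `]1%R, +oo[) (gamma_density 1 x)%:E = (0 - - expR (- 1))%:E)%E.
    apply: (@ge0_FTC_itvcy R (gamma_density 1) (fun t => - expR (- t))) => //.
    + by move=> x _; exact: gamma_density_ge0.
    + by move=> x x0; exact: cgd.
    + move=> x x0; apply: is_derive_eq.
      by rewrite /gamma_density subrr powRr0 mul1r /GRing.scale /= ?mulrN1 ?opprK.
    + by rewrite -oppr0; apply: cvgN; exact: cvgr_expR.
  exact: ltry.
Qed.

Lemma egamma_ge0 a : (0 <= egamma a)%E. Proof. exact: egamma_piece_ge0. Qed.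

Lemma egamma_fin_num (n : nat) : egamma (n.+1%:R / 2) \is a fin_num.
Proof.
rewrite ge0_fin_numE ?egamma_ge0//.
(* The functional equation moves the index [n] by 2, so the induction carries two consecutive
   values. *)
suff: (egamma (n.+1%:R / 2) < +oo /\ egamma (n.+2%:R / 2) < +oo)%E by case.
elim: n => [|n [IH1 IH2]].
  by split; apply: egamma_lty; rewrite divr_gt0//= ler_pdivrMr// mul1r ler_nat.
split; first exact: IH2.
rewrite (_ : n.+3%:R / 2 = n.+1%:R / 2 + 1); last by rewrite -addn2 natrD; lra.
have n0 : 0 < n.+1%:R / 2 :> R by rewrite divr_gt0.
by rewrite egammaD1// lte_mul_pinfty// ?lee_fin ?ltW.
Qed.

Lemma Gamma_ge0 a : 0 <= Gamma a.
Proof. by rewrite GammaE fine_ge0// egamma_ge0. Qed.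

Lemma Gamma_halfD1 (n : nat) :
  Gamma (n.+3%:R / 2) = n.+1%:R / 2 * Gamma (n.+1%:R / 2) :> R.
Proof.
rewrite !GammaE (_ : n.+3%:R / 2 = n.+1%:R / 2 + 1); last by rewrite -addn2 natrD; lra.
by rewrite egammaD1 ?divr_gt0// fineM// egamma_fin_num.
Qed.

(** The densities at [a], [a + 1/2] and [a + 1] are in the ratio [1 : sqrt t : t], so the
    weighted-mean criterion reduces to [2 sqrt t <= l + t / l]. *)
Lemma Gamma_half_logconvex (n : nat) :
  Gamma (n.+2%:R / 2) ^+ 2 <= Gamma (n.+1%:R / 2) * Gamma (n.+3%:R / 2) :> R.
Proof.
apply: sqr_le_mul_of_weighted_mean; rewrite ?Gamma_ge0// => l l0.
rewrite -lee_fin EFinD !EFinM !GammaE !fineK ?egamma_fin_num//.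
have a1 : n.+2%:R / 2 = n.+1%:R / 2 + 2^-1 :> R by rewrite -addn1 natrD; lra.
have a2 : n.+3%:R / 2 = n.+1%:R / 2 + 1 :> R by rewrite -addn2 natrD; lra.
rewrite a1 a2; set a : R := n.+1%:R / 2.
rewrite (muleC (egamma (a + 1))) -!ge0_integralZl//; do ?[exact: mgd
  | by move=> x _; rewrite lee_fin gamma_density_ge0 | by rewrite lee_fin ?invr_ge0 ltW].
- rewrite -ge0_integralD//=.
  + apply: ge0_le_integral => //=.
    * by move=> x _; rewrite mule_ge0// lee_fin ?gamma_density_ge0.
    * by apply/measurable_EFinP; apply: measurable_funTS;
        apply: measurable_funM => //; exact: measurable_gamma_density.
    * apply/measurable_EFinP; apply: measurable_funTS; apply: measurable_funD;
        by apply: measurable_funM => //; exact: measurable_gamma_density.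
    * move=> x; rewrite in_itv /= andbT => x0; rewrite -!EFinM -EFinD lee_fin.
      rewrite gamma_density_half// gamma_densityD1// (mulrA 2) (mulrA l^-1) -mulrDl.
      rewrite ler_wpM2r ?gamma_density_ge0//.
      have := sqr_ge0 (l - Num.sqrt x); rewrite sqrrB sqr_sqrtr ?(ltW x0)// => h.
      by rewrite -(ler_pM2l l0) mulrDr (mulrA l l^-1) divff ?gt_eqF// mul1r; lra.
  + by move=> x _; rewrite mule_ge0// lee_fin ?gamma_density_ge0// ltW.
  + by apply/measurable_EFinP; apply: measurable_funTS;
      apply: measurable_funM => //; exact: measurable_gamma_density.
  + by move=> x _; rewrite mule_ge0// lee_fin ?gamma_density_ge0// invr_ge0 ltW.
  + by apply/measurable_EFinP; apply: measurable_funTS;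
      apply: measurable_funM => //; exact: measurable_gamma_density.
Qed.

Lemma Gamma1_gt0 : 0 < Gamma (1 : R).
Proof.
rewrite GammaE fine_gt0//; apply/andP; split; last by apply: egamma_lty; rewrite ltr01 lexx.
rewrite /egamma (@integral_itv0y_split (fun x => (gamma_density 1 x)%:E) 1)//; last 2 first.
- exact: mgd.
- by move=> x; rewrite lee_fin gamma_density_ge0.
have -> : (\int[mu]_(x in `]1%R, +oo[) (gamma_density 1 x)%:E = (0 - - expR (- 1))%:E)%E.
  apply: (@ge0_FTC_itvcy R (gamma_density 1) (fun t => - expR (- t))) => //.
  - by move=> x _; exact: gamma_density_ge0.
  - by move=> x x0; exact: cgd.
  - move=> x x0; apply: is_derive_eq.
    by rewrite /gamma_density subrr powRr0 mul1r /GRing.scale /= ?mulrN1 ?opprK.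
  - by rewrite -oppr0; apply: cvgN; exact: cvgr_expR.
by rewrite sub0r opprK lte_paddl ?egamma_piece_ge0// lte_fin expR_gt0.
Qed.

Lemma Gamma_half_gt0 (n : nat) : 0 < Gamma (n.+1%:R / 2) :> R.
Proof.
have h1 : 0 < Gamma (2 / 2 : R) by rewrite divff//; exact: Gamma1_gt0.
suff: 0 < Gamma (n.+1%:R / 2) :> R /\ 0 < Gamma (n.+2%:R / 2) :> R by case.
elim: n => [|n [IH1 IH2]].
  split; last exact: h1.
  (* [Gamma (1/2)] cannot vanish: log-convexity and the functional equation give
     [Gamma 1 ^ 2 <= Gamma (1/2)^2 / 2]. *)
  have := Gamma_half_logconvex 0; rewrite Gamma_halfD1.
  move/(lt_le_trans (exprn_gt0 2 h1)) => h; rewrite lt_def Gamma_ge0 andbT.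
  by apply: contraTneq h => ->; rewrite mul0r ltxx.
split; first exact: IH2.
by rewrite Gamma_halfD1; apply: mulr_gt0; [rewrite divr_gt0|exact: IH1].
Qed.

End gamma.

(** * Moments determined by a two-step recursion *)

Section moment_recursion.
Context {R : realType}.

Lemma le0_of_mul_nat_bounded (e M : R) : (forall k : nat, e * k%:R <= M) -> e <= 0.
Proof.
move=> h; rewrite leNgt; apply/negP => e0.
have := h (Num.bound `|M / e|); apply/negP; rewrite -ltNge mulrC -ltr_pdivrMr//.
by rewrite (le_lt_trans (ler_norm _))// archi_boundP.
Qed.

Section moments.
Context {d r : nat} {c g : nat -> R}.
Hypothesis d0 : (0 < d)%N.
Hypothesis r0 : (0 < r)%N.
Hypothesis g_gt0 : forall m, (0 < m)%N -> 0 < g m.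
Hypothesis gD2 : forall m, (0 < m)%N -> g m.+2 = m%:R / 2 * g m.
Hypothesis g_logconvex : forall m, (0 < m)%N -> g m.+1 ^+ 2 <= g m * g m.+2.
Hypothesis c_ge0 : forall n, 0 <= c n.
Hypothesis c0 : c 0%N = 1.
Hypothesis c_logconvex : forall n, c n.+1 ^+ 2 <= c n * c n.+2.
Hypothesis c_rec : forall n,
  (d%:R + n%:R) * c n.+2 = d%:R / r%:R * (r%:R + n%:R) * c n.

(** A converse of log-convexity up to the factor [(m+1)/m]: log-convexity is taken one index higher,
    and the functional equation rewrites [g m] and [g m.+3] by their neighbours. *)
Let g_ratio_le m : (0 < m)%N -> m%:R * (g m * g m.+2) <= m.+1%:R * g m.+1 ^+ 2.
Proof.
move=> m0; have m1 : 0 < m%:R :> R by rewrite ltr0n.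
have h := g_logconvex (ltn0Sn m); rewrite (gD2 (ltn0Sn m)) in h.
have e : m%:R * (g m * g m.+2) = 2 * g m.+2 ^+ 2 by rewrite (gD2 m0); field.
have e' : m.+1%:R * g m.+1 ^+ 2 = 2 * (g m.+1 * (m.+1%:R / 2 * g m.+1)) by field.
by rewrite e e' ler_pM2l.
Qed.

Let s : R := Num.sqrt (d%:R / r%:R).
(** The conjectured closed form of the moments, with [g m] in the role of [Gamma (m / 2)]; [t 1] is
    then [tau]. *)
Let t (n : nat) : R := s ^+ n * (g (r + n) * g d / (g r * g (d + n))).

Let t_gt0 n : 0 < t n.
Proof.
by rewrite mulr_gt0 ?exprn_gt0 ?sqrtr_gt0 ?divr_gt0 ?mulr_gt0 ?ltr0n ?g_gt0 ?addn_gt0 ?d0 ?r0.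
Qed.

Let s2 : s ^+ 2 = d%:R / r%:R.
Proof. by rewrite sqr_sqrtr// divr_ge0. Qed.

Let t_rec n : (d%:R + n%:R) * t n.+2 = d%:R / r%:R * (r%:R + n%:R) * t n.
Proof.
rewrite /t !addnS gD2 ?addn_gt0 ?r0// gD2 ?addn_gt0 ?d0// -addn2 exprD s2 !natrD.
have gd := g_gt0 d0; have gr := g_gt0 r0.
have gdn : 0 < g (d + n) by rewrite g_gt0// addn_gt0 d0.
have dn0 : 0 < d%:R + n%:R :> R by rewrite -natrD ltr0n addn_gt0 d0.
have r0' : r%:R != 0 :> R by rewrite pnatr_eq0 -lt0n.
by field; rewrite r0' !gt_eqF.
Qed.

(** Log-concavity of [t] up to a factor tending to 1: [g_ratio_le] treats the numerators
    [g (r + n)], plain log-convexity the denominators [g (d + n)]. *)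
Let t_ratio n : (r + n)%:R * (t n * t n.+2) <= (r + n).+1%:R * t n.+1 ^+ 2.
Proof.
have rn0 : (0 < r + n)%N by rewrite addn_gt0 r0.
have dn0 : (0 < d + n)%N by rewrite addn_gt0 d0.
have hr := g_ratio_le rn0; have hd := g_logconvex dn0.
rewrite /t !addnS.
have gd := g_gt0 d0; have gr := g_gt0 r0.
have p0 : 0 < g (d + n) by exact: g_gt0.
have p1 : 0 < g (d + n).+1 by rewrite g_gt0.
have p2 : 0 < g (d + n).+2 by rewrite g_gt0.
have q1 : 0 < g (r + n).+1 by rewrite g_gt0.
set A := g (d + n) in hd p0 *; set B := g (d + n).+1 in hd p1 *.
set C := g (d + n).+2 in hd p2 *.
set X := g (r + n) in hr *; set Y := g (r + n).+1 in hr q1 *; set Z := g (r + n).+2 in hr *.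
set k := (s ^+ n.+1 * (g d / g r)) ^+ 2.
have k0 : 0 <= k by exact: sqr_ge0.
have -> : (r + n)%:R * (s ^+ n * (X * g d / (g r * A)) * (s ^+ n.+2 * (Z * g d / (g r * C)))) =
    k * ((r + n)%:R * (X * Z) / (A * C)).
  by rewrite /k !exprS; field; rewrite !gt_eqF.
have -> : (r + n).+1%:R * (s ^+ n.+1 * (Y * g d / (g r * B))) ^+ 2 =
    k * ((r + n).+1%:R * Y ^+ 2 / B ^+ 2).
  by rewrite /k; field; rewrite !gt_eqF.
rewrite ler_wpM2l// (@le_trans _ _ ((r + n).+1%:R * Y ^+ 2 / (A * C)))//.
  by rewrite ler_pM2r// invr_gt0 mulr_gt0.
by rewrite ler_pM2l ?mulr_gt0 ?exprn_gt0// lef_pV2 ?posrE ?mulr_gt0 ?exprn_gt0.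
Qed.

Let rho := c 1 / t 1.

(** The recursion preserves parity: even moments are anchored by [c 0 = t 0 = 1], odd ones only up
    to the common factor [rho]. *)
Let ct k : c k.*2 = t k.*2 /\ c k.*2.+1 = rho * t k.*2.+1.
Proof.
elim: k => [|k [IH1 IH2]].
  rewrite c0 /rho divfK ?gt_eqF//; split=> //.
  by rewrite /t double0 expr0 mul1r !addn0 divff// gt_eqF// mulr_gt0// g_gt0.
have dn0 (n : nat) : d%:R + n%:R != 0 :> R by rewrite -natrD pnatr_eq0 -lt0n addn_gt0 d0.
rewrite doubleS; split.
  by apply: (mulfI (dn0 k.*2)); rewrite c_rec t_rec IH1.
by apply: (mulfI (dn0 k.*2.+1)); rewrite c_rec IH2 (mulrCA _ rho) -t_rec mulrCA.
Qed.

(* Log-convexity of the moments at both parities squeezes the ratio [rho]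
   between quantities tending to 1. *)
Lemma first_moment_ratio : c 1 = s * (g r.+1 * g d / (g r * g d.+1)).
Proof.
have rho0 : 0 <= rho by rewrite divr_ge0// ltW.
(* Log-convexity centred at the odd index [2k+1] gives [rho^2 <= 1 + 1/(r + 2k)]. *)
have rho1 : rho ^+ 2 - 1 <= 0.
  apply: (@le0_of_mul_nat_bounded _ 1) => k.
  have [h1 _] := ct k; have [h3 _] := ct k.+1; have [_ h2] := ct k.
  have := c_logconvex k.*2; rewrite -doubleS h1 h2 h3 exprMn doubleS => h.
  have u := t_ratio k.*2; have p := exprn_gt0 2 (t_gt0 k.*2.+1).
  have n0 : 0 < (r + k.*2)%:R :> R by rewrite ltr0n addn_gt0 r0.
  have {}h : (r + k.*2)%:R * rho ^+ 2 <= (r + k.*2).+1%:R.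
    rewrite -(ler_pM2r p) -mulrA; apply: le_trans u.
    by rewrite ler_pM2l.
  have [r1|r1] := leP (rho ^+ 2) 1.
    by rewrite (@le_trans _ _ 0)// mulr_le0_ge0// subr_le0.
  have : (rho ^+ 2 - 1) * (r + k.*2)%:R <= 1.
    by move: h; rewrite -natr1 mulrBl mulrC mul1r lerBlDr addrC.
  apply: le_trans; rewrite ler_pM2l ?subr_gt0// ler_nat -addnn addnA leq_addl.
  by [].
(* Centred at the even index [2k+2], it gives [1 <= rho^2 (1 + 1/(r + 2k + 1))]. *)
have rho2 : 1 - rho ^+ 2 <= 0.
  apply: (@le0_of_mul_nat_bounded _ 1) => k.
  have [_ h1] := ct k; have [h2 _] := ct k.+1; have [_ h3] := ct k.+1.
  have := c_logconvex k.*2.+1; rewrite -doubleS h1 h2 h3 doubleS => h.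
  have u := t_ratio k.*2.+1; have p := exprn_gt0 2 (t_gt0 k.*2.+2).
  have n0 : 0 < (r + k.*2.+1)%:R :> R by rewrite ltr0n addn_gt0 r0.
  have {}h : (r + k.*2.+1)%:R <= rho ^+ 2 * (r + k.*2.+1).+1%:R.
    rewrite -(ler_pM2r p) -[leRHS]mulrA.
    apply: le_trans (ler_wpM2l (sqr_ge0 rho) u).
    rewrite [leRHS]mulrCA ler_pM2l//; apply: le_trans h _.
    by rewrite le_eqVlt; apply/orP; left; apply/eqP; ring.
  have : (1 - rho ^+ 2) * (r + k.*2.+1)%:R <= rho ^+ 2.
    by move: h; rewrite -natr1 mulrDr mulr1 mulrBl mul1r lerBlDr addrC.
  have [r1|r1] := leP 1 (rho ^+ 2).
    by move=> _; rewrite (@le_trans _ _ 0)// mulr_le0_ge0// subr_le0.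
  move=> {}h; apply: le_trans (ltW r1); apply: le_trans h.
  rewrite ler_pM2l ?subr_gt0// ler_nat -addnn -addnS addnA.
  by rewrite addnAC leq_addl.
have : rho ^+ 2 = 1 by lra.
move/eqP; rewrite sqrf_eq1 => /orP[/eqP rE|/eqP rE]; last by lra.
have := divfK (lt0r_neq0 (t_gt0 1)) (c 1); rewrite -/rho rE mul1r => <-.
by rewrite /t expr1 !addn1.
Qed.

End moments.

Lemma first_moment_tau (d r : nat) (c : nat -> R) : (0 < d)%N -> (0 < r)%N ->
  (forall n, 0 <= c n) -> c 0%N = 1 -> (forall n, c n.+1 ^+ 2 <= c n * c n.+2) ->
  (forall n, (d%:R + n%:R) * c n.+2 = d%:R / r%:R * (r%:R + n%:R) * c n) ->
  c 1%N = tau R d r.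
Proof.
move=> d0 r0 c_ge0 c0 c_lc c_rec.
rewrite /tau !natr1.
have g1 m : (0 < m)%N -> 0 < Gamma (m%:R / 2) :> R.
  by case: m => [//|m _]; exact: Gamma_half_gt0.
have g2 m : (0 < m)%N -> Gamma (m.+2%:R / 2) = m%:R / 2 * Gamma (m%:R / 2) :> R.
  by case: m => [//|m _]; exact: Gamma_halfD1.
have g3 m : (0 < m)%N ->
    Gamma (m.+1%:R / 2) ^+ 2 <= Gamma (m%:R / 2) * Gamma (m.+2%:R / 2) :> R.
  by case: m => [//|m _]; exact: Gamma_half_logconvex.
exact: (first_moment_ratio d0 r0 g1 g2 g3 c_ge0 c0 c_lc c_rec).
Qed.

Lemma tau_gt0 (d r : nat) : (0 < d)%N -> (0 < r)%N -> 0 < tau R d r.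
Proof.
case: d r => // d [|r]// _ _; rewrite /tau !natr1.
have h (n : nat) := @Gamma_half_gt0 R n; move: h.
move: (@Gamma R) => G h.
by rewrite mulr_gt0 ?sqrtr_gt0 ?divr_gt0 ?mulr_gt0.
Qed.

End moment_recursion.

(** * Uniform first-order Taylor remainders for powers of the norm *)

Section power_remainder.
Context {R : realType}.

(** The remainder of the next power is [b] times the current one plus [(n+1) a^n (b-a)^2]. The
    constant depends on [n] and [K] only, so that the estimate can later be integrated over [P]. *)
Lemma power_taylor1 (n : nat) (K : R) : 0 <= K -> exists2 C, 0 <= C &
  forall a b : R, 0 <= a <= K -> 0 <= b <= K ->
  `|b ^+ n.+1 - a ^+ n.+1 - n.+1%:R * a ^+ n * (b - a)| <= C * (b - a) ^+ 2.
Proof.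
move=> K0; elim: n => [|n [C C0 IH]].
  exists 0 => // a b _ _; rewrite mul0r normr_le0; apply/eqP; rewrite !expr1 expr0; ring.
exists (K * C + n.+1%:R * K ^+ n).
  by rewrite addr_ge0// mulr_ge0// ?exprn_ge0.
move=> a b aK bK; have /andP[a0 ak] := aK; have /andP[b0 bk] := bK.
have -> : b ^+ n.+2 - a ^+ n.+2 - n.+2%:R * a ^+ n.+1 * (b - a) =
    b * (b ^+ n.+1 - a ^+ n.+1 - n.+1%:R * a ^+ n * (b - a)) +
    n.+1%:R * a ^+ n * (b - a) ^+ 2.
  by rewrite -[n.+2%:R]natr1 !exprS; ring.
rewrite (le_trans (ler_normD _ _))// mulrDl lerD//.
  by rewrite normrM (ger0_norm b0) -[leRHS]mulrA; apply: ler_pM => //; exact: IH.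
rewrite ger0_norm; last by rewrite mulr_ge0 ?sqr_ge0// mulr_ge0 ?exprn_ge0.
by rewrite ler_wpM2r ?sqr_ge0// ler_wpM2l// lerXn2r ?nnegrE.
Qed.

(* With [a = |x|], [b = |y|], [c = <x, y>] and [w = |x + t y|], the left-hand
   side is the first-order Taylor remainder at [t = 0] of
   [|x + t y|^n <x + t y, y - t x>]. *)
Lemma norm_power_taylor1 (n : nat) (K : R) : 0 <= K -> exists C,
  forall a b c w t : R, 0 <= a <= K -> 0 <= b <= K -> 0 <= w <= K -> 0 < t <= 1 ->
  `|c| <= a * b -> w ^+ 2 = a ^+ 2 + 2 * t * c + t ^+ 2 * b ^+ 2 -> `|w - a| <= t * b ->
  `|w ^+ n * ((1 - t ^+ 2) * c + t * (b ^+ 2 - a ^+ 2)) - a ^+ n * c -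
    t * (n%:R * c ^+ 2 * (a ^+ n / a ^+ 2) + a ^+ n * (b ^+ 2 - a ^+ 2))| <= C * t ^+ 2.
Proof.
move=> K0; case: n => [|n].
  exists (K * K) => a b c w t /andP[a0 ak] /andP[b0 bk] _ _ cab _ _.
  have -> : w ^+ 0 * ((1 - t ^+ 2) * c + t * (b ^+ 2 - a ^+ 2)) - a ^+ 0 * c -
    t * (0%:R * c ^+ 2 * (a ^+ 0 / a ^+ 2) + a ^+ 0 * (b ^+ 2 - a ^+ 2)) = - (c * t ^+ 2).
    by rewrite !expr0 !mul0r; ring.
  rewrite normrN normrM (ger0_norm (sqr_ge0 t)) ler_wpM2r ?sqr_ge0//.
  by rewrite (le_trans cab)// ler_pM.
have [C C0 hC] := @power_taylor1 n K K0.
exists (n.+1%:R * K ^+ n * K ^+ 3 + C * K ^+ 2 * K ^+ 2 + K ^+ n.+1 * K ^+ 2 +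
  (C * K ^+ 2 + n.+1%:R * K ^+ n * K) * K ^+ 2).
move=> a b c w t aK bK wK /andP[t0 t1] cab w2 wa.
have /andP[a0 ak] := aK; have /andP[b0 bk] := bK; have /andP[w0 wk] := wK.
have cK : `|c| <= K ^+ 2 by rewrite (le_trans cab)// expr2 ler_pM.
set f := w ^+ n.+1 - a ^+ n.+1 - n.+1%:R * a ^+ n * (w - a).
have d2 : (w - a) ^+ 2 <= t ^+ 2 * b ^+ 2.
  rewrite -exprMn -(real_normK (num_real (w - a))) lerXn2r ?nnegrE//.
  by rewrite mulr_ge0// ltW.
have b2 : b ^+ 2 <= K ^+ 2 by rewrite lerXn2r ?nnegrE.
have a2 : a ^+ 2 <= K ^+ 2 by rewrite lerXn2r ?nnegrE.
have an : a ^+ n <= K ^+ n by rewrite lerXn2r ?nnegrE.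
have fb : `|f| <= C * K ^+ 2 * t ^+ 2.
  rewrite (le_trans (hC _ _ aK wK))// -mulrA ler_wpM2l// (le_trans d2)//.
  by rewrite mulrC ler_wpM2r ?sqr_ge0.
have wan : `|w ^+ n.+1 - a ^+ n.+1| <= (C * K ^+ 2 + n.+1%:R * K ^+ n * K) * t.
  have -> : w ^+ n.+1 - a ^+ n.+1 = f + n.+1%:R * a ^+ n * (w - a) by rewrite /f; ring.
  rewrite (le_trans (ler_normD _ _))// mulrDl lerD//.
    rewrite (le_trans fb)// ler_wpM2l ?mulr_ge0 ?sqr_ge0//.
    by rewrite expr2 ler_piMr// ltW.
  rewrite normrM ger0_norm ?mulr_ge0 ?exprn_ge0// -[leRHS]mulrA ler_pM ?mulr_ge0 ?exprn_ge0//.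
    by rewrite ler_wpM2l.
  by rewrite (le_trans wa)// mulrC ler_wpM2r// ltW.
set q := n.+1%:R * a ^+ n * (w - a) * c - t * (n.+1%:R * c ^+ 2 * (a ^+ n.+1 / a ^+ 2)).
have qb : `|q| <= n.+1%:R * K ^+ n * K ^+ 3 * t ^+ 2.
  (* At [a = 0] Cauchy-Schwarz forces [c = 0], which absorbs the quotient by [a ^+ 2]. *)
  have [az|az] := eqVneq a 0.
    have cz : c = 0 by apply/eqP; rewrite -normr_le0 (le_trans cab)// az mul0r.
    by rewrite /q cz !(mulr0, expr0n, mul0r) subrr normr0 !mulr_ge0 ?exprn_ge0// ltW.
  (* Expanding [w^2 = (a + (w - a))^2] gives [a (w - a) - t c = (t^2 b^2 - (w - a)^2) / 2], which is
     of second order. *)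
  have -> : q = n.+1%:R * a ^+ n * (c / a) * ((t ^+ 2 * b ^+ 2 - (w - a) ^+ 2) / 2).
    have -> : t ^+ 2 * b ^+ 2 = w ^+ 2 - a ^+ 2 - 2 * t * c by rewrite w2; ring.
    by rewrite /q !exprS; field.
  have cb : `|c / a| <= K.
    by rewrite normrM normfV (ger0_norm a0) ler_pdivrMr ?lt_def ?az// mulrC
      (le_trans cab)// ler_wpM2l.
  rewrite !normrM -(normrM c) (ger0_norm (ler0n _ _)) (ger0_norm (exprn_ge0 _ a0)).
  have hh : `|t ^+ 2 * b ^+ 2 - (w - a) ^+ 2| * `|2^-1| <= K ^+ 2 * t ^+ 2.
    rewrite [X in _ * X]ger0_norm ?invr_ge0// ger0_norm ?subr_ge0//.
    have := sqr_ge0 (w - a); have : t ^+ 2 * b ^+ 2 <= K ^+ 2 * t ^+ 2.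
      by rewrite mulrC ler_wpM2r ?sqr_ge0.
    by have := mulr_ge0 (sqr_ge0 t) (sqr_ge0 b); lra.
  have -> : n.+1%:R * K ^+ n * K ^+ 3 * t ^+ 2 = (n.+1%:R * K ^+ n * K) * (K ^+ 2 * t ^+ 2).
    by rewrite (exprS K 2); ring.
  have nan : 0 <= n.+1%:R * a ^+ n by rewrite mulr_ge0// exprn_ge0.
  apply: ler_pM => //; rewrite ?mulr_ge0 ?exprn_ge0//.
  by apply: ler_pM => //; rewrite ler_wpM2l.
have -> : w ^+ n.+1 * ((1 - t ^+ 2) * c + t * (b ^+ 2 - a ^+ 2)) - a ^+ n.+1 * c -
    t * (n.+1%:R * c ^+ 2 * (a ^+ n.+1 / a ^+ 2) + a ^+ n.+1 * (b ^+ 2 - a ^+ 2)) =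
    q + f * c + - (w ^+ n.+1 * c * t ^+ 2) +
    (w ^+ n.+1 - a ^+ n.+1) * (b ^+ 2 - a ^+ 2) * t by rewrite /q /f; ring.
rewrite !(mulrDl _ _ (t ^+ 2)).
rewrite (le_trans (ler_normD _ _))// lerD//; last first.
  have -> : (C * K ^+ 2 + n.+1%:R * K ^+ n * K) * K ^+ 2 * t ^+ 2 =
    (C * K ^+ 2 + n.+1%:R * K ^+ n * K) * t * K ^+ 2 * t by ring.
  rewrite normrM (ger0_norm (ltW t0)) normrM; apply: ler_wpM2r; first exact: ltW.
  apply: ler_pM => //.
  by rewrite ler_norml; have := sqr_ge0 a; have := sqr_ge0 b; lra.
rewrite (le_trans (ler_normD _ _))// lerD//; last first.
  rewrite normrN normrM (ger0_norm (sqr_ge0 t)) ler_wpM2r ?sqr_ge0//.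
  rewrite normrM ler_pM// normrX ger0_norm// lerXn2r ?nnegrE//.
rewrite (le_trans (ler_normD _ _))// lerD//.
by rewrite normrM mulrAC; apply: ler_pM.
Qed.

End power_remainder.

(** * Moments of a Haar matrix *)

Section haar_moments.
Context {R : realType} {d r : nat}.
Implicit Types (P : 'M[R]_(d, r)) (x y z : 'cV[R]_d).

(** Scaled Stiefel manifold, which carries the law of a Haar matrix. On it
    [|P^T x| <= sqrt(d/r) |x|], so integrating over it makes the relevant functions of [P] bounded,
    hence integrable. *)
Definition stiefel : set 'M[R]_(d, r) := [set P | P^T *m P = (d%:R / r%:R)%:M].

Lemma measurable_stiefel : measurable stiefel.
Proof.
rewrite (_ : stiefel = \bigcap_i \bigcap_j
    ((fun P : 'M[R]_(d, r) => (P^T *m P) i j) @^-1` [set (d%:R / r%:R)%:M i j])).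
  apply: fin_bigcap_measurable => // i _; apply: fin_bigcap_measurable => // j _.
  rewrite -[X in measurable X]setTI.
  have /measurable_mxP mP : measurable_fun setT (fun P : 'M[R]_(d, r) => P^T *m P).
    by apply: measurable_mulmx => //; exact: measurable_trmx.
  exact: mP.
apply/seteqP; split => [P PP i _ j _|P PP] /=; first by rewrite PP.
by apply/matrixP => i j; exact: PP.
Qed.

(** Since [0^-1 = 0], it vanishes when [P^T x = 0]; both branches of the update are then one
    formula. *)
Definition descent_dir (P : 'M[R]_(d, r)) x : 'cV[R]_d :=
  (norm2 (P^T *m x))^-1 *: (P *m (P^T *m x)).

Lemma measurable_descent_dir (dT : measure_display) (T : measurableType dT)
    (P : T -> 'M[R]_(d, r)) (g : T -> 'cV[R]_d) :
  measurable_fun setT P -> measurable_fun setT g ->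
  measurable_fun setT (fun t => descent_dir (P t) (g t)).
Proof.
move=> mP mg.
have mPg : measurable_fun setT (fun t => (P t)^T *m g t).
  by apply: measurable_mulmx => //; exact: measurable_trmx.
by apply: measurable_scalemx; [exact: measurable_norm2_inv|exact: measurable_mulmx].
Qed.

Context (mu : probability 'M[R]_(d, r) R).
Hypothesis mu_stiefel : mu stiefel = 1%E.
Hypothesis mu_inv : forall U, orthogonal_group U ->
  forall A : set 'M[R]_(d, r), measurable A -> mu (mulmx U @^-1` A) = mu A.
Hypothesis d0 : (0 < d)%N.
Hypothesis r0 : (0 < r)%N.

Let bdd (f : 'M[R]_(d, r) -> R) := measurable_fun setT f /\
  exists C : R, forall P, stiefel P -> `|f P| <= C.

Let EE (f : 'M[R]_(d, r) -> R) : R := \int[mu]_(P in stiefel) f P.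

Let integrable_bdd f : bdd f -> mu.-integrable stiefel (EFin \o f).
Proof.
move=> [mf [C fC]]; apply: measurable_bounded_integrable => //.
- exact: measurable_stiefel.
- have mS : (mu stiefel < +oo)%E by rewrite mu_stiefel ltry.
  exact: mS.
- exact: measurable_funTS.
- exists C; split; first exact: num_real.
  by move=> M CM P SP /=; rewrite (le_trans (fC P SP))// ltW.
Qed.

Let mS := measurable_stiefel.

Let bdd_cst c : bdd (fun=> c).
Proof. by split; [exact: measurable_cst|exists `|c|]. Qed.

Let bddD f g : bdd f -> bdd g -> bdd (fun P => f P + g P).
Proof.
move=> [mf [C fC]] [mg [D gD]]; split; first exact: measurable_funD.
exists (C + D) => P SP; rewrite (le_trans (ler_normD _ _))// lerD//; [exact: fC|exact: gD].
Qed.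

Let bddM f g : bdd f -> bdd g -> bdd (fun P => f P * g P).
Proof.
move=> [mf [C fC]] [mg [D gD]]; split; first exact: measurable_funM.
by exists (C * D) => P SP; rewrite normrM ler_pM// ?fC ?gD.
Qed.

Let bddB f g : bdd f -> bdd g -> bdd (fun P => f P - g P).
Proof.
move=> bf bg; apply: bddD => //.
have -> : (fun P => - g P) = (fun P => -1 * g P) by apply/funext => P; rewrite mulN1r.
exact: bddM.
Qed.

Let bddX f n : bdd f -> bdd (fun P => f P ^+ n).
Proof.
move=> [mf [C fC]]; split; first exact: measurable_funX.
exists (C ^+ n) => P SP; rewrite normrX lerXn2r ?nnegrE// ?fC//.
by rewrite (le_trans _ (fC P SP)).
Qed.

Let bdd_sum (I : Type) (s : seq I) (Q : pred I) (f : I -> 'M[R]_(d, r) -> R) :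
  (forall i, bdd (f i)) -> bdd (fun P => \sum_(i <- s | Q i) f i P).
Proof.
move=> bf; elim: s => [|i s IH].
  by under eq_fun do rewrite big_nil; exact: bdd_cst.
by under eq_fun do rewrite big_cons; case: (Q i) => //; exact: bddD.
Qed.

Let EED f g : bdd f -> bdd g -> EE (fun P => f P + g P) = EE f + EE g.
Proof. by move=> bf bg; rewrite /EE RintegralD//; exact: integrable_bdd. Qed.

Let EEZ c f : bdd f -> EE (fun P => c * f P) = c * EE f.
Proof. by move=> bf; rewrite /EE RintegralZl//; exact: integrable_bdd. Qed.

Let EEB f g : bdd f -> bdd g -> EE (fun P => f P - g P) = EE f - EE g.
Proof. by move=> bf bg; rewrite /EE RintegralB//; exact: integrable_bdd. Qed.

Let EE_cst c : EE (fun=> c) = c.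
Proof.
transitivity (c * fine (mu stiefel)); last by rewrite mu_stiefel mulr1.
exact: (Rintegral_cst mu mS).
Qed.

Let EE_eq f g : (forall P, stiefel P -> f P = g P) -> EE f = EE g.
Proof. by move=> fg; apply: eq_Rintegral => P; rewrite inE => /fg. Qed.

Let EE_le f g : bdd f -> bdd g -> (forall P, stiefel P -> f P <= g P) -> EE f <= EE g.
Proof. by move=> bf bg fg; apply: le_Rintegral => //; exact: integrable_bdd. Qed.

Let EE_sum (I : Type) (s : seq I) (Q : pred I) (f : I -> 'M[R]_(d, r) -> R) :
  (forall i, bdd (f i)) -> EE (fun P => \sum_(i <- s | Q i) f i P) = \sum_(i <- s | Q i) EE (f i).
Proof.
move=> bf; elim: s => [|i s IH].
  by rewrite big_nil; under EE_eq do rewrite big_nil; exact: EE_cst.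
rewrite big_cons; under EE_eq do rewrite big_cons.
by case: (Q i) => //; rewrite EED ?IH//; exact: bdd_sum.
Qed.

Let stiefel_mul U P : orthogonal_group U -> stiefel (U *m P) = stiefel P.
Proof.
by move=> UU; rewrite /stiefel /= trmx_mul mulmxA -(mulmxA P^T) UU mulmx1.
Qed.

Let measurable_mulU (U : 'M[R]_d) : measurable_fun setT (fun P : 'M[R]_(d, r) => U *m P).
Proof. exact: measurable_mulmx. Qed.

Let EE_inv U f : orthogonal_group U -> bdd f -> EE (fun P => f (U *m P)) = EE f.
Proof.
move=> UU bf; have [mf [C fC]] := bf; rewrite /EE /Rintegral; congr fine.
have -> : (\int[mu]_(P in stiefel) (f P)%:E =
    \int[pushforward mu (mulmx U)]_(P in stiefel) (f P)%:E)%E.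
  by apply: eq_measure_integral => A mA _; exact: (esym (mu_inv UU mA)).
have preS : mulmx U @^-1` stiefel = stiefel.
  by apply/funext => P; exact: stiefel_mul.
rewrite (integral_pushforward (measurable_mulU U)) ?preS//.
- exact/measurable_EFinP.
- apply: (integrable_bdd (f := fun P => f (U *m P))); split.
    exact: (measurableT_comp mf (measurable_mulU U)).
  by exists C => P SP; apply: fC; rewrite (stiefel_mul P UU).
Qed.

Let s : R := Num.sqrt (d%:R / r%:R).

Let s2 : s ^+ 2 = d%:R / r%:R.
Proof. by rewrite sqr_sqrtr// divr_ge0. Qed.

Let stiefel_dotv P (w w' : 'cV[R]_r) : stiefel P ->
  dotv (P *m w) (P *m w') = d%:R / r%:R * dotv w w'.
Proof. by move=> SP; rewrite dotv_mulmxl mulmxA SP mul_scalar_mx dotvZr. Qed.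

Let norm2_stiefel_le P x : stiefel P -> norm2 (P^T *m x) <= s * norm2 x.
Proof.
move=> SP; have := dotv_le x (P *m (P^T *m x)).
rewrite dotv_mulmxr -sqr_norm2.
have -> : norm2 (P *m (P^T *m x)) = s * norm2 (P^T *m x).
  apply/eqP; rewrite -(@eqrXn2 _ 2) ?norm2_ge0 ?mulr_ge0 ?norm2_ge0 ?sqrtr_ge0//.
  by rewrite exprMn !sqr_norm2 s2 stiefel_dotv.
have := norm2_ge0 (P^T *m x); rewrite le_eqVlt => /predU1P[<- _|v0].
  by rewrite mulr_ge0 ?norm2_ge0 ?sqrtr_ge0.
by rewrite mulrA expr2 ler_pM2r// mulrC.
Qed.

Let measurable_v x : measurable_fun setT (fun P : 'M[R]_(d, r) => P^T *m x).
Proof. by apply: measurable_mulmx => //; exact: measurable_trmx. Qed.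

Let bdd_norm2 x : bdd (fun P => norm2 (P^T *m x)).
Proof.
split; first exact: measurable_norm2.
by exists (s * norm2 x) => P SP; rewrite ger0_norm ?norm2_ge0// norm2_stiefel_le.
Qed.

Let bdd_dotv x y : bdd (fun P => dotv (P^T *m x) (P^T *m y)).
Proof.
split; first exact: measurable_dotv.
have [_ [C xC]] := bddM (bdd_norm2 x) (bdd_norm2 y).
by exists C => P SP; rewrite (le_trans (norm_dotv_le _ _))// (le_trans (ler_norm _) (xC P SP)).
Qed.

(** Reflecting along [y] fixes [P^T x] and negates [P^T y], so the integral equals its own
    opposite. *)
Let EE_orth n x y : dotv x y = 0 ->
  EE (fun P => norm2 (P^T *m x) ^+ n * dotv (P^T *m x) (P^T *m y)) = 0.
Proof.
move=> xy; set f := (X in EE X).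
have bf : bdd f by apply: bddM; [exact: bddX|exact: bdd_dotv].
have := EE_inv (reflection_orthogonal y) bf.
rewrite (_ : (fun P => f (reflection y *m P)) = (fun P => -1 * f P)); last first.
  apply/funext => P; rewrite /f trmx_mul reflection_tr -!mulmxA reflection_self.
  by rewrite (reflection_orth (_ : dotv y x = 0)) ?[dotv y x]dotvC// mulmxN dotvNr mulrN mulN1r.
by rewrite EEZ// => h; lra.
Qed.

Let i0 : 'I_d := Ordinal d0.
Let e (i : 'I_d) : 'cV[R]_d := delta_mx i ord0.
Let c n := EE (fun P => norm2 (P^T *m e i0) ^+ n).

Let dotv_e i j : dotv (e i) (e j) = (i == j)%:R :> R.
Proof. by rewrite dotv_delta mxE eqxx andbT. Qed.

Let norm2_e i : norm2 (e i) = 1.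
Proof.
by apply/eqP; rewrite -(@eqrXn2 _ 2) ?norm2_ge0// sqr_norm2 dotv_e eqxx expr1n.
Qed.

(** Derivative at [t = 0] of [|x_t|^n <x_t, y_t>] for [x_t = P^T (e0 + t e_j)] and
    [y_t = P^T (e_j - t e0)]. Where [P^T e0 = 0] the first term is 0 by the convention on
    division. *)
Let W n j P := n%:R * dotv (P^T *m e i0) (P^T *m e j) ^+ 2 *
    (norm2 (P^T *m e i0) ^+ n / norm2 (P^T *m e i0) ^+ 2) +
  norm2 (P^T *m e i0) ^+ n * (norm2 (P^T *m e j) ^+ 2 - norm2 (P^T *m e i0) ^+ 2).

Let bddW n j : bdd (W n j).
Proof.
apply: bddD; last by apply: bddM; [exact: bddX|apply: bddB; exact: bddX].
have [_ [C hC]] := bddM (bdd_cst n%:R)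
  (bddM (bddX 2 (bdd_norm2 (e j))) (bddX n (bdd_norm2 (e i0)))).
split.
  apply: measurable_funM.
    by have [] := bddM (bdd_cst n%:R) (bddX 2 (bdd_dotv (e i0) (e j))).
  under eq_fun do rewrite -exprVn.
  apply: measurable_funM; first by have [] := bddX n (bdd_norm2 (e i0)).
  by apply: measurable_funX; apply: measurable_norm2_inv.
exists C => P SP; apply: le_trans (hC P SP).
rewrite ger0_norm; last first.
  apply: mulr_ge0; first by apply: mulr_ge0 => //; exact: sqr_ge0.
  by apply: divr_ge0; [apply: exprn_ge0; exact: norm2_ge0|exact: sqr_ge0].
rewrite (le_trans _ (ler_norm _))// -mulrA ler_wpM2l//.
have := norm2_ge0 (P^T *m e i0); rewrite le_eqVlt => /predU1P[<-|a0].
  by rewrite !expr0n /= invr0 !mulr0 mulr_ge0 ?sqr_ge0// ler0n.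
rewrite mulrCA [leRHS]mulrC ler_wpM2l ?exprn_ge0 ?norm2_ge0//.
rewrite ler_pdivrMr ?exprn_gt0// -exprMn mulrC -(real_normK (num_real (dotv _ _))).
by rewrite lerXn2r ?nnegrE ?mulr_ge0 ?norm2_ge0// norm_dotv_le.
Qed.

(* Differentiating [EE_orth] along the orthogonal pair [e0 + t e_j],
   [e_j - t e0] at [t = 0]. *)
Let EE_W n j : j != i0 -> EE (W n j) = 0.
Proof.
(* For [t <= 1] the norm of [P^T (e0 + t e_j)] is at most [s + s]. *)
move=> ji; pose K := 2 * s.
have s0 : 0 <= s by exact: sqrtr_ge0.
have sK : s <= K by rewrite /K; lra.
have K0 : 0 <= K by exact: le_trans sK.
have [C hC] := norm_power_taylor1 n K0.
have orth0 : EE (fun P => norm2 (P^T *m e i0) ^+ n * dotv (P^T *m e i0) (P^T *m e j)) = 0.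
  by apply: EE_orth; rewrite dotv_e eq_sym (negbTE ji).
have tW t : 0 < t <= 1 -> t * `|EE (W n j)| <= C * t ^+ 2.
  move=> t01; have /andP[t0 t1] := t01.
  pose psi P := norm2 (P^T *m (e i0 + t *: e j)) ^+ n *
    dotv (P^T *m (e i0 + t *: e j)) (P^T *m (e j - t *: e i0)).
  have bpsi : bdd psi by apply: bddM; [exact: bddX|exact: bdd_dotv].
  have psi0 : EE psi = 0.
    apply: EE_orth; rewrite dotvDl !dotvBr !dotvZl !dotvZr !dotv_e !eqxx (eq_sym i0).
    by rewrite (negbTE ji) /=; ring.
  pose rem P := psi P - norm2 (P^T *m e i0) ^+ n * dotv (P^T *m e i0) (P^T *m e j) - t * W n j P.
  have b0 : bdd (fun P => norm2 (P^T *m e i0) ^+ n * dotv (P^T *m e i0) (P^T *m e j)).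
    by apply: bddM; [exact: bddX|exact: bdd_dotv].
  have btW : bdd (fun P => t * W n j P) by apply: bddM => //; exact: bddW.
  have brem : bdd rem by apply: bddB => //; exact: bddB.
  have EErem : EE rem = - (t * EE (W n j)).
    by rewrite /rem (EEB (bddB bpsi b0) btW) (EEB bpsi b0) (EEZ t (bddW n j)) psi0 orth0; lra.
  have remC P : stiefel P -> `|rem P| <= C * t ^+ 2.
    move=> SP; rewrite /rem /psi /W !mulmxDr mulmxN -!scalemxAr.
    set x := P^T *m e i0; set y := P^T *m e j.
    have xs : norm2 x <= s by rewrite (le_trans (norm2_stiefel_le _ SP))// norm2_e mulr1.
    have ys : norm2 y <= s by rewrite (le_trans (norm2_stiefel_le _ SP))// norm2_e mulr1.
    have -> : dotv (x + t *: y) (y - t *: x) =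
        (1 - t ^+ 2) * dotv x y + t * (norm2 y ^+ 2 - norm2 x ^+ 2).
      by rewrite dotvDl !dotvBr !dotvZl !dotvZr !sqr_norm2 (dotvC y x); ring.
    apply: hC; rewrite ?norm2_ge0 ?norm_dotv_le//=.
    - exact: le_trans sK.
    - exact: le_trans sK.
    - rewrite (le_trans (ler_norm2D _ _))// norm2Z (ger0_norm (ltW t0)).
      have : t * norm2 y <= 1 * norm2 y by rewrite ler_wpM2r ?norm2_ge0.
      rewrite /K; lra.
    - by rewrite !sqr_norm2 dotvDl !dotvDr !dotvZl !dotvZr (dotvC y x); ring.
    - have tn : norm2 (t *: y) = t * norm2 y by rewrite norm2Z (ger0_norm (ltW t0)).
      have := ler_norm2D x (t *: y); have := ler_norm2D (x + t *: y) (- (t *: y)).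
      by rewrite addrK norm2N tn ler_norml; lra.
  rewrite -{1}(ger0_norm (ltW t0)) -normrM -normrN -EErem.
  rewrite ler_norml; apply/andP; split.
    rewrite -[leLHS]EE_cst; apply: EE_le; [exact: bdd_cst|exact: brem|move=> P SP].
    by have := remC P SP; rewrite ler_norml => /andP[].
  rewrite -[leRHS]EE_cst; apply: EE_le; [exact: brem|exact: bdd_cst|move=> P SP].
  by have := remC P SP; rewrite ler_norml => /andP[].
apply/eqP; rewrite -normr_le0.
have [//|w0] := leP `|EE (W n j)| 0.
have C1 : 0 < C.
  have := tW 1; rewrite ltr01 lexx => /(_ isT); rewrite mul1r expr1n mulr1.
  exact: lt_le_trans.
(* With [t <= |EE W| / (2 C)], the bound [t |EE W| <= C t^2] would give [|EE W| <= |EE W| / 2]. *)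
pose t := Num.min 1 (`|EE (W n j)| / (2 * C)).
have t0 : 0 < t by rewrite lt_min ltr01 divr_gt0// mulr_gt0.
have t1 : t <= 1 by rewrite ge_min lexx.
have := tW t; rewrite t0 t1 => /(_ isT); rewrite expr2 mulrCA ler_pM2l// => h.
have : t <= `|EE (W n j)| / (2 * C) by rewrite ge_min lexx orbT.
rewrite ler_pdivlMr ?mulr_gt0//; lra.
Qed.

Let sum_dotv_sqr P x : stiefel P ->
  \sum_j dotv (P^T *m x) (P^T *m e j) ^+ 2 = d%:R / r%:R * norm2 (P^T *m x) ^+ 2.
Proof.
move=> SP; rewrite sqr_norm2 -(stiefel_dotv _ _ SP); apply: eq_bigr => j _.
by rewrite -dotv_mulmxl dotvC dotv_delta expr2.
Qed.

Let sum_norm2_sqr P : stiefel P -> \sum_j norm2 (P^T *m e j) ^+ 2 = d%:R.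
Proof.
move=> SP.
have -> : \sum_j norm2 (P^T *m e j) ^+ 2 = \tr (P *m P^T).
  apply: eq_bigr => j _; rewrite sqr_norm2 -dotv_mulmxr mulmxA dotv_delta.
  by rewrite -colE mxE.
by rewrite mxtrace_mulC SP mxtrace_scalar -[LHS]mulr_natr divfK// pnatr_eq0 -lt0n.
Qed.

(** Summation over the other directions leaves a function of [|P^T e0|] alone: [P^T P = (d/r) I]
    evaluates both the sum of [<P^T e0, P^T e_j>^2] and that of [|P^T e_j|^2]. Integrated, it
    becomes [c_rec]. *)
Let sumW n P : stiefel P -> \sum_(j | j != i0) W n j P =
  d%:R / r%:R * (r%:R + n%:R) * norm2 (P^T *m e i0) ^+ n -
  (d%:R + n%:R) * norm2 (P^T *m e i0) ^+ n.+2.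
Proof.
move=> SP; rewrite big_split /= -mulr_suml -!mulr_sumr sumrB.
have h1 := sum_dotv_sqr (e i0) SP; have h2 := sum_norm2_sqr SP.
rewrite (bigD1 i0)//= -sqr_norm2 in h1; rewrite (bigD1 i0)//= in h2.
rewrite (_ : \sum_(j | j != i0) norm2 (P^T *m e i0) ^+ 2 =
    (d%:R - 1) * norm2 (P^T *m e i0) ^+ 2); last first.
  rewrite sumr_const (_ : #|_| = d.-1); last by rewrite cardC1 card_ord.
  have -> : d%:R - 1 = d.-1%:R :> R by rewrite -(natrB _ d0) subn1.
  by rewrite mulr_natl.
set S1 := \sum_(j | j != i0) _ ^+ 2 in h1 *; set S2 := \sum_(j | j != i0) _ ^+ 2 in h2 *.
have r0' : r%:R != 0 :> R by rewrite pnatr_eq0 -lt0n.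
set a := norm2 _ in h1 h2 *.
have -> : S1 = d%:R / r%:R * a ^+ 2 - (a ^+ 2) ^+ 2 by rewrite -h1 addrAC subrr add0r.
have -> : S2 = d%:R - a ^+ 2 by rewrite -h2 addrAC subrr add0r.
have [az|az] := eqVneq a 0; last by rewrite !exprS; field; rewrite r0' az.
case: n => [|n]; rewrite az ?expr0 !expr0n /= invr0; field; exact: r0'.
Qed.

Let c_rec n : (d%:R + n%:R) * c n.+2 = d%:R / r%:R * (r%:R + n%:R) * c n.
Proof.
apply/eqP; rewrite eq_sym -subr_eq0; apply/eqP.
rewrite -!EEZ; [|exact: bddX|exact: bddX].
rewrite -EEB; [|by apply: bddM; [exact: bdd_cst|exact: bddX]..].
transitivity (EE (fun P => \sum_(j | j != i0) W n j P)).
  by apply: EE_eq => P SP; rewrite sumW.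
rewrite EE_sum; last by move=> j; exact: bddW.
by rewrite big1// => j; exact: EE_W.
Qed.

Let c_ge0 n : 0 <= c n.
Proof.
rewrite -(EE_cst 0); apply: EE_le; [exact: bdd_cst|exact: bddX|].
by move=> P _; rewrite exprn_ge0 ?norm2_ge0.
Qed.

Let c0 : c 0%N = 1.
Proof. by rewrite /c; under EE_eq do rewrite expr0; exact: EE_cst. Qed.

Let c_logconvex n : c n.+1 ^+ 2 <= c n * c n.+2.
Proof.
apply: sqr_le_mul_of_weighted_mean; rewrite ?c_ge0// => l l0.
rewrite (mulrC (c n.+2)) -!EEZ; do ?exact: bddX.
rewrite -EED; do ?by apply: bddM; [exact: bdd_cst|exact: bddX].
apply: EE_le.
- by apply: bddM; [exact: bdd_cst|exact: bddX].
- by apply: bddD; apply: bddM; (exact: bdd_cst || exact: bddX).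
move=> P _; set a := norm2 _; have a0 : 0 <= a by exact: norm2_ge0.
have -> : 2 * a ^+ n.+1 = (2 * a) * a ^+ n by rewrite exprS; ring.
have -> : l * a ^+ n + l^-1 * a ^+ n.+2 = (l + l^-1 * (a * a)) * a ^+ n.
  by rewrite !exprS; ring.
rewrite ler_wpM2r ?exprn_ge0// -(ler_pM2l l0) mulrDr (mulrA l l^-1) divff ?gt_eqF// mul1r.
have := sqr_ge0 (l - a); lra.
Qed.

Let c1_tau : c 1%N = tau R d r.
Proof. exact: first_moment_tau. Qed.

Let reflect_to x : x != 0 ->
  exists U : 'M[R]_d, [/\ U^T = U, orthogonal_group U & U *m e i0 = (norm2 x)^-1 *: x].
Proof.
move=> x0; pose y := (norm2 x)^-1 *: x; exists (reflection (e i0 - y)).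
split; [exact: reflection_tr|exact: reflection_orthogonal|].
apply: reflection_swap; rewrite -!sqr_norm2 norm2_e /y norm2Z.
by rewrite ger0_norm ?invr_ge0 ?norm2_ge0// mulVf// norm2_eq0.
Qed.

Let scale_back x : x != 0 -> x = norm2 x *: ((norm2 x)^-1 *: x).
Proof. by move=> x0; rewrite scalerA divff ?scale1r// norm2_eq0. Qed.

Let EE_norm2 x : EE (fun P => norm2 (P^T *m x)) = tau R d r * norm2 x.
Proof.
have [->|x0] := eqVneq x 0.
  by rewrite norm20 mulr0; under EE_eq do rewrite mulmx0 norm20; exact: EE_cst.
have [U [Ut UU Ux]] := reflect_to x0.
rewrite -(EE_inv UU (bdd_norm2 x)) -c1_tau mulrC /c -EEZ; last exact: bddX.
apply: EE_eq => P _; rewrite {1}(scale_back x0) -Ux -scalemxAr norm2Z.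
rewrite ger0_norm ?norm2_ge0// expr1 trmx_mul -!mulmxA; congr (_ * norm2 (_ *m _)).
by rewrite Ut mulmxA -{1}Ut UU mul1mx.
Qed.

(** The [i]-th coordinate of [descent_dir P e0]. The next lemmas describe the second-moment matrix
    of these coordinates. *)
Let Y i P : R := (norm2 (P^T *m e i0))^-1 * dotv (P^T *m e i0) (P^T *m e i).

Let bddY i : bdd (Y i).
Proof.
split; first by apply: measurable_funM; [exact: measurable_norm2_inv|exact: measurable_dotv].
have [_ [C hC]] := bdd_norm2 (e i); exists C => P SP; apply: le_trans (hC P SP).
rewrite normrM normfV !(ger0_norm (norm2_ge0 _)).
have := norm2_ge0 (P^T *m e i0); rewrite le_eqVlt => /predU1P[<-|a0].
  by rewrite invr0 mul0r norm2_ge0.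
by rewrite ler_pdivrMl// norm_dotv_le.
Qed.

Let bddYY i j : bdd (fun P => Y i P * Y j P). Proof. exact: bddM. Qed.

(** One of the two indices, say [k], differs from [i0]; the reflection along [e k] flips [Y k] and
    fixes both [e0] and the other coordinate. *)
Let Y_orth i j : i != j -> EE (fun P => Y i P * Y j P) = 0.
Proof.
have main k l : k != i0 -> l != k -> EE (fun P => Y k P * Y l P) = 0.
  move=> ki lk; have := EE_inv (reflection_orthogonal (e k)) (bddYY k l).
  rewrite (_ : (fun P => Y k (_ *m P) * _) = (fun P => -1 * (Y k P * Y l P))); last first.
    apply/funext => P; rewrite /Y trmx_mul reflection_tr -!mulmxA reflection_self.
    rewrite !reflection_orth ?dotv_e; [|by rewrite eq_sym (negbTE lk)|by rewrite (negbTE ki)].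
    by rewrite mulmxN dotvNr; ring.
  by rewrite EEZ// => h; lra.
move=> ij; have [ii|ii] := eqVneq i i0; last by apply: main => //; rewrite eq_sym.
rewrite -(main j i) -?ii//; last by rewrite eq_sym.
by apply: EE_eq => P _; rewrite mulrC.
Qed.

Let Y_sqr_swap j k : j != i0 -> k != i0 ->
  EE (fun P => Y j P * Y j P) = EE (fun P => Y k P * Y k P).
Proof.
move=> ji ki; rewrite -(EE_inv (reflection_orthogonal (e j - e k)) (bddYY j j)).
apply: EE_eq => P _; rewrite /Y trmx_mul reflection_tr -!mulmxA.
rewrite reflection_swap ?dotv_e ?eqxx//.
by rewrite reflection_orth// dotvBl !dotv_e (negbTE ji) (negbTE ki) subrr.
Qed.

Let Y_i0 : EE (fun P => Y i0 P * Y i0 P) = 1.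
Proof.
(* At [n = 0] the recursion reads [d c 2 = d c 0]: the second moment along [e0] is 1, and [Y i0] is
   [|P^T e0|]. *)
have := c_rec 0; rewrite c0 !addr0 mulr1 divfK ?pnatr_eq0 -?lt0n// => h.
have <- : c 2 = 1.
  by apply: (mulfI (_ : d%:R != 0 :> R)); rewrite ?pnatr_eq0 -?lt0n// h mulr1.
apply: EE_eq => P _; rewrite /Y -sqr_norm2; set a := norm2 _.
have [->|a0] := eqVneq a 0; first by rewrite invr0 !mul0r expr0n.
by rewrite !exprS; field.
Qed.

(** The sum is [|descent_dir P e0|^2]: it equals [d/r] when [P^T e0] is nonzero and 0 otherwise,
    hence an inequality. *)
Let sumY_le P : stiefel P -> \sum_j Y j P * Y j P <= d%:R / r%:R.
Proof.
move=> SP; under eq_bigr => j _ do rewrite -expr2 /Y exprMn.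
rewrite -mulr_sumr sum_dotv_sqr//; set a := norm2 _.
have [->|a0] := eqVneq a 0; first by rewrite invr0 expr0n /= mul0r divr_ge0.
by rewrite mulrCA exprVn mulVf ?mulr1// sqrf_eq0.
Qed.

(** The direction [e0] takes 1 out of the total [d/r]; by symmetry the other [d - 1] directions
    share the rest equally. *)
Let Y_sqr_le j : (1 < d)%N -> j != i0 ->
  EE (fun P => Y j P * Y j P) <= (d%:R / r%:R - 1) / (d%:R - 1).
Proof.
move=> d1 ji.
have : \sum_k EE (fun P => Y k P * Y k P) <= d%:R / r%:R.
  rewrite -EE_sum//.
  rewrite -[leRHS]EE_cst; apply: EE_le; [|exact: bdd_cst|exact: sumY_le].
  by apply: bdd_sum => k; exact: bddYY.
rewrite (bigD1 i0)//= Y_i0 -lerBrDl => h.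
have d10 : 0 < d%:R - 1 :> R by rewrite subr_gt0 ltr1n.
rewrite ler_pdivlMr//; apply: le_trans h.
rewrite (eq_bigr (fun=> EE (fun P => Y j P * Y j P))); last first.
  by move=> k ki; exact: Y_sqr_swap.
rewrite sumr_const (_ : #|_| = d.-1); last by rewrite cardC1 card_ord.
have -> : d%:R - 1 = d.-1%:R :> R by rewrite -(natrB _ d0) subn1.
by rewrite mulr_natr.
Qed.

Let bdd_quadform (S : 'M[R]_d) x : bdd (fun P => quadform S (descent_dir P x)).
Proof.
split; first by apply: measurable_quadform; exact: measurable_descent_dir.
have ndir P : stiefel P -> norm2 (descent_dir P x) <= s.
  move=> SP; rewrite norm2Z normfV ger0_norm ?norm2_ge0//.
  have -> : norm2 (P *m (P^T *m x)) = s * norm2 (P^T *m x).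
    apply/eqP; rewrite -(@eqrXn2 _ 2) ?norm2_ge0 ?mulr_ge0 ?norm2_ge0 ?sqrtr_ge0//.
    by rewrite exprMn !sqr_norm2 s2 stiefel_dotv.
  have := norm2_ge0 (P^T *m x); rewrite le_eqVlt => /predU1P[<-|v0].
    by rewrite invr0 mul0r sqrtr_ge0.
  by rewrite mulrCA mulVf ?mulr1// gt_eqF.
exists (s * (opnorm S * s)) => P SP.
rewrite (le_trans (norm_dotv_le _ _))//; apply: ler_pM; rewrite ?norm2_ge0 ?ndir//.
by rewrite (le_trans (norm2_mulmx_le _ _))// ler_wpM2l ?opnorm_ge0 ?ndir.
Qed.

Let EE_quadform_le (S : 'M[R]_d) x : (1 < d)%N -> (r <= d)%N -> S != 0 -> symmetric_psd S ->
  EE (fun P => quadform S (descent_dir P x)) <= ell r S * opnorm S.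
Proof.
move=> d1 rd S0 [_ Sge0].
have d10 : 0 < d%:R - 1 :> R by rewrite subr_gt0 ltr1n.
have r0' : 0 < r%:R :> R by rewrite ltr0n.
have rd' : r%:R <= d%:R :> R by rewrite ler_nat.
have r1 : 1 <= r%:R :> R by rewrite ler1n.
have nS := opnorm_gt0 S0.
have diagS (U : 'M[R]_d) i : (U^T *m S *m U) i i = quadform S (U *m e i).
  by rewrite /quadform dotv_mulmxl dotv_delta !mulmxA /e -colE [RHS]mxE.
(* [b] bounds the second moment across [x]. The integral is then at most [(1 - b) S'00 + b tr S],
   and [S'00 <= opnorm S]; [ellE] identifies the resulting bound with the constant [ell]. *)
pose b := (d%:R / r%:R - 1) / (d%:R - 1) : R.
have ellE : ell r S * opnorm S = (1 - b) * opnorm S + b * \tr S.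
  by rewrite /ell /effective_rank /b; field; rewrite !gt_eqF.
have b1 : 0 <= 1 - b.
  rewrite subr_ge0 ler_pdivrMr// mul1r lerD2r ler_pdivrMr//.
  by rewrite -{1}(mulr1 d%:R) ler_wpM2l.
have b0 : 0 <= b.
  by apply: divr_ge0; [rewrite subr_ge0 ler_pdivlMr// mul1r|exact: ltW].
have trS : 0 <= \tr S.
  apply: sumr_ge0 => i _; have := diagS 1%:M i.
  by rewrite trmx1 mul1mx mulmx1 => ->; exact: Sge0.
have [->|x0] := eqVneq x 0.
  rewrite (EE_eq (g := fun=> 0)); last first.
    by move=> P _; rewrite /descent_dir !mulmx0 scaler0 /quadform dotv0l.
  by rewrite EE_cst ellE; apply: addr_ge0; apply: mulr_ge0 => //; exact: opnorm_ge0.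
have [U [Ut UU Ux]] := reflect_to x0.
(* By invariance [x] may be moved to a multiple of [e0] if [S] is conjugated accordingly, which
   preserves the trace. *)
pose S' := U^T *m S *m U.
have UU' : U *m U = 1%:M by rewrite -{1}Ut.
rewrite -(EE_inv UU (bdd_quadform S x)).
rewrite (EE_eq (g := fun P => \sum_i \sum_j S' i j * (Y i P * Y j P))); last first.
  move=> P _.
  pose y : 'cV[R]_d := \col_i Y i P.
  have -> : descent_dir (U *m P) x = U *m y.
    rewrite /descent_dir {1 2}(scale_back x0) -Ux trmx_mul Ut -!mulmxA.
    rewrite -!scalemxAr !(mulmxA U U) UU' mul1mx norm2Z ger0_norm ?norm2_ge0//.
    rewrite scalerA invfM mulrAC mulVf ?norm2_eq0// mul1r scalemxAr; congr (U *m _).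
    apply/matrixP => i k; rewrite ord1 !mxE /Y; congr (_ * _).
    by rewrite -[RHS]dotvC dotv_mulmxl trmxK dotv_delta mxE.
  rewrite /quadform dotv_mulmxl !mulmxA -/S' /dotv; apply: eq_bigr => i _.
  rewrite !mxE mulr_sumr; apply: eq_bigr => j _; rewrite !mxE; ring.
have bdS i j : bdd (fun P => S' i j * (Y i P * Y j P)) by apply: bddM.
rewrite EE_sum; last by move=> i; apply: bdd_sum.
rewrite (eq_bigr (fun i => S' i i * EE (fun P => Y i P * Y i P))); last first.
  move=> i _; rewrite EE_sum// (bigD1 i)//= big1 ?addr0 ?EEZ// => j ji.
  by rewrite EEZ// Y_orth ?mulr0// eq_sym.
have trE : \tr S' = \tr S by rewrite /S' mxtrace_mulC Ut mulmxA UU' mul1mx.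
have trD : \tr S = S' i0 i0 + \sum_(i | i != i0) S' i i.
  by rewrite -trE /mxtrace (bigD1 i0).
rewrite (bigD1 i0)//= Y_i0 mulr1 ellE trD.
have S0le : S' i0 i0 <= opnorm S.
  rewrite diagS (le_trans (quadform_le _ _))// Ux norm2Z.
  by rewrite ger0_norm ?invr_ge0 ?norm2_ge0// mulVf ?norm2_eq0// expr1n mulr1.
have sumle : \sum_(i | i != i0) S' i i * EE (fun P => Y i P * Y i P) <=
    b * \sum_(i | i != i0) S' i i.
  rewrite mulr_sumr; apply: ler_sum => i ii0; rewrite mulrC ler_wpM2r//.
    by rewrite diagS Sge0.
  exact: Y_sqr_le.
have : (1 - b) * S' i0 i0 <= (1 - b) * opnorm S by rewrite ler_wpM2l.
by move: sumle; set A := \sum_(i | _) _; set B := \sum_(i | _) _; lra.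
Qed.

Let integral_stiefel f : bdd f -> (forall P, 0 <= f P) ->
  (\int[mu]_P (f P)%:E = (EE f)%:E)%E.
Proof.
move=> bf f0; have [mf _] := bf.
rewrite /EE /Rintegral fineK; last by apply: integrable_fin_num => //; exact: integrable_bdd.
have mfE A : measurable_fun A (EFin \o f) by apply/measurable_EFinP; exact: measurable_funTS.
have null : mu (~` stiefel) = 0%E by rewrite probability_setC// mu_stiefel subee.
rewrite -(setUv stiefel) ge0_integral_setU//.
- by rewrite (null_set_integral (measurableC mS) (mfE _) null) adde0.
- exact: measurableC.
- by move=> P _; rewrite lee_fin.
- by apply/disj_setPCl.
Qed.

Lemma integral_norm2_haar x :
  (\int[mu]_P (norm2 (P^T *m x))%:E = (tau R d r * norm2 x)%:E)%E.
Proof. by rewrite integral_stiefel ?EE_norm2// => P; exact: norm2_ge0. Qed.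

Lemma integral_quadform_haar_le (S : 'M[R]_d) x :
  (1 < d)%N -> (r <= d)%N -> S != 0 -> symmetric_psd S ->
  (\int[mu]_P (quadform S (descent_dir P x))%:E <= (ell r S * opnorm S)%:E)%E.
Proof.
move=> d1 rd S0 Spsd; rewrite integral_stiefel// ?lee_fin ?EE_quadform_le// => P.
by have [_] := Spsd; apply.
Qed.

End haar_moments.

(** * From Haar measure on O(d) to the law of the sampled block *)

Section haar_law.
Context {R : realType} {d r : nat} (hr : (r <= d)%N).
Hypothesis d0 : (0 < d)%N.

Let haar_block_entry (Q : 'M[R]_d) i j :
  haar_block hr Q i j = Num.sqrt (d%:R / r%:R) * Q i (widen_ord hr j).
Proof. by rewrite /haar_block !mxE. Qed.

Let measurable_haar_block : measurable_fun setT (@haar_block R d r hr).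
Proof.
apply/measurable_mxP => i j; under eq_fun do rewrite haar_block_entry.
by apply: measurable_funM => //; exact: measurable_mx_entry.
Qed.

Let haar_block_mul (U Q : 'M[R]_d) : haar_block hr (U *m Q) = U *m haar_block hr Q.
Proof.
apply/matrixP => i j; rewrite haar_block_entry !mxE mulr_sumr.
by apply: eq_bigr => k _; rewrite haar_block_entry mulrCA.
Qed.

Let haar_block_stiefel (Q : 'M[R]_d) : orthogonal_group Q -> stiefel (haar_block hr Q).
Proof.
move=> QQ; have QE : Q^T *m Q = 1%:M := QQ.
apply/matrixP => i j; rewrite [LHS]mxE.
have /matrixP /(_ (widen_ord hr i) (widen_ord hr j)) := QE; rewrite [LHS]mxE [RHS]mxE => QEij.
transitivity (d%:R / r%:R * (widen_ord hr i == widen_ord hr j)%:R : R).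
  rewrite -QEij mulr_sumr; apply: eq_bigr => k _.
  by rewrite [(_^T) i k]mxE [(_^T) _ k]mxE !haar_block_entry mulrACA -expr2 sqr_sqrtr.
by rewrite mulr_natr [RHS]mxE.
Qed.

(** Selecting columns commutes with left multiplication, so the pushforward of Haar measure by
    [haar_block] inherits left invariance; orthonormal columns put it on [stiefel]. *)
Lemma haar_matrix_law (dO : measure_display) (Omega : measurableType dO)
    (Pr : probability Omega R) (P : Omega -> 'M[R]_(d, r)) : is_haar_matrix Pr hr P ->
  exists mu : probability 'M[R]_(d, r) R, [/\ has_law Pr P mu, mu stiefel = 1%E &
    forall U, orthogonal_group U ->
      forall A : set 'M[R]_(d, r), measurable A -> mu (mulmx U @^-1` A) = mu A].
Proof.
move=> [nu [nuO nu_inv] law].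
pose X : {mfun 'M[R]_d >-> 'M[R]_(d, r)} := HB.pack (@haar_block R d r hr)
  (isMeasurableFun.Build _ _ _ _ _ measurable_haar_block).
exists (distribution nu X); split => //.
(* As [d / d = 1], O(d) is the square case of [stiefel], and is measurable for that reason. *)
- have OE : @orthogonal_group R d = @stiefel R d d.
    by rewrite /stiefel divff// pnatr_eq0 -lt0n.
  have mXS : measurable (haar_block hr @^-1` @stiefel R d r).
    by rewrite -[Y in measurable Y]setTI; apply: measurable_haar_block => //;
      exact: measurable_stiefel.
  have le1 : (nu (@orthogonal_group R d) <= nu (haar_block hr @^-1` @stiefel R d r))%E.
    have mO : measurable (@orthogonal_group R d) by rewrite OE; exact: measurable_stiefel.
    have sub : @orthogonal_group R d `<=` haar_block hr @^-1` @stiefel R d r.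
      by move=> Q QO; exact: haar_block_stiefel.
    by apply: le_measure; rewrite ?inE.
  apply/eqP; rewrite eq_le; apply/andP; split.
    by apply: probability_le1; exact: measurable_stiefel.
  by rewrite nuO in le1.
- move=> U UU A mA.
  have mXA : measurable (haar_block hr @^-1` A).
    by rewrite -[Y in measurable Y]setTI; apply: measurable_haar_block.
  transitivity (nu (mulmx U @^-1` (haar_block hr @^-1` A))); last exact: nu_inv.
  by congr (nu _); apply/funext => Q; rewrite /preimage /= haar_block_mul.
Qed.

End haar_law.

(** * A first-order inequality for powers of the norm *)

Section norm_power_inequality.
Context {R : realType}.

(** For [a < 1] this is Young's inequality for [x^a * 1] with exponents [1/a] and [1/(1-a)]. *)
Lemma powR_bernoulli (x a : R) : 0 <= x -> 0 < a <= 1 -> x `^ a <= 1 + a * (x - 1).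
Proof.
move=> x0 /andP[a0]; rewrite le_eqVlt => /predU1P[->|a1].
  by rewrite powRr1// mul1r addrCA subrr addr0.
have b0 : 0 < 1 - a by rewrite subr_gt0.
have := @conjugate_powR R (x `^ a) 1 a^-1 (1 - a)^-1 (powR_ge0 _ _) ler01.
rewrite !invr_gt0 => /(_ a0 b0); rewrite !invrK addrCA subrr addr0 => /(_ erefl).
by rewrite -powRrM divff ?gt_eqF// powRr1// powR1 !mulr1 mul1r; lra.
Qed.

Lemma powR_sub2 (p a : R) : 0 < a -> a `^ (p - 2) = a `^ p / a ^+ 2.
Proof.
move=> a0; rewrite powRB; last by rewrite (gt_eqF a0) implybT.
by rewrite -(powR_mulrn 2 (ltW a0)).
Qed.

Lemma sqr_powR_half (p a : R) : 0 <= a -> (a ^+ 2) `^ (p / 2) = a `^ p.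
Proof.
by move=> a0; rewrite -(powR_mulrn 2 a0) -powRrM mulrC divfK.
Qed.

(** As [p/2 <= 1], the map [s |-> s^(p/2)] is concave; its tangent at [|x|^2] is evaluated at
    [|x + y|^2]. *)
Let bernoulli_around (n : nat) (p : R) (x y : 'cV[R]_n) : 1 < p <= 2 -> x != 0 ->
  norm2 (x + y) `^ p <= norm2 x `^ p + norm2 x `^ (p - 2) *
    (p * dotv x y + p / 2 * norm2 y ^+ 2).
Proof.
move=> /andP[p1 p2] x0; have a0 : 0 < norm2 x by rewrite norm2_gt0.
rewrite -(sqr_powR_half p (norm2_ge0 (x + y))).
pose z := norm2 (x + y) ^+ 2 / norm2 x ^+ 2.
have z0 : 0 <= z by rewrite divr_ge0 ?sqr_ge0.
have -> : norm2 (x + y) ^+ 2 = norm2 x ^+ 2 * z by rewrite /z mulrC divfK// sqrf_eq0 gt_eqF.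
rewrite powRM ?sqr_ge0// sqr_powR_half ?norm2_ge0//.
have ap : 0 <= norm2 x `^ p by exact: powR_ge0.
apply: le_trans (ler_wpM2l ap (powR_bernoulli z0 (_ : 0 < p / 2 <= 1))) _; first by lra.
have -> : z - 1 = (2 * dotv x y + norm2 y ^+ 2) / norm2 x ^+ 2.
  rewrite /z sqr_norm2 dotvDl !dotvDr -!sqr_norm2 (dotvC y x).
  by field; rewrite gt_eqF.
rewrite powR_sub2// le_eqVlt; apply/orP; left; apply/eqP; field.
by rewrite gt_eqF.
Qed.

(* Expanding around the larger of [x] and [y] gives the constant [2]; at [x = 0]
   the first-order term vanishes because [dotv 0 y = 0]. *)
Lemma norm2_powRD_le (n : nat) (p : R) (x y : 'cV[R]_n) : 1 < p <= 2 ->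
  norm2 (x + y) `^ p <=
  norm2 x `^ p + p * norm2 x `^ (p - 2) * dotv x y + 2 * norm2 y `^ p.
Proof.
move=> p12; have /andP[p1 p2] := p12; have pn0 : p != 0 by rewrite gt_eqF//; lra.
have [->|x0] := eqVneq x 0.
  rewrite add0r norm20 dotv0l powR0// mulr0 !add0r.
  by have := powR_ge0 (norm2 y) p; lra.
have a0 : 0 < norm2 x by rewrite norm2_gt0.
have [->|y0] := eqVneq y 0.
  by rewrite addr0 norm20 dotv0r powR0// !mulr0 !addr0.
have b0 : 0 < norm2 y by rewrite norm2_gt0.
have [ba|ab] := leP (norm2 y) (norm2 x).
  apply: le_trans (bernoulli_around y p12 x0) _.
  (* The exponent [p - 2] is nonpositive, so the larger norm has the smaller power; the factor
     [p / 2 <= 1] then fits under [2]. *)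
  have h : norm2 x `^ (p - 2) * norm2 y ^+ 2 <= norm2 y `^ p.
    have -> : norm2 y `^ p = norm2 y `^ (p - 2) * norm2 y ^+ 2.
      by rewrite powR_sub2// divfK// gt_eqF// exprn_gt0.
    rewrite ler_wpM2r ?sqr_ge0// -(opprB 2 p) !powRN lef_pV2 ?posrE ?powR_gt0//.
    by apply: ge0_ler_powR; rewrite ?nnegrE ?norm2_ge0// subr_ge0.
  rewrite mulrDr -!addrA lerD2l mulrCA mulrA lerD2l mulrCA.
  have := powR_ge0 (norm2 y) p.
  move: h; set u := _ * _; set v := _ `^ _; nra.
rewrite addrC; apply: le_trans (bernoulli_around x p12 y0) _.
(* Dividing by [|y|^p] leaves a scalar inequality in [t < 1] and [c = <x, y> / |y|^2 >= - t]. *)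
pose t := norm2 x / norm2 y.
have t0 : 0 < t by rewrite divr_gt0.
have t1 : t < 1 by rewrite ltr_pdivrMr// mul1r.
have aE : norm2 x = t * norm2 y by rewrite /t divfK// gt_eqF.
rewrite powR_sub2// powR_sub2// (dotvC y x) aE (powRM p (ltW t0) (ltW b0)).
set X := norm2 y `^ p; have X0 : 0 < X by exact: powR_gt0.
have c1 : - (norm2 x * norm2 y) <= dotv x y.
  by have := norm_dotv_le x y; rewrite ler_norml => /andP[].
pose c := dotv x y / norm2 y ^+ 2.
have cE : dotv x y = c * norm2 y ^+ 2 by rewrite /c divfK// sqrf_eq0 gt_eqF.
have ct : - t <= c.
  by rewrite /c ler_pdivlMr ?exprn_gt0//; move: c1; rewrite aE; lra.
have tp : t `^ p <= t * (1 + (p - 1) * (t - 1)).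
  rewrite -[leLHS](mulr_powRB1 (ltW t0)); last by lra.
  by rewrite ler_pM2l//; apply: powR_bernoulli; [exact: ltW|apply/andP; split; lra].
have tpge : t ^+ 2 <= t `^ p.
  rewrite -(powR_mulrn 2 (ltW t0)); by apply: ger_powR => //; rewrite t0 ltW.
have -> : X / norm2 y ^+ 2 * (p * dotv x y + p / 2 * (t * norm2 y) ^+ 2) =
    X * (p * c + p / 2 * t ^+ 2) by rewrite cE; field; rewrite gt_eqF.
have -> : t `^ p * X + p * (t `^ p * X / (t * norm2 y) ^+ 2) * dotv x y + 2 * X =
    X * (t `^ p + p * (t `^ p / t ^+ 2) * c + 2).
  by rewrite cE; field; rewrite !gt_eqF.
rewrite [leLHS](_ : _ = X * (1 + (p * c + p / 2 * t ^+ 2))); last by ring.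
rewrite ler_pM2l//.
have w1 : 1 <= t `^ p / t ^+ 2 by rewrite ler_pdivlMr ?mul1r// exprn_gt0.
have w2 : t * (t `^ p / t ^+ 2) <= 1 + (p - 1) * (t - 1).
  have -> : t * (t `^ p / t ^+ 2) = t `^ p / t by field; rewrite gt_eqF.
  by rewrite ler_pdivrMr// mulrC.
(* With [w = t^(p-2) >= 1] the goal is [p (1 - w) c + (p/2) t^2 <= 1 + t^p]. The worst case
   [c = - t], concavity of [t^(p-1)] and [p (2 - p) <= 1] bound the first term by [1 - t]; the
   second is at most [t]. *)
move: (t `^ p / t ^+ 2) w1 w2 => w w1 w2.
have h1 : p * (1 - w) * c <= p * (w - 1) * t.
  have : 0 <= p * (w - 1) * (c + t) by rewrite !mulr_ge0//; lra.
  lra.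
have h2 : p * (w - 1) * t <= p * (2 - p) * (1 - t).
  rewrite -!mulrA ler_pM2l; last by lra.
  by nra.
have h3 : p * (2 - p) * (1 - t) <= 1 - t.
  rewrite -[leRHS]mul1r ler_pM2r ?subr_gt0//; have := sqr_ge0 (p - 1); lra.
have h4 : p / 2 * t ^+ 2 <= t.
  have : t ^+ 2 <= t by rewrite expr2 ler_piMr ?ltW.
  have : p / 2 * t ^+ 2 <= 1 * t ^+ 2 by rewrite ler_wpM2r ?sqr_ge0//; lra.
  lra.
have := powR_ge0 t p; lra.
Qed.

End norm_power_inequality.

(** * Adding one centred draw to a fixed vector *)

Section one_draw.
Context {R : realType} {dT : measure_display} {T : measurableType dT}.
Context (mu : probability T R) {n : nat} (e : T -> 'cV[R]_n).
Hypothesis me : measurable_fun setT e.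
Hypothesis e_int : forall i, mu.-integrable setT (fun t => (e t i ord0)%:E).
Hypothesis e_mean : forall i, (\int[mu]_t (e t i ord0)%:E = 0)%E.

Let dotv_mean (x : 'cV[R]_n) : mu.-integrable setT (fun t => (dotv x (e t))%:E) /\
  (\int[mu]_t (dotv x (e t))%:E = 0)%E.
Proof.
rewrite /dotv; elim: (index_enum _) => [|i s [IH1 IH2]].
  under eq_fun do rewrite big_nil.
  by split; [exact: integrable0|exact: integral0].
have iZ : mu.-integrable setT (fun t => ((x i ord0)%:E * (e t i ord0)%:E)%E).
  exact: integrableZl.
have E : (fun t => (\sum_(j <- i :: s) x j ord0 * e t j ord0)%:E) =
    (fun t => ((x i ord0)%:E * (e t i ord0)%:E + (\sum_(j <- s) x j ord0 * e t j ord0)%:E)%E).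
  by apply/funext => t; rewrite big_cons EFinD EFinM.
rewrite E; split; first exact: integrableD.
by rewrite integralD// IH2 adde0 integralZl// e_mean mule0.
Qed.

(** The linear term of [norm2_powRD_le] integrates to 0 because [e] is centred: this is one step of
    a von Bahr-Esseen argument. *)
Lemma integral_norm2_powD_le (x : 'cV[R]_n) (p M : R) : 1 < p <= 2 ->
  (\int[mu]_t (norm2 (e t) `^ p)%:E <= M%:E)%E ->
  (\int[mu]_t (norm2 (x + e t) `^ p)%:E <= (norm2 x `^ p + 2 * M)%:E)%E.
Proof.
move=> p12 eM; have [dint dmean] := dotv_mean x.
have mp (f : T -> 'cV[R]_n) : measurable_fun setT f ->
    measurable_fun setT (fun t => (norm2 (f t) `^ p)%:E).
  move=> mf; apply/measurable_EFinP.
  exact: (measurableT_comp (measurable_powR _) (measurable_norm2 mf)).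
have pint : mu.-integrable setT (fun t => (norm2 (e t) `^ p)%:E).
  apply/integrableP; split; first exact: mp.
  under eq_integral do rewrite gee0_abs ?lee_fin ?powR_ge0//.
  by rewrite (le_lt_trans eM)// ltry.
pose c := p * norm2 x `^ (p - 2).
have cint : mu.-integrable setT (fun t => (c%:E * (dotv x (e t))%:E)%E) by exact: integrableZl.
have p2int : mu.-integrable setT (fun t => (2%:E * (norm2 (e t) `^ p)%:E)%E).
  exact: integrableZl.
have kint : mu.-integrable setT (cst (norm2 x `^ p)%:E) by exact: finite_measure_integrable_cst.
have i1 : mu.-integrable setT (fun t => ((norm2 x `^ p)%:E + c%:E * (dotv x (e t))%:E)%E).
  exact: (integrableD measurableT kint cint).
have i2 := integrableD measurableT i1 p2int.
apply: (@le_trans _ _ (\int[mu]_t ((norm2 x `^ p)%:E + c%:E * (dotv x (e t))%:E +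
    2%:E * (norm2 (e t) `^ p)%:E))%E).
  apply: ge0_le_integral => //.
  - by move=> t _; rewrite lee_fin powR_ge0.
  - by apply: mp; apply: measurable_addmx.
  - exact: (measurable_int mu i2).
  - move=> t _; rewrite -!EFinM -!EFinD lee_fin; exact: norm2_powRD_le.
rewrite (integralD measurableT i1 p2int) (integralD measurableT kint cint).
rewrite integralZl// dmean mule0 adde0 integralZl//.
have -> : (\int[mu]_t (cst (norm2 x `^ p)%:E) t = (norm2 x `^ p)%:E)%E.
  transitivity ((norm2 x `^ p)%:E * mu setT)%E; first exact: integral_cst.
  by rewrite probability_setT mule1.
rewrite [leRHS]EFinD [(2 * M)%:E]EFinM leeD2l//.
by rewrite lee_pmul2l.
Qed.

End one_draw.

(** * Integrating out a fresh draw *)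

Section independence.
Context {R : realType} {dO : measure_display} {Omega : measurableType dO}.
Context (Pr : probability Omega R).

Section fresh_draw.
Context {dT dZ : measure_display} {T : measurableType dT} {Z : measurableType dZ}.
Context (W : Omega -> T) (z : Omega -> Z) (nu : probability Z R).
Hypothesis mW : measurable_fun setT W.
Hypothesis z_law : has_law Pr z nu.
Hypothesis Wz_indep : forall A C, measurable A -> measurable C ->
  Pr (W @^-1` A `&` z @^-1` C) = (Pr (W @^-1` A) * Pr (z @^-1` C))%E.

(** The law of [(W, z)] and the product measure agree on rectangles, hence coincide; Tonelli then
    integrates [z] with [W] frozen. This plays the part of conditional expectation. *)
Lemma integral_fresh_draw (h : T * Z -> \bar R) : measurable_fun setT h ->
  (forall y, 0 <= h y)%E ->
  (\int[Pr]_w h (W w, z w) = \int[Pr]_w \int[nu]_s h (W w, s))%E.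
Proof.
move=> mh h0; have [mz zE] := z_law.
have mWz : measurable_fun setT (fun w => (W w, z w)) by exact: measurable_fun_pair.
pose X : {mfun Omega >-> T} := HB.pack W (isMeasurableFun.Build _ _ _ _ _ mW).
pose Y : {mfun Omega >-> (T * Z)%type} :=
  HB.pack (fun w => (W w, z w)) (isMeasurableFun.Build _ _ _ _ _ mWz).
transitivity (\int[distribution Pr Y]_y h y)%E.
  by rewrite ge0_integral_distribution.
transitivity (\int[distribution Pr X \x nu]_y h y)%E.
  apply: eq_measure_integral => A mA _; apply/esym.
  apply: product_measure_unique => // B C mB mC.
  transitivity (Pr (W @^-1` B `&` z @^-1` C)) => [//|].
  by rewrite Wz_indep// zE.
rewrite fubini_tonelli1// ge0_integral_distribution//.
- exact: measurable_fun_fubini_tonelli_F.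
- by move=> x; apply: integral_ge0.
Qed.

End fresh_draw.

Section cylinders.
Context {I : eqType} (G : I -> set (set Omega)).
Hypothesis GT : forall i, G i setT.
Hypothesis GI : forall i, setI_closed (G i).
Hypothesis Gm : forall i, G i `<=` measurable.
Hypothesis G_indep : mutually_independent Pr G.

(** A pi-system generating the information carried by the draws indexed by [J]. *)
Definition cylinders (J : set I) : set (set Omega) :=
  [set A | exists (s : seq I) (B : I -> set Omega),
    [/\ forall i, i \in s -> J i, forall i, G i (B i) & A = \bigcap_(i in [set` s]) B i]].

Lemma cylindersT J : cylinders J setT.
Proof.
exists [::], (fun=> setT); split=> //.
by apply/seteqP; split.
Qed.

Lemma sub_cylinders J i A : J i -> G i A -> cylinders J A.
Proof.
move=> Ji GA; exists [:: i], (fun k => if k == i then A else setT); split.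
- by move=> k; rewrite inE => /eqP ->.
- by move=> k; case: eqP => [->|].
- apply/seteqP; split => [w Aw k /=|w /(_ i)/=]; first by rewrite inE => ->.
  by rewrite inE eqxx; exact.
Qed.

Lemma cylinders_setI J : setI_closed (cylinders J).
Proof.
move=> _ _ [s [B [sJ GB ->]]] [s' [B' [sJ' GB' ->]]].
exists (s ++ s'), (fun k => (if k \in s then B k else setT) `&` (if k \in s' then B' k else setT)).
split.
- by move=> i; rewrite mem_cat => /orP[/sJ|/sJ'].
- by move=> i; apply: GI; case: ifP.
- apply/seteqP; split => [w [h h'] k /=|w h].
    by rewrite mem_cat => _; split; case: ifP => [ks|//]; [exact: h|exact: h'].
  split => k /= ks; have := h k; rewrite /= mem_cat ks ?orbT => /(_ isT) [];
    by rewrite ?ks.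
Qed.

Lemma cylinders_measurable J : cylinders J `<=` measurable.
Proof.
move=> _ [s [B [_ GB ->]]]; apply: fin_bigcap_measurable; first exact: finite_seq.
by move=> i _; apply: Gm; exact: GB.
Qed.

Lemma cylinders_indep J i A C : ~ J i -> cylinders J A -> G i C ->
  Pr (A `&` C) = (Pr A * Pr C)%E.
Proof.
move=> Ji [s [B [sJ GB ->]]] GC.
have is_ : i \notin s by apply/negP => /sJ.
have us := undup_uniq s.
(* Mutual independence speaks of duplicate-free lists only. *)
have eqs : [set` s] = [set` undup s] by apply/seteqP; split => k /=; rewrite mem_undup.
pose B' k := if k == i then C else B k.
have GB' k : G k (B' k) by rewrite /B'; case: eqP => [->|].
have B's k : k \in s -> B' k = B k.
  by rewrite /B'; case: eqP => // -> ks; rewrite ks in is_.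
have capE : \bigcap_(k in [set` s]) B k `&` C = \bigcap_(k in [set` i :: undup s]) B' k.
  apply/seteqP; split => [w [h Cw] k /=|w h].
    rewrite inE mem_undup => /predU1P[->|ks]; first by rewrite /B' eqxx.
    by rewrite B's//; exact: h.
  split; last by have := h i; rewrite /= inE eqxx /B' eqxx; apply.
  by move=> k /= ks; rewrite -B's//; apply: h; rewrite /= inE mem_undup ks orbT.
rewrite capE (G_indep (s := i :: undup s) (A := B')) ?big_cons /=; last 2 first.
- by rewrite us mem_undup is_.
- by move=> k _.
have B'i : B' i = C by rewrite /B' eqxx.
rewrite B'i [LHS]muleC; congr (_ * _)%E.
rewrite eqs (G_indep (s := undup s) (A := B))//.
by rewrite [LHS]big_seq [RHS]big_seq; apply: eq_bigr => k; rewrite mem_undup => /B's ->.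
Qed.

Lemma g_cylinders_measurable J A : <<s cylinders J >> A -> measurable A.
Proof.
apply: smallest_sub; first exact: sigma_algebra_measurable.
exact: cylinders_measurable.
Qed.

(** Both sides are finite measures in [A] that agree on the pi-system of cylinders, hence on the
    sigma-algebra it generates. *)
Lemma g_cylinders_indep J i A C : ~ J i -> <<s cylinders J >> A -> G i C ->
  Pr (A `&` C) = (Pr A * Pr C)%E.
Proof.
move=> Ji sA GC; have mC := Gm GC.
have C0 : 0 <= fine (Pr C) by apply: fine_ge0.
have CE : Pr C = (fine (Pr C))%:E by rewrite fineK// fin_num_measure.
have := @g_sigma_algebra_measure_unique _ R Omega (cylinders J) (@cylinders_measurable J)
  (fun=> setT) (fun=> cylindersT J) _ (mrestr Pr mC) (mscale (NngNum C0) Pr)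
  (@cylinders_setI J).
have -> : \bigcup_(k : nat) [set: Omega] = setT by apply/seteqP; split => // w _; exists 0%N.
move=> /(_ erefl) h.
have mscaleE B : mscale (NngNum C0) Pr B = (Pr B * Pr C)%E.
  by rewrite /mscale /= -CE muleC.
rewrite -mscaleE; apply: (h _ _ _ sA) => [B cB|k].
- by apply: eq_trans (esym (mscaleE B)); exact: (cylinders_indep Ji cB GC).
- have lty : (Pr (setT `&` C) < +oo)%E.
    by rewrite setTI (le_lt_trans (probability_le1 _ mC))// ltry.
  exact: lty.
Qed.

Lemma measurable_fun_draw (dZ : measure_display) (Z : measurableType dZ)
    (J : set I) (i : I) (z : Omega -> Z) : J i ->
  G i = generated_sigma z ->
  measurable_fun (setT : set (g_sigma_algebraType (cylinders J))) z.
Proof.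
move=> Ji GE _ A mA; rewrite setTI; apply: sub_sigma_algebra.
by apply: (sub_cylinders Ji); rewrite GE; exists A => //; rewrite setTI.
Qed.

Lemma draw_indep (dT dZ : measure_display) (T : measurableType dT) (Z : measurableType dZ)
    (J : set I) (i : I) (z : Omega -> Z) (W : Omega -> T) : ~ J i ->
  G i = generated_sigma z ->
  measurable_fun (setT : set (g_sigma_algebraType (cylinders J))) W ->
  measurable_fun setT W /\ forall A C, measurable A -> measurable C ->
    Pr (W @^-1` A `&` z @^-1` C) = (Pr (W @^-1` A) * Pr (z @^-1` C))%E.
Proof.
move=> Ji GE mW.
have sW A : measurable A -> <<s cylinders J >> (W @^-1` A).
  by move=> mA; rewrite -[W @^-1` A]setTI; exact: mW.
split; first by move=> _ A mA; rewrite setTI; apply: (@g_cylinders_measurable J); exact: sW.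
move=> A C mA mC; apply: (g_cylinders_indep Ji); first exact: sW.
by rewrite GE; exists C => //; rewrite setTI.
Qed.

End cylinders.
End independence.

(** * Descent along the iterates *)

Section descent_step.
Context {R : realType} {d r : nat}.
Context (F : 'cV[R]_d -> R) (gF : 'cV[R]_d -> 'cV[R]_d) (S : 'M[R]_d) (Fmin : R).
Hypothesis F_upper : forall x y,
  F y - F x - dotv (gF x) (y - x) <= 2^-1 * quadform S (y - x).
Hypothesis Fmin_le : forall x, Fmin <= F x.
Hypothesis S_psd : symmetric_psd S.

Lemma rs_nsgd_stepE (P : 'M[R]_(d, r)) (x g : 'cV[R]_d) (step : R) :
  (if P^T *m g == 0 then x else x - (step / norm2 (P^T *m g)) *: (P *m (P^T *m g))) =
  x - step *: descent_dir P g.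
Proof.
rewrite /descent_dir scalerA; case: eqP => // ->.
by rewrite mulmx0 scaler0 subr0.
Qed.

Lemma quadformZ (a : R) (y : 'cV[R]_d) : quadform S (a *: y) = a ^+ 2 * quadform S y.
Proof. by rewrite /quadform -scalemxAr dotvZl dotvZr mulrA expr2. Qed.

Lemma normalized_step_decrease (step : R) (P : 'M[R]_(d, r)) (x g : 'cV[R]_d) : 0 <= step ->
  (F (x - step *: descent_dir P g) - Fmin) + step * norm2 (P^T *m gF x) <=
  (F x - Fmin) + 2 * step * norm2 (P^T *m (g - gF x)) +
  step ^+ 2 / 2 * quadform S (descent_dir P g).
Proof.
move=> step0.
set y := descent_dir P g; have := F_upper x (x - step *: y).
have -> : x - step *: y - x = (- step) *: y by rewrite addrAC subrr add0r scaleNr.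
rewrite quadformZ sqrrN dotvZr.
(* Writing [<a, v>/|v| = |v| - <v - a, v>/|v|], Cauchy-Schwarz costs one [|v - a|] and the triangle
   inequality [|a| <= |v| + |v - a|] another: hence the factor 2. *)
suff : norm2 (P^T *m gF x) <= dotv (gF x) y + 2 * norm2 (P^T *m (g - gF x)).
  move=> /(ler_wpM2l step0); rewrite mulrDr; lra.
set v := P^T *m g; set a := P^T *m gF x.
have -> : P^T *m (g - gF x) = v - a by rewrite mulmxBr.
have -> : dotv (gF x) y = (norm2 v)^-1 * dotv a v by rewrite dotvZr dotv_mulmxr.
have := norm2_ge0 v; rewrite le_eqVlt => /predU1P[v0|v0].
  (* If [v = 0] the iterate does not move, and the claim is [|a| <= 2 |a|]. *)
  have -> : v = 0 by apply/eqP; rewrite -norm2_eq0 -v0.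
  by rewrite dotv0r mulr0 !add0r norm2N; have := norm2_ge0 a; lra.
have -> : (norm2 v)^-1 * dotv a v = norm2 v - (norm2 v)^-1 * dotv (v - a) v.
  by rewrite dotvBl -sqr_norm2; field; rewrite gt_eqF.
have h1 : (norm2 v)^-1 * dotv (v - a) v <= norm2 (v - a).
  by rewrite ler_pdivrMl// mulrC dotv_le.
have h2 : norm2 a <= norm2 v + norm2 (v - a).
  by have := ler_norm2D v (- (v - a)); rewrite norm2N opprB addrCA subrr addr0.
lra.
Qed.

Context (mu : probability 'M[R]_(d, r) R).
Hypothesis mu_stiefel : mu stiefel = 1%E.
Hypothesis mu_inv : forall U, orthogonal_group U ->
  forall A : set 'M[R]_(d, r), measurable A -> mu (mulmx U @^-1` A) = mu A.
Hypothesis d1 : (1 < d)%N.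
Hypothesis r0 : (0 < r)%N.
Hypothesis rd : (r <= d)%N.
Hypothesis S_neq0 : S != 0.
Hypothesis mF : measurable_fun setT F.

(** Each term stands on the side where it is nonnegative, so the pointwise decrease integrates in
    the extended reals with [x] and [g] frozen. *)
Lemma integral_step_decrease (step : R) (x g : 'cV[R]_d) : 0 <= step ->
  (\int[mu]_P (F (x - step *: descent_dir P g) - Fmin)%:E +
     (step * tau R d r * norm2 (gF x))%:E <=
   (F x - Fmin)%:E + (2 * step * tau R d r * norm2 (g - gF x))%:E +
     (step ^+ 2 / 2 * (ell r S * opnorm S))%:E)%E.
Proof.
move=> step0; have d0 : (0 < d)%N by exact: ltnW.
have mP : measurable_fun setT (fun P : 'M[R]_(d, r) => P) by exact: measurable_id.
have mn (z : 'cV[R]_d) : measurable_fun setT (fun P : 'M[R]_(d, r) => (norm2 (P^T *m z))%:E).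
  apply/measurable_EFinP; apply: measurable_norm2; apply: measurable_mulmx => //.
  exact: measurable_trmx.
have mdir : measurable_fun setT (fun P : 'M[R]_(d, r) => descent_dir P g).
  exact: measurable_descent_dir.
have mq : measurable_fun setT (fun P : 'M[R]_(d, r) => (quadform S (descent_dir P g))%:E).
  by apply/measurable_EFinP; exact: measurable_quadform.
have mFx : measurable_fun setT (fun P : 'M[R]_(d, r) => (F (x - step *: descent_dir P g) - Fmin)%:E).
  apply/measurable_EFinP; apply: measurable_funB => //.
  apply: (measurableT_comp mF); apply: measurable_subm => //.
  exact: measurable_scalemx.
have n0 (z : 'cV[R]_d) (P : 'M[R]_(d, r)) : (0 <= (norm2 (P^T *m z))%:E)%E.
  by rewrite lee_fin norm2_ge0.
have q0 (P : 'M[R]_(d, r)) : (0 <= (quadform S (descent_dir P g))%:E)%E.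
  by rewrite lee_fin; case: S_psd => _; apply.
have c0 : (0 <= (2 * step)%:E)%E by rewrite lee_fin mulr_ge0.
have c1 : (0 <= (step ^+ 2 / 2)%:E)%E by rewrite lee_fin divr_ge0 ?sqr_ge0.
have F0 z : (0 <= (F z - Fmin)%:E)%E by rewrite lee_fin subr_ge0.
have -> : (step * tau R d r * norm2 (gF x))%:E =
    (\int[mu]_P (step%:E * (norm2 (P^T *m gF x))%:E))%E.
  rewrite ge0_integralZl//.
  by rewrite (integral_norm2_haar mu_stiefel mu_inv d0 r0) -EFinM; congr EFin; ring.
have -> : (2 * step * tau R d r * norm2 (g - gF x))%:E =
    (\int[mu]_P ((2 * step)%:E * (norm2 (P^T *m (g - gF x)))%:E))%E.
  rewrite ge0_integralZl//.
  by rewrite (integral_norm2_haar mu_stiefel mu_inv d0 r0) -EFinM; congr EFin; ring.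
have quad : (\int[mu]_P ((step ^+ 2 / 2)%:E * (quadform S (descent_dir P g))%:E) <=
    (step ^+ 2 / 2 * (ell r S * opnorm S))%:E)%E.
  rewrite ge0_integralZl// [leRHS]EFinM; apply: lee_pmul => //.
    exact: integral_ge0.
  exact: (integral_quadform_haar_le mu_stiefel mu_inv d0 r0).
have cst : ((F x - Fmin)%:E = \int[mu]_(P in setT) (F x - Fmin)%:E)%E.
  rewrite integral_cst//; transitivity ((F x - Fmin)%:E * 1)%E; first by rewrite mule1.
  by congr (_ * _)%E; apply/esym; exact: probability_setT.
apply: le_trans (leeD (lexx _) quad); rewrite cst.
have mZ (c : \bar R) f : measurable_fun setT f ->
    measurable_fun setT (fun P : 'M[R]_(d, r) => (c * f P)%E).
  by move=> mf; apply: emeasurable_funM.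
pose f1 (P : 'M[R]_(d, r)) := (step%:E * (norm2 (P^T *m gF x))%:E)%E.
pose f2 (P : 'M[R]_(d, r)) := ((2 * step)%:E * (norm2 (P^T *m (g - gF x)))%:E)%E.
pose f3 (P : 'M[R]_(d, r)) := ((step ^+ 2 / 2)%:E * (quadform S (descent_dir P g))%:E)%E.
have mf1 : measurable_fun setT f1 by exact: mZ.
have mf2 : measurable_fun setT f2 by exact: mZ.
have mf3 : measurable_fun setT f3 by exact: mZ.
have f10 P : (0 <= f1 P)%E by rewrite /f1 mule_ge0// lee_fin.
have f20 P : (0 <= f2 P)%E by exact: mule_ge0.
have f30 P : (0 <= f3 P)%E by exact: mule_ge0.
have f120 P : (0 <= (F x - Fmin)%:E + f2 P)%E by exact: adde_ge0.
have m2 : measurable_fun setT (fun P : 'M[R]_(d, r) => (F x - Fmin)%:E + f2 P)%E by exact: emeasurable_funD.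
apply: (@le_trans _ _ (\int[mu]_P ((F x - Fmin)%:E + f2 P + f3 P))%E); last first.
  by rewrite ge0_integralD// ge0_integralD.
apply: (@le_trans _ _ (\int[mu]_P ((F (x - step *: descent_dir P g) - Fmin)%:E + f1 P))%E).
  by rewrite ge0_integralD.
apply: ge0_le_integral => //.
- by move=> P _; exact: adde_ge0.
- exact: emeasurable_funD.
- exact: emeasurable_funD.
- move=> P _; rewrite /f1 /f2 /f3 -!EFinM -!EFinD lee_fin.
  exact: normalized_step_decrease.
Qed.

End descent_step.

Lemma measurable_summx (R : realType) (dT : measure_display) (T : measurableType dT)
    (m n : nat) (I : Type) (s : seq I) (Q : pred I) (f : I -> T -> 'M[R]_(m, n)) :
  (forall i, Q i -> measurable_fun setT (f i)) ->
  measurable_fun setT (fun t => \sum_(i <- s | Q i) f i t).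
Proof.
move=> mf; elim: s => [|i s IH]; first by under eq_fun do rewrite big_nil; exact: measurable_cst.
under eq_fun do rewrite big_cons.
by case Qi : (Q i) => //; apply: measurable_addmx => //; exact: mf.
Qed.

Section measurable_iterates.
Context {R : realType} {d r b : nat} {dXi : measure_display} {Xi : measurableType dXi}.
Context (gf : 'cV[R]_d -> Xi -> 'cV[R]_d) (step : R) (x0 : 'cV[R]_d).
Hypothesis m_gf : measurable_fun setT (fun z : 'cV[R]_d * Xi => gf z.1 z.2).
Context {dT : measure_display} {T : measurableType dT}.
Context (P : nat -> T -> 'M[R]_(d, r)) (xi : nat -> 'I_b -> T -> Xi).

Let X k t := rs_nsgd gf step x0 (P ^~ t) (fun i j => xi i j t) k.

Lemma measurable_sgradient (x : T -> 'cV[R]_d) (s : T -> Xi) :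
  measurable_fun setT x -> measurable_fun setT s ->
  measurable_fun setT (fun t => gf (x t) (s t)).
Proof.
move=> mx ms.
exact: (measurableT_comp (f := fun z : 'cV[R]_d * Xi => gf z.1 z.2) m_gf
  (measurable_fun_pair mx ms)).
Qed.

Lemma rs_nsgdS k t : X k.+1 t = X k t - step *:
  descent_dir (P k t) (b%:R^-1 *: \sum_j gf (X k t) (xi k j t)).
Proof. exact: rs_nsgd_stepE. Qed.

Lemma measurable_rs_nsgd K : (forall k, (k < K)%N -> measurable_fun setT (P k)) ->
  (forall k j, (k < K)%N -> measurable_fun setT (xi k j)) -> measurable_fun setT (X K).
Proof.
elim: K => [|K IH] mP mxi; first exact: measurable_cst.
have mX : measurable_fun setT (X K).
  by apply: IH => [k kK|k j kK]; [apply: mP|apply: mxi]; exact: ltnW.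
rewrite (_ : X K.+1 = fun t => X K t - step *:
  descent_dir (P K t) (b%:R^-1 *: \sum_j gf (X K t) (xi K j t))); last first.
  by apply/funext => t; exact: rs_nsgdS.
apply: measurable_subm => //; apply: measurable_scalemx; first exact: measurable_cst.
apply: measurable_descent_dir; first exact: mP.
apply: measurable_scalemx; first exact: measurable_cst.
apply: measurable_summx => j _; apply: measurable_sgradient => //.
exact: mxi.
Qed.

End measurable_iterates.

(** Jensen's inequality by a tangent: [f <= e (1 - 1/p) + (e/p) f^p / e^p], with contact at [f = e].
    Integration at [e = c] yields [c (1 + 1/p) <= 2 c]. *)
Lemma expectation_le_of_moment (R : realType) (dO : measure_display)
    (Omega : measurableType dO) (Pr : probability Omega R) (f : Omega -> R) (p c : R) :
  measurable_fun setT f -> (forall w, 0 <= f w) -> 1 < p <= 2 -> 0 <= c ->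
  (\int[Pr]_w (f w `^ p)%:E <= (2 * c `^ p)%:E)%E -> (\int[Pr]_w (f w)%:E <= (2 * c)%:E)%E.
Proof.
move=> mf f0 /andP[p1 p2] c0 fp.
have p0 : 0 < p by lra.
have mfp : measurable_fun setT (fun w => (f w `^ p)%:E).
  by apply/measurable_EFinP; exact: (measurableT_comp (measurable_powR _) mf).
have main e : 0 < e -> (\int[Pr]_w (f w `^ p)%:E <= (2 * e `^ p)%:E)%E ->
    (\int[Pr]_w (f w)%:E <= (2 * e)%:E)%E.
  move=> e0 fe; have ep : 0 < e `^ p by exact: powR_gt0.
  pose k := e * p^-1 * (e `^ p)^-1.
  have k0 : 0 <= k by rewrite /k !mulr_ge0 ?invr_ge0 ?ltW.
  have e1 : 0 <= e * (1 - p^-1) by rewrite mulr_ge0 ?ltW// subr_gt0 invf_lt1.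
  apply: (@le_trans _ _ (\int[Pr]_w ((cst (e * (1 - p^-1))%:E) w + k%:E * (f w `^ p)%:E))%E).
    apply: ge0_le_integral => //.
    - by move=> w _; rewrite lee_fin.
    - exact/measurable_EFinP.
    - by apply: emeasurable_funD => //; exact: emeasurable_funM.
    - move=> w _; rewrite -EFinM -EFinD lee_fin.
      have p1' : 0 < p^-1 <= 1 by rewrite invr_gt0 p0 invf_le1// ltW.
      have fe0 : 0 <= f w / e by rewrite divr_ge0// ltW.
      have := powR_bernoulli (powR_ge0 (f w / e) p) p1'.
      rewrite -powRrM mulfV ?(gt_eqF p0)// (powRr1 fe0) (ler_pdivrMr _ _ e0).
      have e10 : 0 <= e^-1 by rewrite invr_ge0 ltW.
      rewrite (powRM p (f0 w) e10) -(powR_inv1 (ltW e0)) powRAC powR_inv1 ?powR_ge0// => h.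
      apply: le_trans h _; rewrite le_eqVlt; apply/orP; left; apply/eqP.
      rewrite /k; ring.
  rewrite ge0_integralD//; [|by move=> w _; rewrite mule_ge0// lee_fin powR_ge0
    |exact: emeasurable_funM].
  have -> : (\int[Pr]_w (cst (e * (1 - p^-1))%:E) w = (e * (1 - p^-1))%:E)%E.
    transitivity ((e * (1 - p^-1))%:E * Pr setT)%E; first exact: integral_cst.
    by rewrite probability_setT mule1.
  rewrite ge0_integralZl//; last by move=> w _; rewrite lee_fin powR_ge0.
  apply: le_trans (leeD (lexx _) (lee_wpmul2l _ fe)) _; first by rewrite lee_fin.
  rewrite -EFinM -EFinD lee_fin.
  have -> : k * (2 * e `^ p) = 2 * e * p^-1 by rewrite /k; field; rewrite !gt_eqF.
  have : e * p^-1 <= e * 1 by rewrite ler_pM2l// invf_le1// ltW.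
  lra.
(* The tangent needs a positive contact point, so [c = 0] is treated as a limit of positive ones. *)
move: c0; rewrite le_eqVlt => /predU1P[cz|]; last by move=> c0; exact: main.
rewrite -cz mulr0; apply/lee_addgt0Pr => e e0; rewrite add0e.
have e2 : 0 < e / 2 by lra.
have -> : e%:E = (2 * (e / 2))%:E by congr EFin; lra.
apply: main => //; apply: le_trans fp _; rewrite -cz powR0 ?gt_eqF// mulr0 lee_fin.
by rewrite mulr_ge0// powR_ge0.
Qed.

(** * Minibatch error and telescoping along the random iterates *)

Section process.
Context {R : realType} {d r b : nat} {dXi : measure_display} {Xi : measurableType dXi}.
Context (D : probability Xi R) (gf : 'cV[R]_d -> Xi -> 'cV[R]_d) (gF : 'cV[R]_d -> 'cV[R]_d).
Context (step : R) (x0 : 'cV[R]_d).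
Hypothesis m_gf : measurable_fun setT (fun z : 'cV[R]_d * Xi => gf z.1 z.2).
Hypothesis m_gF : measurable_fun setT gF.
Hypothesis gf_int : forall x i, D.-integrable setT (fun s => (gf x s i ord0)%:E).
Hypothesis gf_mean : forall x i, (\int[D]_s (gf x s i ord0)%:E = (gF x i ord0)%:E)%E.
Context (p M : R).
Hypothesis p12 : 1 < p <= 2.
Hypothesis gf_moment : forall x,
  (\int[D]_s (norm2 (gf x s - gF x) `^ p)%:E <= M%:E)%E.
Context {dO : measure_display} {Omega : measurableType dO} (Pr : probability Omega R).
Context (P : nat -> Omega -> 'M[R]_(d, r)) (xi : nat -> 'I_b -> Omega -> Xi).
Hypothesis mP : forall k, measurable_fun setT (P k).
Hypothesis xi_law : forall k j, has_law Pr (xi k j) D.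
Hypothesis indep : mutually_independent Pr (draws_sigma P xi).

Let X k w := rs_nsgd gf step x0 (P ^~ w) (fun i j => xi i j w) k.
(** Only the first [m] samples count, so that the minibatch can be revealed one sample at a time. *)
Let noise k m w := \sum_(j : 'I_b | (j < m)%N) (gf (X k w) (xi k j w) - gF (X k w)).

(** Order of revelation: the samples of step [k] precede [P k], which is still excluded at
    [m = b]. *)
Let before k m : set (nat + nat * 'I_b) := fun i => match i with
  | inl k' => (k' < k)%N : Prop
  | inr kj => (kj.1 < k)%N || (kj.1 == k) && (kj.2 < m)%N : Prop
  end.

Let past k m := g_sigma_algebraType (cylinders (draws_sigma P xi) (before k m)).

Let mxi k j : measurable_fun setT (xi k j). Proof. by have [] := xi_law k j. Qed.

Let gsT (dT : measure_display) (T : measurableType dT) (f : Omega -> T) :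
  generated_sigma f setT.
Proof. by exists setT => //; rewrite preimage_setT setTI. Qed.

Let gsI (dT : measure_display) (T : measurableType dT) (f : Omega -> T) :
  setI_closed (generated_sigma f).
Proof.
move=> _ _ [A mA <-] [B mB <-]; exists (A `&` B); first exact: measurableI.
by rewrite !setTI preimage_setI.
Qed.

Let gsm (dT : measure_display) (T : measurableType dT) (f : Omega -> T) :
  measurable_fun setT f -> generated_sigma f `<=` measurable.
Proof. by move=> mf _ [A mA <-]; exact: mf. Qed.

Let dsT i : draws_sigma P xi i setT. Proof. by case: i => [k|kj]; exact: gsT. Qed.
Let dsI i : setI_closed (draws_sigma P xi i). Proof. by case: i => [k|kj]; exact: gsI. Qed.
Let dsm i : draws_sigma P xi i `<=` measurable.
Proof. by case: i => [k|kj]; apply: gsm; [exact: mP|exact: mxi]. Qed.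

Let past_P k m k' : (k' < k)%N -> measurable_fun (setT : set (past k m)) (P k').
Proof. by move=> kk; apply: (@measurable_fun_draw _ _ _ _ dsT _ _ _ (inl k')). Qed.

Let past_xi k m k' (j : 'I_b) : (k' < k)%N -> measurable_fun (setT : set (past k m)) (xi k' j).
Proof.
by move=> kk; apply: (@measurable_fun_draw _ _ _ _ dsT _ _ _ (inr (k', j))); rewrite /= ?kk.
Qed.

Let past_xi_now k m (j : 'I_b) : (j < m)%N -> measurable_fun (setT : set (past k m)) (xi k j).
Proof.
move=> jm; apply: (@measurable_fun_draw _ _ _ _ dsT _ _ _ (inr (k, j))) => //.
by rewrite /= eqxx jm orbT.
Qed.

Let m_gF_comp (dT : measure_display) (T : measurableType dT) (x : T -> 'cV[R]_d) :
  measurable_fun setT x -> measurable_fun setT (fun t => gF (x t)).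
Proof. exact: measurableT_comp. Qed.

Let past_X k m : measurable_fun (setT : set (past k m)) (X k).
Proof.
apply: (measurable_rs_nsgd step x0 m_gf (T := past k m)) => [k' kk|k' j kk].
  exact: past_P.
exact: past_xi.
Qed.

Let past_noise k m : measurable_fun (setT : set (past k m)) (noise k m).
Proof.
apply: (measurable_summx (T := past k m)) => j jm.
apply: (measurable_subm (T := past k m)).
  by apply: (measurable_sgradient m_gf (T := past k m)); [exact: past_X|exact: past_xi_now].
by apply: (m_gF_comp (T := past k m)); exact: past_X.
Qed.

Let X_meas k : measurable_fun setT (X k).
Proof. exact: (measurable_rs_nsgd step x0 m_gf (fun k _ => @mP k) (fun k j _ => @mxi k j)). Qed.

Let noise_meas k m : measurable_fun setT (noise k m).
Proof.
apply: measurable_summx => j jm; apply: measurable_subm.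
  by apply: (measurable_sgradient m_gf).
exact: m_gF_comp.
Qed.

Let M0 : 0 <= M.
Proof.
rewrite -lee_fin; apply: le_trans (gf_moment x0).
by apply: integral_ge0 => s _; rewrite lee_fin powR_ge0.
Qed.

Let noiseS k m w (mb : (m < b)%N) : noise k m.+1 w =
  noise k m w + (gf (X k w) (xi k (Ordinal mb) w) - gF (X k w)).
Proof.
rewrite /noise (bigD1 (Ordinal mb))//= addrC; congr (_ + _); apply: eq_bigl => j.
by rewrite -val_eqE /= ltnS [RHS]ltn_neqAle andbC.
Qed.

Let m_powR (dT : measure_display) (T : measurableType dT) (f : T -> 'cV[R]_d) :
  measurable_fun setT f -> measurable_fun setT (fun t => (norm2 (f t) `^ p)%:E).
Proof.
move=> mf; apply/measurable_EFinP.
exact: (measurableT_comp (measurable_powR _) (measurable_norm2 mf)).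
Qed.

Let Pr_integral_cst c : (\int[Pr]_w (cst c) w = c)%E.
Proof.
transitivity (c * Pr setT)%E; first exact: integral_cst.
by rewrite probability_setT mule1.
Qed.

Let gradient_noiseE x i s : ((gf x s - gF x) i ord0)%:E =
  ((gf x s i ord0)%:E + (cst (- gF x i ord0)%:E) s)%E.
Proof. by rewrite !mxE EFinD. Qed.

Let gradient_cst_int x i : D.-integrable setT (cst (- gF x i ord0)%:E).
Proof. exact: finite_measure_integrable_cst. Qed.

Let gradient_noise_int x i : D.-integrable setT (fun s => ((gf x s - gF x) i ord0)%:E).
Proof.
rewrite (_ : (fun s => _) = (fun s => (gf x s i ord0)%:E + (cst (- gF x i ord0)%:E) s)%E).
  exact: (integrableD measurableT (gf_int x i) (gradient_cst_int x i)).
by apply/funext => s; exact: gradient_noiseE.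
Qed.

Let gradient_noise_mean x i : (\int[D]_s ((gf x s - gF x) i ord0)%:E = 0)%E.
Proof.
under eq_integral do rewrite gradient_noiseE.
rewrite (integralD measurableT (gf_int x i) (gradient_cst_int x i)) gf_mean.
have -> : (\int[D]_s (cst (- gF x i ord0)%:E) s = (- gF x i ord0)%:E)%E.
  transitivity ((- gF x i ord0)%:E * D setT)%E; first exact: integral_cst.
  by rewrite probability_setT mule1.
by rewrite -EFinD subrr.
Qed.

(** Given [(X k, noise k m)], the next sample is a fresh centred draw and adds at most [2 M]. Growth
    linear in [m] is what makes the averaged error decay like [b^(-(p-1)/p)]. *)
Let noise_moment k m : (m <= b)%N ->
  (\int[Pr]_w (norm2 (noise k m w) `^ p)%:E <= (2 * m%:R * M)%:E)%E.
Proof.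
elim: m => [_|m IH mb].
  rewrite mulr0 mul0r (eq_integral (cst 0%E)); first by rewrite integral0.
  by move=> w _; rewrite /noise big_pred0// norm20 powR0//; case/andP: p12; lra.
pose j0 := Ordinal mb.
pose W w := (X k w, noise k m w).
pose h (y : 'cV[R]_d * 'cV[R]_d * Xi) :=
  (norm2 (y.1.2 + (gf y.1.1 y.2 - gF y.1.1)) `^ p)%:E.
have mh : measurable_fun setT h.
  apply: m_powR; apply: measurable_addmx.
    exact: (measurableT_comp measurable_snd measurable_fst).
  have m11 : measurable_fun setT (fun y : 'cV[R]_d * 'cV[R]_d * Xi => y.1.1).
    exact: (measurableT_comp measurable_fst measurable_fst).
  apply: measurable_subm; last exact: m_gF_comp.
  by apply: measurable_sgradient => //; exact: measurable_snd.
have pastW : measurable_fun (setT : set (past k m)) W.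
  by apply: (measurable_fun_pair (T := past k m)); [exact: past_X|exact: past_noise].
have nbefore : ~ before k m (inr (k, j0)) by rewrite /before /= !ltnn andbF.
have [mW Wi] := draw_indep dsT dsI dsm indep nbefore erefl pastW.
under eq_integral do rewrite noiseS.
rewrite (integral_fresh_draw mW (xi_law k j0) Wi mh); last by move=> y; rewrite lee_fin powR_ge0.
apply: (@le_trans _ _ (\int[Pr]_w ((norm2 (noise k m w) `^ p)%:E + (cst (2 * M)%:E) w))%E).
  apply: ge0_le_integral => //.
  - by move=> w _; apply: integral_ge0 => s _; rewrite lee_fin powR_ge0.
  - apply: (measurableT_comp (f := fun y => (\int[D]_s h (y, s))%E) _ mW).
    apply: measurable_fun_fubini_tonelli_F => // y; by rewrite lee_fin powR_ge0.
  - by apply: emeasurable_funD => //; apply: m_powR.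
  - move=> w _; rewrite /h /=.
    apply: (integral_norm2_powD_le (e := fun s => gf (X k w) s - gF (X k w))) => //.
    by apply: measurable_subm => //; apply: measurable_sgradient.
rewrite ge0_integralD//; [|by move=> w _; rewrite lee_fin powR_ge0|exact: m_powR
  |by move=> w _; rewrite lee_fin mulr_ge0].
rewrite Pr_integral_cst (le_trans (leeD (IH (ltnW mb)) (lexx _)))//.
by rewrite -EFinD lee_fin -natr1; lra.
Qed.

Hypothesis b0 : (0 < b)%N.
Let grad_est k w : 'cV[R]_d := b%:R^-1 *: \sum_j gf (X k w) (xi k j w).

Let b0R : 0 < b%:R :> R. Proof. by rewrite ltr0n. Qed.

Let grad_est_err k w : grad_est k w - gF (X k w) = b%:R^-1 *: noise k b w.
Proof.
rewrite /noise (eq_bigl predT); last by move=> j; rewrite ltn_ord.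
rewrite sumrB scalerBr sumr_const card_ord -(scaler_nat b (gF (X k w))) scalerA.
by rewrite mulVf ?gt_eqF// scale1r.
Qed.

Let expectation_err k :
  (\int[Pr]_w (norm2 (grad_est k w - gF (X k w)))%:E <=
   (2 * (b%:R * M) `^ p^-1 / b%:R)%:E)%E.
Proof.
have p0 : 0 < p by case/andP: p12; lra.
under eq_integral do rewrite grad_est_err norm2Z ger0_norm ?invr_ge0// EFinM.
have mn : measurable_fun setT (fun w => norm2 (noise k b w)).
  by apply: measurable_norm2; exact: noise_meas.
rewrite ge0_integralZl//; last 2 first.
- exact/measurable_EFinP.
- by move=> w _; rewrite lee_fin norm2_ge0.
rewrite [leRHS](_ : _ = (b%:R^-1)%:E * (2 * (b%:R * M) `^ p^-1)%:E)%E; last first.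
  by rewrite -EFinM mulrC.
apply: lee_wpmul2l; first by rewrite lee_fin invr_ge0.
apply: (expectation_le_of_moment mn _ p12); rewrite ?powR_ge0//.
  by move=> w; exact: norm2_ge0.
apply: le_trans (noise_moment k (leqnn b)) _.
rewrite -powRrM mulVf ?gt_eqF// powRr1 ?mulr_ge0// lee_fin; lra.
Qed.

Context (F : 'cV[R]_d -> R) (S : 'M[R]_d) (Fmin : R).
Hypothesis F_upper : forall x y,
  F y - F x - dotv (gF x) (y - x) <= 2^-1 * quadform S (y - x).
Hypothesis Fmin_le : forall x, Fmin <= F x.
Hypothesis S_psd : symmetric_psd S.
Hypothesis S_neq0 : S != 0.
Hypothesis mF : measurable_fun setT F.
Context (hr : (r <= d)%N).
Hypothesis d1 : (1 < d)%N.
Hypothesis r0 : (0 < r)%N.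
Hypothesis P_haar : forall k, is_haar_matrix Pr hr (P k).
Hypothesis step0 : 0 <= step.

(** A priori possibly infinite; finiteness comes out of [sum_expectation]. *)
Let gap k : \bar R := (\int[Pr]_w (F (X k w) - Fmin)%:E)%E.
Let gnorm k : \bar R := (\int[Pr]_w (norm2 (gF (X k w)))%:E)%E.
Let err : R := 2 * (b%:R * M) `^ p^-1 / b%:R.
Let cst_step : R := 2 * step * tau R d r * err + step ^+ 2 / 2 * (ell r S * opnorm S).

Let tau_ge0 : 0 <= tau R d r. Proof. by apply/ltW/tau_gt0 => //; exact: ltnW. Qed.

Let past_grad_est k : measurable_fun (setT : set (past k b)) (grad_est k).
Proof.
apply: (measurable_scalemx (T := past k b)); first exact: measurable_cst.
apply: (measurable_summx (T := past k b)) => j _.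
apply: (measurable_sgradient m_gf (T := past k b)); first exact: past_X.
by apply: past_xi_now; exact: ltn_ord.
Qed.

Let grad_est_meas k : measurable_fun setT (grad_est k).
Proof.
apply: measurable_scalemx; first exact: measurable_cst.
by apply: measurable_summx => j _; apply: measurable_sgradient => //; exact: X_meas.
Qed.

(** The iterate and the gradient estimate depend only on the draws in [before k b], so [P k] is
    fresh and [integral_step_decrease] applies under the integral. *)
Let step_expectation k :
  (gap k.+1 + (step * tau R d r)%:E * gnorm k <= gap k + cst_step%:E)%E.
Proof.
have d0 : (0 < d)%N by exact: ltnW.
have [mu [P_law mu_stiefel mu_inv]] := haar_matrix_law d0 (P_haar k).
pose W w := (X k w, grad_est k w).
pose h (y : 'cV[R]_d * 'cV[R]_d * 'M[R]_(d, r)) :=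
  (F (y.1.1 - step *: descent_dir y.2 y.1.2) - Fmin)%:E.
have m11 : measurable_fun setT (fun y : 'cV[R]_d * 'cV[R]_d * 'M[R]_(d, r) => y.1.1).
  exact: (measurableT_comp measurable_fst measurable_fst).
have m12 : measurable_fun setT (fun y : 'cV[R]_d * 'cV[R]_d * 'M[R]_(d, r) => y.1.2).
  exact: (measurableT_comp measurable_snd measurable_fst).
have mh : measurable_fun setT h.
  apply/measurable_EFinP; apply: measurable_funB => //.
  apply: (measurableT_comp mF); apply: measurable_subm => //.
  by apply: measurable_scalemx => //; apply: measurable_descent_dir.
have h0 y : (0 <= h y)%E by rewrite lee_fin subr_ge0.
have pastW : measurable_fun (setT : set (past k b)) W.
  by apply: (measurable_fun_pair (T := past k b)); [exact: past_X|exact: past_grad_est].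
have nbefore : ~ before k b (inl k) by rewrite /before /= ltnn.
have [mW Wi] := draw_indep dsT dsI dsm indep nbefore erefl pastW.
pose I w := (\int[mu]_Q h (W w, Q))%E.
have -> : gap k.+1 = (\int[Pr]_w I w)%E.
  rewrite /I -(integral_fresh_draw mW P_law Wi mh h0).
  by apply: eq_integral => w _; rewrite /X rs_nsgdS.
have mI : measurable_fun setT I.
  apply: (measurableT_comp (f := fun y => (\int[mu]_Q h (y, Q))%E) _ mW).
  exact: measurable_fun_fubini_tonelli_F.
have mG : measurable_fun setT (fun w => (norm2 (gF (X k w)))%:E).
  apply/measurable_EFinP; apply: measurable_norm2; apply: m_gF_comp; exact: X_meas.
have mE : measurable_fun setT (fun w => (norm2 (grad_est k w - gF (X k w)))%:E).
  apply/measurable_EFinP; apply: measurable_norm2; apply: measurable_subm.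
    exact: grad_est_meas.
  by apply: m_gF_comp; exact: X_meas.
have mFX : measurable_fun setT (fun w => (F (X k w) - Fmin)%:E).
  apply/measurable_EFinP; apply: measurable_funB => //.
  by apply: (measurableT_comp mF); exact: X_meas.
have FX0 w : (0 <= (F (X k w) - Fmin)%:E)%E by rewrite lee_fin subr_ge0.
have G0 w : (0 <= (norm2 (gF (X k w)))%:E)%E by rewrite lee_fin norm2_ge0.
have E0 w : (0 <= (norm2 (grad_est k w - gF (X k w)))%:E)%E by rewrite lee_fin norm2_ge0.
have st0 : (0 <= (step * tau R d r)%:E)%E by rewrite lee_fin mulr_ge0.
have st20 : (0 <= (2 * step * tau R d r)%:E)%E by rewrite lee_fin; do 2!apply: mulr_ge0 => //.
have I0 w : (0 <= I w)%E by exact: integral_ge0.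
(* The sign is read off the Haar bound, whose left-hand side integrates a nonnegative function. *)
have ell0 : 0 <= step ^+ 2 / 2 * (ell r S * opnorm S).
  rewrite mulr_ge0 ?divr_ge0 ?sqr_ge0// -lee_fin.
  apply: le_trans (integral_quadform_haar_le mu_stiefel mu_inv d0 r0 x0 d1 hr S_neq0 S_psd).
  by apply: integral_ge0 => Q _; rewrite lee_fin; case: S_psd => _; apply.
pose a w := ((step * tau R d r)%:E * (norm2 (gF (X k w)))%:E)%E.
pose e w := ((2 * step * tau R d r)%:E * (norm2 (grad_est k w - gF (X k w)))%:E)%E.
have ma : measurable_fun setT a by exact: emeasurable_funM.
have me : measurable_fun setT e by exact: emeasurable_funM.
have a0 w : (0 <= a w)%E by exact: mule_ge0.
have e0 w : (0 <= e w)%E by exact: mule_ge0.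
apply: (@le_trans _ _ (\int[Pr]_w (I w + a w))%E).
  by rewrite (@ge0_integralD _ _ _ Pr setT measurableT I a)// /a ge0_integralZl.
pose c : \bar R := (step ^+ 2 / 2 * (ell r S * opnorm S))%:E.
have c0 : (0 <= c)%E by rewrite lee_fin.
have Fe0 w : (0 <= (F (X k w) - Fmin)%:E + e w)%E by exact: adde_ge0.
have mFe : measurable_fun setT (fun w => (F (X k w) - Fmin)%:E + e w)%E.
  exact: emeasurable_funD.
apply: (@le_trans _ _ (\int[Pr]_w ((F (X k w) - Fmin)%:E + e w + (cst c) w))%E).
  apply: ge0_le_integral => //.
  - by move=> w _; exact: adde_ge0.
  - exact: emeasurable_funD.
  - by apply: emeasurable_funD => //; exact: measurable_cst.
  - move=> w _.
    have := integral_step_decrease F_upper Fmin_le S_psd mu_stiefel mu_inv d1 r0 hr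
      S_neq0 mF (X k w) (grad_est k w) step0.
    by rewrite /I /a /e /c -!EFinM.
rewrite (@ge0_integralD _ _ _ Pr setT measurableT (fun w => (F (X k w) - Fmin)%:E + e w)%E)//.
rewrite Pr_integral_cst (@ge0_integralD _ _ _ Pr setT measurableT _ e)// /e ge0_integralZl//.
rewrite -addeA leeD2l// EFinD leeD2r// [leRHS]EFinM.
exact: lee_wpmul2l.
Qed.

Let sum_expectation n :
  (gap n + (step * tau R d r)%:E * \sum_(k < n) gnorm k <=
   (F x0 - Fmin + n%:R * cst_step)%:E)%E.
Proof.
have gnorm0 k : (0 <= gnorm k)%E by apply: integral_ge0 => w _; rewrite lee_fin norm2_ge0.
elim: n => [|n IH].
  by rewrite big_ord0 mule0 adde0 mul0r addr0 /gap /X /= Pr_integral_cst.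
rewrite big_ord_recr /= ge0_muleDr//; last exact: sume_ge0.
rewrite (addeC ((step * _)%:E * \sum_(i < n) _)%E) addeA.
apply: le_trans (leeD (step_expectation n) (lexx _)) _.
rewrite addeAC; apply: le_trans (leeD IH (lexx _)) _.
by rewrite -EFinD lee_fin -natr1; lra.
Qed.

Lemma sum_gradient_norm_le n :
  ((step * tau R d r)%:E * \sum_(k < n) \int[Pr]_w (norm2 (gF (X k w)))%:E <=
   (F x0 - Fmin + n%:R * (2 * step * tau R d r * (2 * (b%:R * M) `^ p^-1 / b%:R) +
      step ^+ 2 / 2 * (ell r S * opnorm S)))%:E)%E.
Proof.
apply: le_trans (sum_expectation n); rewrite leeDr//.
by apply: integral_ge0 => w _; rewrite lee_fin subr_ge0.
Qed.

End process.

(** * Measurability of the gradient map *)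

Section lipschitz.
Context {R : realType}.

Lemma norm2_le_of_entries (n : nat) (z : 'cV[R]_n) (e : R) : 0 <= e ->
  (forall i, `|z i ord0| <= e) -> norm2 z <= n%:R * e.
Proof.
move=> e0 ze; rewrite -(@ler_pXn2r _ 2) ?nnegrE ?norm2_ge0 ?mulr_ge0//.
rewrite sqr_norm2; apply: (@le_trans _ _ (\sum_(i < n) e ^+ 2)).
  apply: ler_sum => i _; rewrite -expr2 -(real_normK (num_real (z i ord0))).
  by rewrite lerXn2r ?nnegrE.
rewrite sumr_const card_ord -(mulr_natl (e ^+ 2)) exprMn ler_wpM2r ?sqr_ge0//.
by rewrite -natrX ler_nat; case: n {z ze} => // n; rewrite expnS expn1 leq_pmulr.
Qed.

(** The Lipschitz bound is Euclidean while the topology is that of the maximum norm;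
    [norm2_le_of_entries] bridges them at the cost of a factor [n]. *)
Lemma lipschitz_measurable (n : nat) (g : 'cV[R]_n -> 'cV[R]_n) (L : R) : 0 < L ->
  (forall x y, norm2 (g x - g y) <= L * norm2 (x - y)) -> measurable_fun setT g.
Proof.
move=> L0 gL; apply/measurable_mxP => i j; apply: continuous_measurable_mx => x.
have Fx : Filter (nbhs x) by exact: nbhs_filter.
apply/(@cvgrPdist_le _ _ _ _ Fx) => e e0.
(* [n.+1] instead of [n] keeps the radius positive in dimension 0. *)
have k0 : 0 < L * n.+1%:R by rewrite mulr_gt0.
have d0 : 0 < e / (L * n.+1%:R) by rewrite divr_gt0.
apply/nbhs_ballP; exists (e / (L * n.+1%:R)) => //= y [_ xy].
have -> : g x i j - g y i j = (g x - g y) i ord0 by rewrite (ord1 j) !mxE.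
rewrite (le_trans (entry_le_norm2 _ _))// (le_trans (gL _ _))//.
have h : norm2 (x - y) <= n%:R * (e / (L * n.+1%:R)).
  apply: norm2_le_of_entries => [|k]; first exact: ltW.
  by have := xy k ord0; rewrite -ball_normE /= !mxE => /ltW.
apply: le_trans (ler_wpM2l (ltW L0) h) _.
have -> : L * (n%:R * (e / (L * n.+1%:R))) = e * (n%:R / n.+1%:R).
  by field; rewrite ?natr1 !gt_eqF.
by rewrite ler_piMr ?(ltW e0)// ler_pdivrMr// mul1r ler_nat.
Qed.

End lipschitz.

Theorem theorem5p4 (R : realType)
  (d r : nat) (hd : (2 <= d)%N) (hr1 : (1 <= r)%N) (hr : (r <= d)%N)
  (dXi : measure_display) (Xi : measurableType dXi) (D : probability Xi R)
  (f : 'cV[R]_d -> Xi -> R) (F : 'cV[R]_d -> R)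
  (hF_int : forall x, D.-integrable setT (fun s => (f x s)%:E))
  (hF : forall x, (F x)%:E = 'E_D[f x]%E)
  (hf_diff : forall s x, differentiable (fun y => f y s) x)
  (hf_meas : measurable_fun [set: 'cV[R]_d * Xi]
    (fun z : 'cV[R]_d * Xi => grad (fun y => f y z.2) z.1))
  (hF_diff : forall x, differentiable F x)
  (hF_lb : has_lbound (range F))
  (L : R) (hL : 0 < L)
  (hF_smooth : forall x y, norm2 (grad F x - grad F y) <= L * norm2 (x - y))
  (LL : 'M[R]_d) (hLL0 : LL != 0) (hLL : symmetric_psd LL)
  (hF_LL : forall x y,
    F y - F x - dotv (grad F x) (y - x) <= 2^-1 * quadform LL (y - x))
  (hg_int : forall x i, D.-integrable setT
    (fun s => (grad (fun y => f y s) x i ord0)%:E))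
  (hg_mean : forall x i,
    'E_D[fun s => grad (fun y => f y s) x i ord0]%E = (grad F x i ord0)%:E)
  (p sigma : R) (hp : 1 < p <= 2) (hsigma : 0 <= sigma)
  (hg_mom : forall x,
    ('E_D[fun s => (norm2 (grad (fun y => f y s) x - grad F x)%R `^ p)%R]
      <= (sigma `^ p)%:E)%E)
  (T : nat) (hT : (1 <= T)%N)
  (B q eta u : R) (hB : 0 < B) (hq : 0 < q) (heta : 0 < eta) (hu : 0 < u < 1)
  (b : nat) (hb : b%:Z = Num.ceil (Num.max 1 (B * T%:R `^ q)))
  (dO : measure_display) (Omega : measurableType dO) (Pr : probability Omega R)
  (P : nat -> Omega -> 'M[R]_(d, r)) (xi : nat -> 'I_b -> Omega -> Xi)
  (hP : forall k, is_haar_matrix Pr hr (P k))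
  (hxi : forall k j, has_law Pr (xi k j) D)
  (hind : mutually_independent Pr (draws_sigma P xi))
  (x0 : 'cV[R]_d) (x : nat -> Omega -> 'cV[R]_d)
  (hx : forall k w, x k w =
    rs_nsgd (fun y s => grad (fun z => f z s) y) (eta * T%:R `^ (- u)) x0
      (fun i => P i w) (fun i j => xi i j w) k)
  (Delta0 : R) (hDelta0 : Delta0 = F x0 - inf (range F)) :
  ((T%:R^-1)%:E * \sum_(k < T) 'E_Pr[fun w => norm2 (grad F (x k w))]
    <= (Delta0 / (tau R d r * eta * T%:R `^ (1 - u))
        + eta * ell r LL * opnorm LL / (2 * tau R d r * T%:R `^ u)
        + 4 * sigma
          / Num.max 1 (B * T%:R `^ q) `^ ((p - 1) / p))%R%:E)%E.
Proof.
have d0 : (0 < d)%N by exact: ltnW.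
have /andP[p1 p2] := hp.
pose gf (y : 'cV[R]_d) (s : Xi) := grad (fun z => f z s) y.
pose step : R := eta * T%:R `^ (- u).
have T0 : 0 < T%:R :> R by rewrite ltr0n.
have step_gt0 : 0 < step by rewrite mulr_gt0// powR_gt0.
have m_gF : measurable_fun setT (grad F) := lipschitz_measurable hL hF_smooth.
have mF : measurable_fun setT F.
  by apply: continuous_measurable_mx => y; exact: differentiable_continuous.
have Fmin y : inf (range F) <= F y by apply: ge_inf => //; exists y.
have gf_mean y i : (\int[D]_s (gf y s i ord0)%:E = (grad F y i ord0)%:E)%E.
  by rewrite -hg_mean unlock.
have gf_moment y : (\int[D]_s (norm2 (gf y s - grad F y) `^ p)%:E <= (sigma `^ p)%:E)%E.
  by have := hg_mom y; rewrite unlock.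
have mP k : measurable_fun setT (P k) by have [nu _ []] := hP k.
set m := Num.max 1 (B * T%:R `^ q).
have m1 : 1 <= m by rewrite le_max lexx.
have m0 : 0 < m by exact: lt_le_trans m1.
have mb : m <= b%:R.
  by have := ceil_ge m; rewrite -hb.
have b0R : 0 < b%:R :> R by exact: lt_le_trans mb.
have b0 : (0 < b)%N by rewrite -(ltr0n R).
have := @sum_gradient_norm_le R d r b dXi Xi D gf (grad F) step x0 hf_meas m_gF hg_int gf_mean
  p (sigma `^ p) hp gf_moment dO Omega Pr P xi mP hxi hind b0 F LL (inf (range F)) hF_LL Fmin
  hLL hLL0 mF hr hd hr1 hP (ltW step_gt0) T.
set tau_ := tau R d r; have tau0 : 0 < tau_ by exact: tau_gt0.
under eq_bigr => k _.
  rewrite (_ : (\int[Pr]_w _)%E = ('E_Pr[fun w => norm2 (grad F (x k w))])%E); last first.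
    by rewrite unlock; apply: eq_integral => w _; rewrite hx.
  over.
set s := (\sum_(k < T) _)%E; rewrite -hDelta0 => sum_le.
set A := (X in (_ <= X%:E)%E) in sum_le.
pose c := T%:R^-1 / (step * tau_).
have st0 : 0 < step * tau_ by exact: mulr_gt0.
have c0 : 0 <= c by apply/ltW/divr_gt0 => //; rewrite invr_gt0.
have -> : ((T%:R^-1)%:E * s = c%:E * ((step * tau_)%:E * s))%E.
  by rewrite muleA -EFinM /c divfK// gt_eqF.
apply: le_trans (lee_wpmul2l _ sum_le) _; first by rewrite lee_fin.
rewrite -EFinM lee_fin.
set N := opnorm LL; set l := ell r LL.
pose err : R := 2 * (b%:R * sigma `^ p) `^ p^-1 / b%:R.
have errE : err = 2 * sigma / b%:R `^ ((p - 1) / p).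
  rewrite /err powRM ?powR_ge0 ?ler0n// -[(sigma `^ p) `^ _]powRrM.
  rewrite divff ?gt_eqF ?(lt_trans _ p1)// powRr1//.
  have -> : (p - 1) / p = 1 - p^-1 by rewrite mulrBl mul1r divff ?gt_eqF ?(lt_trans _ p1).
  rewrite powRB ?(gt_eqF b0R) ?implybT// powRr1 ?ler0n// invf_div; ring.
(* The batch size is at least [m] and the exponent is nonnegative, so rounding up only helps. *)
have err_le : err <= 2 * sigma / m `^ ((p - 1) / p).
  rewrite errE ler_wpM2l ?mulr_ge0//.
  rewrite lef_pV2 ?posrE ?powR_gt0//; apply: ge0_ler_powR; rewrite ?nnegrE//.
  - by rewrite divr_ge0 ?subr_ge0//; apply/ltW; [exact: p1|exact: lt_trans p1].
  - exact: ltW.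
have AE : A = Delta0 + T%:R * (2 * step * tau_ * err + step ^+ 2 / 2 * (l * N)) by [].
have Tu : T%:R `^ u != 0 :> R by rewrite gt_eqF// powR_gt0.
have stepE : step = eta / T%:R `^ u by rewrite /step powRN.
have T1u : T%:R `^ (1 - u) = T%:R / T%:R `^ u :> R.
  by rewrite powRB ?(gt_eqF T0) ?implybT// powRr1// ltW.
(* Each step contributes [2 * step * tau_ * err] to [A]; dividing by [T * step * tau_] leaves
   [2 * err], and [err] itself contains a 2. *)
have -> : c * A = Delta0 / (tau_ * eta * T%:R `^ (1 - u)) +
    eta * l * N / (2 * tau_ * T%:R `^ u) + 2 * err.
  rewrite AE T1u /c stepE; field.
  by rewrite Tu (gt_eqF T0) (gt_eqF tau0) (gt_eqF heta).
rewrite lerD2l; have -> : 4 * sigma / m `^ ((p - 1) / p) =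
  2 * (2 * sigma / m `^ ((p - 1) / p)) by ring.
by rewrite ler_pM2l.
Qed.
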